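(* Let $\alpha_1,\alpha_2\in(0,2]\setminus\{1\}$ with $\alpha_1\ge\alpha_2$, and let $\beta_i=1-\frac{\alpha_i}{2}$ for $i=1,2$. For $\theta\in[0,1]$, $$\|D_1^{-\beta_1\theta}D_2^{-\beta_2\theta}U(t)f\|_{L^{\frac{2}{1-\theta}}(\mathbb{R}^2)}\lesssim|t|^{-\theta}\|f\|_{L^{\frac{2}{1+\theta}}(\mathbb{R}^2)}$$ for all $t\neq0$ and all $f$.
   Context: $D_1^a$, $D_2^a$ are the Fourier multipliers on $\mathbb{R}^2$ with symbols $|\xi|^a$, $|\eta|^a$ ($(\xi,\eta)$ dual to $(x,y)$), and $U(t)=e^{-it(D_1^{\alpha_1}+D_2^{\alpha_2})}$. Operators are defined a priori on Schwartz functions $f$ and extended by density where applicable. For $\theta=1$, $\frac{2}{1-\theta}$ is read as $\infty$. The implicit constant may depend on $\alpha_1,\alpha_2$ (and $\theta$), but not on $t$ or $f$. *)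

(* Defs.v *)
From HB Require Import structures.
From mathcomp Require Import all_boot all_order all_algebra complex.
From mathcomp Require Import all_classical all_reals all_analysis.

Set Implicit Arguments.
Unset Strict Implicit.
Unset Printing Implicit Defensive.

Import Order.TTheory GRing.Theory Num.Theory.
Import numFieldNormedType.Exports.

Local Open Scope classical_set_scope.
Local Open Scope ring_scope.
Local Open Scope complex_scope.

Section Plane.
Variable R : realType.

(* The Borel structure on the plane; both the space and the frequency variables
   range over it. *)
Definition plane : Type := (measurableTypeR R * measurableTypeR R)%type.

Definition leb2 : {measure set (measurableTypeR R * measurableTypeR R) -> \bar R} :=
  (lebesgue_measure \x lebesgue_measure)%E.

Definition expi (x : R) : R[i] := cos x +i* sin x.

(* Meaningful when the real and imaginary parts of [F] are integrable;
   [Rintegral] is total. *)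
Definition cintegral (F : plane -> R[i]) : R[i] :=
  Rintegral leb2 setT (fun z => complex.Re (F z))
  +i* Rintegral leb2 setT (fun z => complex.Im (F z)).

Definition cmeasurable (F : plane -> R[i]) : Prop :=
  measurable_fun [set: measurableTypeR R * measurableTypeR R]
    (fun z => complex.Re (F z)) /\
  measurable_fun [set: measurableTypeR R * measurableTypeR R]
    (fun z => complex.Im (F z)).

Definition cLnorm (p : \bar R) (F : plane -> R[i]) : \bar R :=
  Lnorm leb2 p (fun z => (ComplexField.Normc.normc (F z))%:E).

(* [true] differentiates in the first variable, [false] in the second one. *)
Definition dir (b : bool) : R * R := if b then (1, 0) else (0, 1).

Fixpoint pderiv (w : seq bool) (u : R * R -> R) : R * R -> R :=
  if w is b :: w' then fun z => 'D_(dir b) (pderiv w' u) z else u.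

(* ['D_v] is total, so differentiability has to be required separately. *)
Definition smooth (u : R * R -> R) : Prop :=
  forall w : seq bool, continuous (pderiv w u) /\
    forall (b : bool) (z : R * R), derivable (pderiv w u) z (dir b).

Definition rschwartz (u : R * R -> R) : Prop :=
  smooth u /\
  forall (m n : nat) (w : seq bool), exists M : R, forall z : R * R,
    `|z.1 ^+ m * z.2 ^+ n * pderiv w u z| <= M.

Definition schwartz (f : plane -> R[i]) : Prop :=
  rschwartz (fun z => complex.Re (f z)) /\
  rschwartz (fun z => complex.Im (f z)).

Definition pairing (z zeta : plane) : R := z.1 * zeta.1 + z.2 * zeta.2.

Definition fourier (f : plane -> R[i]) (zeta : plane) : R[i] :=
  cintegral (fun z => expi (- pairing z zeta) * f z).

Definition inv_fourier (g : plane -> R[i]) (z : plane) : R[i] :=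
  ((2 * pi) ^- 2)%:C * cintegral (fun zeta => expi (pairing z zeta) * g zeta).

Definition multiplier (m : plane -> R[i]) (f : plane -> R[i]) : plane -> R[i] :=
  inv_fourier (fun zeta => m zeta * fourier f zeta).

(* For [a < 0] the library sets [0 `^ a = 0]; this affects the symbols only on
   a null set. *)
Definition D1_symbol (a : R) (zeta : plane) : R[i] := (`|zeta.1| `^ a)%:C.

Definition D2_symbol (a : R) (zeta : plane) : R[i] := (`|zeta.2| `^ a)%:C.

Definition U_symbol (alpha1 alpha2 t : R) (zeta : plane) : R[i] :=
  expi (- (t * (`|zeta.1| `^ alpha1 + `|zeta.2| `^ alpha2))).

(* D_1^{-b1} D_2^{-b2} U(t) as one Fourier multiplier: the intermediate
   functions are not Schwartz, so the composition is taken on the symbols.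
   For [b1 < 1] and [b2 < 1] the symbol is locally integrable and the inverse
   Fourier integral converges absolutely on Schwartz functions. *)
Definition smoothed_propagator (alpha1 alpha2 b1 b2 t : R) :
    (plane -> R[i]) -> plane -> R[i] :=
  multiplier (fun zeta => D1_symbol (- b1) zeta * D2_symbol (- b2) zeta
                          * U_symbol alpha1 alpha2 t zeta).

(* [density_extension p q T f g]: g is the value at f of the extension by
   density of T, given on Schwartz functions, to an operator from L^p to L^q. *)
Definition density_extension (p q : \bar R)
    (T : (plane -> R[i]) -> plane -> R[i]) (f g : plane -> R[i]) : Prop :=
  [/\ cmeasurable f, (cLnorm p f < +oo)%E, cmeasurable g &
    exists fn : nat -> plane -> R[i],
      [/\ forall n, schwartz (fn n),
          (fun n => cLnorm p (fun z => fn n z - f z)) @ \oo --> (0 : \bar R)%E &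
          (fun n => cLnorm q (fun z => T (fn n) z - g z)) @ \oo
            --> (0 : \bar R)%E]].

Definition source_exponent (theta : R) : \bar R := (2 / (1 + theta))%:E.

Definition target_exponent (theta : R) : \bar R :=
  if theta == 1 then +oo%E else (2 / (1 - theta))%:E.

End Plane.

(* Main.v *)
Require Import Defs.
From HB Require Import structures.
From mathcomp Require Import all_boot all_order all_algebra complex.
From mathcomp Require Import all_classical all_reals all_analysis.
From mathcomp Require Import measurable_realfun ess_sup_inf ring lra.

(** The estimate interpolates between two bounds for the family of operators with symbol
    [|zeta1|^(-b1 z) |zeta2|^(-b2 z) exp (- i t (|zeta1|^alpha1 + |zeta2|^alpha2))], where
    [b_i = 1 - alpha_i / 2] and [z] is complex.  For [Re z = 0] the symbol has modulus one and
    the operator is bounded on L^2.  For [Re z = 1] it maps L^1 to L^oo, because its kernel is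
    bounded by a multiple of [(1 + |Im z|)^2 / |t|]; this kernel is a product of two
    one-dimensional ones, each of order [|t|^(-1/2)].

    The one-dimensional bound ([kernel_halfline], [kernel_plane]) rests on the choice of the
    weight: [s^(- (1 - alpha / 2)) ds] is a multiple of [|t|^(-1/2) du] for
    [u = |t|^(1/2) s^(alpha/2)].  In this variable the dispersive phase is [u^2], and the linear
    phase is a multiple of [u^(2/alpha)].  As [alpha] differs from one, the two powers differ,
    so the phase has at most one stationary point.  Away from its unit neighbourhood an
    integration by parts gives a bound that does not depend on the linear phase ([osc_bound]);
    near it the length of the interval is a sufficient bound.

    The interpolation ([three_lines]) is carried out on real integrals.  Take a pairing
    [int A exp (z lam) exp (i om)] with real [A], [lam] and [om].  Its values on the lines
    [Re z = 0] and [Re z = 1] are the integrals of [A cos (om + y lam + c)] and of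
    [A exp lam cos (om + y lam + c)].  Averaging over [y] against a Gaussian confines [lam] to a
    neighbourhood of a number [r] ([gauss_localization]).  There [exp (theta lam)] is about
    [exp (theta r)], and also about [exp ((theta - 1) r)] times [exp lam]; so this part of the
    integral can be bounded from either line, at the price of the respective factor.  The smaller
    of the two factors is integrable in [r], and the average over [r] restores the full
    integral.

    With bounded functions on sets of finite measure and frequencies away from the axes and from
    infinity, the two edge bounds are [edge_L2], an instance of Bessel's inequality, and
    [edge_L1]; [bform_bound] is the interpolated bound for the bilinear form.  The truncations
    disappear by dominated convergence, since integrations by parts make the Fourier transform
    of a Schwartz function decay fast enough ([cosint_decay], [pairing_bound]).  The bound on the
    norm follows by [duality], first for real functions, then for complex ones
    ([smoothed_propagatorE], [smoothed_cLnorm]), and Minkowski's inequality carries it over to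
    the extension by density ([density_bound]). *)

Set Implicit Arguments.
Unset Strict Implicit.
Unset Printing Implicit Defensive.

Import Order.TTheory GRing.Theory Num.Theory.
Import numFieldNormedType.Exports.

Local Open Scope classical_set_scope.
Local Open Scope ring_scope.

(** * Bounded measurable functions and Fubini's theorem *)

Section BoundedMeasurable.
Context {R : realType}.

(** Globally measurable but bounded on [D] only: products, sections and partial integrals of
    such functions stay in the class, and they are integrable when [D] has finite measure. *)
Definition bm d (T : measurableType d) (D : set T) (f : T -> R) : Prop :=
  measurable_fun [set: T] f /\ exists M, forall x, D x -> `|f x| <= M.

Section ops.
Context d (T : measurableType d) (D : set T).
Implicit Types f g : T -> R.

Lemma bm_le1 f : measurable_fun [set: T] f -> (forall x, `|f x| <= 1) -> bm D f.
Proof. by move=> mf f1; split=> //; exists 1 => x _. Qed.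

Lemma bm_cst r : bm D (fun=> r).
Proof. by split; [exact: measurable_cst|exists `|r|]. Qed.

Lemma bmD f g : bm D f -> bm D g -> bm D (fun x => f x + g x).
Proof.
move=> [mf [M fM]] [mg [N gN]]; split; first exact: measurable_funD.
exists (M + N) => x Dx; apply: (le_trans (ler_normD _ _)).
by apply: lerD; [exact: fM|exact: gN].
Qed.

Lemma bmM f g : bm D f -> bm D g -> bm D (fun x => f x * g x).
Proof.
move=> [mf [M fM]] [mg [N gN]]; split; first exact: measurable_funM.
exists (M * N) => x Dx; rewrite normrM.
by apply: ler_pM => //; [exact: fM|exact: gN].
Qed.

Lemma bm_norm f : bm D f -> bm D (fun x => `|f x|).
Proof.
move=> [mf [M fM]]; split; first exact: measurableT_comp.
by exists M => x Dx; rewrite normr_id; exact: fM.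
Qed.

Lemma bm_cos f : measurable_fun [set: T] f -> bm D (fun x => cos (f x)).
Proof.
move=> mf; apply: bm_le1; last by move=> x; rewrite ler_norml cos_geN1 cos_le1.
apply: measurableT_comp => //; apply: continuous_measurable_fun.
exact: continuous_cos.
Qed.

Lemma bm_sin f : measurable_fun [set: T] f -> bm D (fun x => sin (f x)).
Proof.
move=> mf; apply: bm_le1; last by move=> x; rewrite ler_norml sin_geN1 sin_le1.
apply: measurableT_comp => //; apply: continuous_measurable_fun.
exact: continuous_sin.
Qed.

Variable mu : {measure set T -> \bar R}.
Hypothesis mD : measurable D.
Hypothesis muD : (mu D < +oo)%E.

Lemma bm_integrable f : bm D f -> mu.-integrable D (EFin \o f).
Proof.
move=> [mf [M fM]]; apply/integrableP; split.
  by apply/measurable_EFinP; exact: measurable_funTS.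
apply: (@le_lt_trans _ _ (\int[mu]_(x in D) (cst `|M|%:E x))%E).
  apply: ge0_le_integral => //.
  - by apply/measurable_EFinP; apply: measurableT_comp => //; exact: measurable_funTS.
  - by move=> x Dx /=; rewrite lee_fin (le_trans (fM _ Dx)) // ler_norm.
rewrite integral_cst //=; by apply: lte_mul_pinfty.
Qed.

End ops.

Lemma bm_comp d (T : measurableType d) d' (T' : measurableType d')
    (D : set T) (E : set T') (f : T -> R) (h : T' -> T) :
  measurable_fun [set: T'] h -> (forall y, E y -> D (h y)) ->
  bm D f -> bm E (fun y => f (h y)).
Proof.
move=> mh ED [mf [M fM]]; split; first exact: (measurableT_comp mf mh).
by exists M => y /ED; exact: fM.
Qed.

Section fub.
Context d1 d2 (T1 : measurableType d1) (T2 : measurableType d2).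
Variable m1 : {sigma_finite_measure set T1 -> \bar R}.
Variable m2 : {sigma_finite_measure set T2 -> \bar R}.
Variables (D : set T1) (E : set T2).
Hypotheses (mD : measurable D) (mE : measurable E).
Hypotheses (fD : (m1 D < +oo)%E) (fE : (m2 E < +oo)%E).

Lemma bm_fst (f : T1 -> R) : bm D f -> bm (D `*` E) (fun z => f z.1).
Proof. by apply: bm_comp => // -[x y] []. Qed.

Lemma bm_snd (f : T2 -> R) : bm E f -> bm (D `*` E) (fun z => f z.2).
Proof. by apply: bm_comp => // -[x y] []. Qed.

Lemma bm_section1 (f : T1 * T2 -> R) x : D x -> bm (D `*` E) f -> bm E (fun y => f (x, y)).
Proof. by move=> Dx; apply: bm_comp => //. Qed.

Lemma bm_section2 (f : T1 * T2 -> R) y : E y -> bm (D `*` E) f -> bm D (fun x => f (x, y)).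
Proof. by move=> Ey; apply: bm_comp => //. Qed.

Lemma finite_measureX : ((m1 \x m2)%E (D `*` E) < +oo)%E.
Proof.
rewrite product_measure1E//; apply: lte_mul_pinfty => //.
by rewrite ge0_fin_numE.
Qed.

End fub.

Section Rint.
Context d (T : measurableType d) (mu : {measure set T -> \bar R}).
Implicit Types D : set T.

Lemma Rintegral_indic D (f : T -> R) :
  \int[mu]_(x in D) f x = \int[mu]_x (f x * \1_D x).
Proof.
rewrite Rintegral_mkcond; apply: eq_Rintegral => x _.
by rewrite patchE indicE; case: ifPn => _; rewrite ?mulr1 ?mulr0.
Qed.

Lemma integrable_indicM D (f : T -> R) : measurable D ->
  mu.-integrable D (EFin \o f) ->
  mu.-integrable [set: T] (fun x => (f x * \1_D x)%:E).
Proof.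
move=> mD /(integrable_mkcond _ mD).1; apply: eq_integrable => // x _ /=.
by rewrite patchE indicE /=; case: ifPn => _; rewrite ?mulr1 ?mulr0.
Qed.

Lemma measurable_indicM D (f : T -> R) : measurable D ->
  measurable_fun [set: T] f -> measurable_fun [set: T] (fun x => f x * \1_D x).
Proof. by move=> mD mf; apply: measurable_funM => //; exact: measurable_indic. Qed.

Lemma Rint_le D (f g : T -> R) : measurable D ->
  mu.-integrable D (EFin \o f) -> mu.-integrable D (EFin \o g) ->
  (forall x, D x -> f x <= g x) ->
  \int[mu]_(x in D) f x <= \int[mu]_(x in D) g x.
Proof. by move=> mD f_ g_ fg; apply: le_Rintegral => // x; rewrite inE; exact: fg. Qed.

Lemma normr_Rint_le D (f g : T -> R) : measurable D ->
  mu.-integrable D (EFin \o f) -> mu.-integrable D (EFin \o g) ->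
  (forall x, D x -> `|f x| <= g x) ->
  `|\int[mu]_(x in D) f x| <= \int[mu]_(x in D) g x.
Proof.
move=> mD f_ g_ fg; apply: le_trans (le_normr_Rintegral mD f_) _.
by apply: Rint_le => //; exact: (integrable_norm f_).
Qed.

End Rint.

Section fub2.
Context d1 d2 (T1 : measurableType d1) (T2 : measurableType d2).
Variable m1 : {sigma_finite_measure set T1 -> \bar R}.
Variable m2 : {sigma_finite_measure set T2 -> \bar R}.

Lemma measurable_Rint (E : set T2) (f : T1 * T2 -> R) : measurable E ->
  measurable_fun [set: T1 * T2] f ->
  measurable_fun [set: T1] (fun x => \int[m2]_(y in E) f (x, y)).
Proof.
move=> mE mf.
pose g z := (f z * \1_E z.2)%:E : \bar R.
have mg : measurable_fun [set: T1 * T2] g.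
  apply/measurable_EFinP/measurable_funM => //.
  by apply: (@measurableT_comp _ _ _ _ _ _ (\1_E : T2 -> R) _ snd).
have -> : (fun x => \int[m2]_(y in E) f (x, y)) =
    fine \o ((fun x => \int[m2]_y g^\+ (x, y)) \- (fun x => \int[m2]_y g^\- (x, y)))%E.
  apply/funext => x; rewrite Rintegral_indic /Rintegral /= integralE.
  congr (fine (_ - _)%E); apply: eq_integral => y _.
    by rewrite -[RHS]/((g^\+ \o pair x)%E y) -funepos_comp.
  by rewrite -[RHS]/((g^\- \o pair x)%E y) -funeneg_comp.
apply: (@measurableT_comp _ _ _ _ _ _ (@fine R)); first exact: fine_measurable.
apply: emeasurable_funB.
- by apply: (measurable_fun_fubini_tonelli_F g^\+%E) => //; exact: measurable_funepos.
- by apply: (measurable_fun_fubini_tonelli_F g^\-%E) => //; exact: measurable_funeneg.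
Qed.

Lemma Rint_prod (D : set T1) (E : set T2) (f : T1 * T2 -> R) :
  measurable D -> measurable E -> measurable_fun [set: T1 * T2] f ->
  (m1 \x m2)%E.-integrable (D `*` E) (EFin \o f) ->
  \int[(m1 \x m2)%E]_(z in D `*` E) f z =
  \int[m1]_(x in D) \int[m2]_(y in E) f (x, y).
Proof.
move=> mD mE mf intf.
have mDE : measurable (D `*` E) by exact: measurableX.
have intg := integrable_indicM mDE intf.
have ind x y : \1_(D `*` E) (x, y) = \1_D x * \1_E y :> R.
  by rewrite !indicE in_setX; case: (x \in D); case: (y \in E); rewrite ?mulr1 ?mulr0.
rewrite Rintegral_indic [RHS]Rintegral_indic /Rintegral.
rewrite -(integral12_prod_meas1 intg); congr fine.
apply: ae_eq_integral => //.
- exact: (measurable_fubini_F intg).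
- apply/measurable_EFinP/measurable_indicM => //.
  exact: (measurable_Rint mE mf).
- have := ae_integrable1 intg; apply: filterS => x /= intx _.
  have -> : (\int[m2]_(y in E) f (x, y)) * \1_D x =
      \int[m2]_y (f (x, y) * \1_(D `*` E) (x, y)).
    rewrite [in LHS]Rintegral_indic.
    under [in RHS]eq_Rintegral do rewrite ind.
    rewrite indicE; case: (x \in D) => /=.
      by rewrite mulr1; apply: eq_Rintegral => y _; rewrite mul1r.
    rewrite mulr0; under eq_Rintegral do rewrite mul0r mulr0.
    by rewrite Rintegral_cst // mul0r.
  by rewrite /fubini_F /Rintegral fineK //; exact: integrable_fin_num.
Qed.

Lemma measurable_Rint2 (D : set T1) (f : T1 * T2 -> R) : measurable D ->
  measurable_fun [set: T1 * T2] f ->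
  measurable_fun [set: T2] (fun y => \int[m1]_(x in D) f (x, y)).
Proof.
move=> mD mf.
pose g z := (f z * \1_D z.1)%:E : \bar R.
have mg : measurable_fun [set: T1 * T2] g.
  apply/measurable_EFinP/measurable_funM => //.
  by apply: (@measurableT_comp _ _ _ _ _ _ (\1_D : T1 -> R) _ fst).
have -> : (fun y => \int[m1]_(x in D) f (x, y)) =
    fine \o ((fun y => \int[m1]_x g^\+ (x, y)) \- (fun y => \int[m1]_x g^\- (x, y)))%E.
  apply/funext => y; rewrite Rintegral_indic /Rintegral /= integralE.
  congr (fine (_ - _)%E); apply: eq_integral => x _.
    by rewrite -[RHS]/((g^\+ \o (pair ^~ y))%E x) -funepos_comp.
  by rewrite -[RHS]/((g^\- \o (pair ^~ y))%E x) -funeneg_comp.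
apply: (@measurableT_comp _ _ _ _ _ _ (@fine R)); first exact: fine_measurable.
apply: emeasurable_funB.
- by apply: (measurable_fun_fubini_tonelli_G g^\+%E) => //; exact: measurable_funepos.
- by apply: (measurable_fun_fubini_tonelli_G g^\-%E) => //; exact: measurable_funeneg.
Qed.

Lemma Rint_prod2 (D : set T1) (E : set T2) (f : T1 * T2 -> R) :
  measurable D -> measurable E -> measurable_fun [set: T1 * T2] f ->
  (m1 \x m2)%E.-integrable (D `*` E) (EFin \o f) ->
  \int[(m1 \x m2)%E]_(z in D `*` E) f z =
  \int[m2]_(y in E) \int[m1]_(x in D) f (x, y).
Proof.
move=> mD mE mf intf.
have mDE : measurable (D `*` E) by exact: measurableX.
have intg := integrable_indicM mDE intf.
have ind x y : \1_(D `*` E) (x, y) = \1_D x * \1_E y :> R.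
  by rewrite !indicE in_setX; case: (x \in D); case: (y \in E); rewrite ?mulr1 ?mulr0.
rewrite Rintegral_indic [RHS]Rintegral_indic /Rintegral.
rewrite -(integral21_prod_meas1 intg); congr fine.
apply: ae_eq_integral => //.
- exact: (measurable_fubini_G intg).
- apply/measurable_EFinP/measurable_indicM => //.
  exact: (measurable_Rint2 mD mf).
- have := ae_integrable2 intg; apply: filterS => y /= inty _.
  have -> : (\int[m1]_(x in D) f (x, y)) * \1_E y =
      \int[m1]_x (f (x, y) * \1_(D `*` E) (x, y)).
    rewrite [in LHS]Rintegral_indic.
    under [in RHS]eq_Rintegral do rewrite ind.
    rewrite [\1_E y]indicE; case: (y \in E) => /=.
      by rewrite mulr1; apply: eq_Rintegral => x _; rewrite mulr1.
    rewrite mulr0; under eq_Rintegral do rewrite !mulr0.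
    by rewrite Rintegral_cst // mul0r.
  by rewrite /fubini_G /Rintegral fineK //; exact: integrable_fin_num.
Qed.

Section finite_sets.
Variables (D : set T1) (E : set T2).
Hypotheses (mD : measurable D) (mE : measurable E).
Hypotheses (fD : (m1 D < +oo)%E) (fE : (m2 E < +oo)%E).

Lemma bm_integrableX f : bm (D `*` E) f ->
  (m1 \x m2)%E.-integrable (D `*` E) (EFin \o f).
Proof.
move=> bf; apply: bm_integrable => //; first exact: measurableX.
exact: finite_measureX.
Qed.

Lemma Rint_prod_bm f : bm (D `*` E) f ->
  \int[(m1 \x m2)%E]_(z in D `*` E) f z = \int[m1]_(x in D) \int[m2]_(y in E) f (x, y).
Proof. by move=> bf; apply: Rint_prod => //; [case: bf|exact: bm_integrableX]. Qed.

Lemma Rint_prod2_bm f : bm (D `*` E) f ->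
  \int[(m1 \x m2)%E]_(z in D `*` E) f z = \int[m2]_(y in E) \int[m1]_(x in D) f (x, y).
Proof. by move=> bf; apply: Rint_prod2 => //; [case: bf|exact: bm_integrableX]. Qed.

Lemma bm_Rint f : bm (D `*` E) f -> bm D (fun x => \int[m2]_(y in E) f (x, y)).
Proof.
move=> bf; split; first exact: (measurable_Rint mE bf.1).
have [mf [M fM]] := bf; exists (fine (`|M|%:E * m2 E)%E) => x Dx.
have bfx : bm E (fun y => f (x, y)) by exact: bm_section1 Dx bf.
rewrite fineM //; last by rewrite ge0_fin_numE.
rewrite -Rintegral_cst //; apply: normr_Rint_le => //.
- exact: bm_integrable.
- by apply: bm_integrable => //; exact: bm_cst.
- by move=> y Ey; rewrite (le_trans (fM _ _)) //= ler_norm.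
Qed.

Lemma bm_Rint2 f : bm (D `*` E) f -> bm E (fun y => \int[m1]_(x in D) f (x, y)).
Proof.
move=> bf; split; first exact: (measurable_Rint2 mD bf.1).
have [mf [M fM]] := bf; exists (fine (`|M|%:E * m1 D)%E) => y Ey.
have bfx : bm D (fun x => f (x, y)) by exact: bm_section2 Ey bf.
rewrite fineM //; last by rewrite ge0_fin_numE.
rewrite -Rintegral_cst //; apply: normr_Rint_le => //.
- exact: bm_integrable.
- by apply: bm_integrable => //; exact: bm_cst.
- by move=> x Dx; rewrite (le_trans (fM _ _)) //= ler_norm.
Qed.

Lemma Rint_mulX (a : T1 -> R) (b : T2 -> R) : bm D a -> bm E b ->
  \int[(m1 \x m2)%E]_(z in D `*` E) (a z.1 * b z.2) =
  (\int[m1]_(x in D) a x) * (\int[m2]_(y in E) b y).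
Proof.
move=> ba bb; rewrite Rint_prod_bm; last first.
  by apply: bmM; [exact: bm_fst|exact: bm_snd].
under eq_Rintegral => x _ do rewrite /= RintegralZl ?bm_integrable //.
by rewrite RintegralZr // bm_integrable.
Qed.

Lemma Rint_cosD (a A : T1 -> R) (b B : T2 -> R) :
  bm D a -> bm E b -> measurable_fun [set: T1] A -> measurable_fun [set: T2] B ->
  \int[(m1 \x m2)%E]_(z in D `*` E) (a z.1 * b z.2 * cos (A z.1 + B z.2)) =
  (\int[m1]_(x in D) (a x * cos (A x))) * (\int[m2]_(y in E) (b y * cos (B y))) -
  (\int[m1]_(x in D) (a x * sin (A x))) * (\int[m2]_(y in E) (b y * sin (B y))).
Proof.
move=> ba bb mA mB.
have mDE : measurable (D `*` E) by exact: measurableX.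
have bac : bm D (fun x => a x * cos (A x)) by apply: bmM => //; exact: bm_cos.
have bas : bm D (fun x => a x * sin (A x)) by apply: bmM => //; exact: bm_sin.
have bbc : bm E (fun x => b x * cos (B x)) by apply: bmM => //; exact: bm_cos.
have bbs : bm E (fun x => b x * sin (B x)) by apply: bmM => //; exact: bm_sin.
rewrite -Rint_mulX // -Rint_mulX // -RintegralB //.
- by apply: eq_Rintegral => -[x y] _ /=; rewrite cosD; ring.
- by apply: bm_integrableX; exact: (bmM (bm_fst E bac) (bm_snd D bbc)).
- by apply: bm_integrableX; exact: (bmM (bm_fst E bas) (bm_snd D bbs)).
Qed.

(** A product of two real oscillatory integrals is handled with both [cos] and [sin]; the free
    phase shift in the hypotheses covers the two at once. *)
Lemma normr_Rint_cosD (a A : T1 -> R) (b B : T2 -> R) (M N : R) :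
  bm D a -> bm E b -> measurable_fun [set: T1] A -> measurable_fun [set: T2] B ->
  (forall c, `|\int[m1]_(x in D) (a x * cos (A x + c))| <= M) ->
  (forall c, `|\int[m2]_(y in E) (b y * cos (B y + c))| <= N) ->
  `|\int[(m1 \x m2)%E]_(z in D `*` E) (a z.1 * b z.2 * cos (A z.1 + B z.2))|
    <= 2 * (M * N).
Proof.
move=> ba bb mA mB hM hN; rewrite Rint_cosD //.
have hM0 := hM 0; have hN0 := hN 0.
have hMs := hM (- (pi / 2)); have hNs := hN (- (pi / 2)).
move: hM0 hN0 hMs hNs.
under eq_Rintegral do rewrite addr0.
under [in X in _ -> X -> _]eq_Rintegral do rewrite addr0.
under [in X in _ -> _ -> X -> _]eq_Rintegral do rewrite cosBpihalf.
under [in X in _ -> _ -> _ -> X -> _]eq_Rintegral do rewrite cosBpihalf.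
move=> hM0 hN0 hMs hNs.
apply: (le_trans (ler_normB _ _)); rewrite !normrM mulr_natl mulr2n.
by apply: lerD; apply: ler_pM.
Qed.

End finite_sets.
End fub2.
End BoundedMeasurable.

(** * Calculus on the real line *)

Section Calculus.
Context {R : realType}.
Notation mu := (@lebesgue_measure R).

Lemma derivable_continuous (f : R -> R) (x : R) :
  derivable f x 1 -> {for x, continuous f}.
Proof. by move=> df; apply: differentiable_continuous; apply/derivable1_diffP. Qed.

Lemma itv_lt_pinfty (a b : R) : (mu `[a, b]%classic < +oo)%E.
Proof. by rewrite lebesgue_measure_itv /=; case: ifP => // _; rewrite -EFinB ltry. Qed.

Lemma continuous_itv_integrable (f : R -> R) (a b : R) :
  (forall x, a <= x <= b -> {for x, continuous f}) ->
  mu.-integrable `[a, b] (EFin \o f).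
Proof.
move=> cf; apply: continuous_compact_integrable; first exact: segment_compact.
by apply: continuous_in_subspaceT => x; rewrite inE /= in_itv; exact: cf.
Qed.

Lemma Rint_FTC (F f : R -> R) (a b : R) : a <= b ->
  (forall x, a <= x <= b -> is_derive x 1 F (f x)) ->
  (forall x, a <= x <= b -> {for x, continuous f}) ->
  \int[mu]_(x in `[a, b]) f x = F b - F a.
Proof.
move=> ab dF cf; move: ab; rewrite le_eqVlt => /predU1P[<-|ab].
  by rewrite set_itv1 Rintegral_set1 subrr.
have cF x : a <= x <= b -> {for x, continuous F}.
  by move=> /dF h; apply: derivable_continuous; apply: ex_derive.
rewrite /Rintegral (@continuous_FTC2 _ _ F) //.
- by apply: continuous_in_subspaceT => x; rewrite inE /= in_itv; exact: cf.
- split.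
  + by move=> x; rewrite in_itv /= => /andP[ax xb]; apply: ex_derive; apply: dF; rewrite !ltW.
  + by apply: cvg_at_right_filter; apply: cF; rewrite lexx ltW.
  + by apply: cvg_at_left_filter; apply: cF; rewrite lexx ltW.
- move=> x; rewrite in_itv /= => /andP[ax xb]; rewrite derive1E.
  by apply: derive_val; apply: dF; rewrite !ltW.
Qed.

Lemma Rint_dominated_cvg d (T : measurableType d) (nu : {measure set T -> \bar R})
    (D : set T) (f_ : nat -> T -> R) (f g : T -> R) :
  measurable D -> (forall n, measurable_fun D (f_ n)) ->
  (forall x, D x -> f_ ^~ x @ \oo --> f x) ->
  nu.-integrable D (EFin \o g) -> (forall n x, D x -> `|f_ n x| <= g x) ->
  (fun n => \int[nu]_(x in D) f_ n x) @ \oo --> \int[nu]_(x in D) f x.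
Proof.
move=> mD mf cf ig fg.
have [|||||intf _ cvgf] := @dominated_convergence _ _ _ nu D mD
    (fun n => EFin \o f_ n) (EFin \o f) (EFin \o g).
- by move=> n; apply/measurable_EFinP.
- by apply/measurable_EFinP; apply: (measurable_fun_cvg mf).
- apply/aeW => x Dx; apply: cvg_EFin; first exact: nearW.
  exact: cf.
- exact: ig.
- by apply/aeW => x n Dx; rewrite lee_fin fg.
- by apply: fine_cvg; rewrite /Rintegral fineK //; exact: integrable_fin_num.
Qed.

Lemma integral_oneDsqr :
  (\int[mu]_x ((1 + x ^+ 2)^-1)%:E)%E = pi%:E.
Proof.
rewrite ge0_symfun_integralT//=.
- rewrite (_ : [set x | _] = `[0, +oo[%classic); last first.
    by apply/seteqP; split => x/=; rewrite in_itv/= andbT.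
  by rewrite integral0y_oneDsqr -EFinM mulrCA divff// mulr1.
- by move=> x; rewrite invr_ge0 addr_ge0 // sqr_ge0.
- by move=> x; exact: continuous_oneDsqrV.
- by move=> x/=; rewrite sqrrN.
Qed.

Lemma integral_affine (G : R -> R) (M x0 : R) : 0 < M -> continuous G -> (forall x, 0 <= G x) ->
  (\int[mu]_x (M * G (M * (x - x0)))%:E = \int[mu]_x (G x)%:E)%E.
Proof.
move=> M0 cG G0.
have dF (x : R) : is_derive x 1 (fun x => M * (x - x0)) M.
  by apply: is_derive_eq; rewrite subr0 /GRing.scale /= mulr1.
have dF1 : derive1 (fun x => M * (x - x0)) = cst M.
  by apply/funext => x; rewrite derive1E; apply: derive_val.
rewrite [RHS](@increasing_ge0_integration_by_substitutionT _ (fun x => M * (x - x0))) //.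
- by apply: eq_integral => x _; rewrite dF1 /= mulrC.
- by move=> x y xy; rewrite ltr_pM2l // ltrD2r.
- by rewrite dF1; exact: cst_continuous.
- by rewrite dF1; apply: is_cvg_cst.
- by rewrite dF1; apply: is_cvg_cst.
- apply/cvgrNyPle => A; exists (x0 + A / M); split; first exact: num_real.
  by move=> x /= /ltW; rewrite -lerBlDl ler_pdivlMr // mulrC.
- apply/cvgryPge => A; exists (x0 + A / M); split; first exact: num_real.
  by move=> x /= /ltW; rewrite -lerBrDl ler_pdivrMr // mulrC.
Qed.

Lemma oneDsqr_pos (x : R) : 0 < 1 + x ^+ 2.
Proof. by rewrite ltr_pwDl // sqr_ge0. Qed.

Lemma measurable_oneDsqrV : measurable_fun [set: R] (fun x : R => (1 + x ^+ 2)^-1).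
Proof. by apply: continuous_measurable_fun; exact: continuous_oneDsqrV. Qed.

Lemma integrable_oneDsqrV : mu.-integrable [set: R] (EFin \o (fun x : R => (1 + x ^+ 2)^-1)).
Proof.
apply/integrableP; split.
  by apply/measurable_EFinP; exact: measurable_oneDsqrV.
under eq_integral => x _ do rewrite gee0_abs ?lee_fin ?invr_ge0 ?ltW ?oneDsqr_pos //.
by rewrite integral_oneDsqr ltry.
Qed.

Lemma integrable_dominated d (T : measurableType d) (nu : {measure set T -> \bar R})
    (D : set T) (f g : T -> R) : measurable D ->
  measurable_fun D f -> (forall x, D x -> `|f x| <= g x) ->
  nu.-integrable D (EFin \o g) -> nu.-integrable D (EFin \o f).
Proof.
move=> mD mf fg; apply: le_integrable => //; first exact/measurable_EFinP.
move=> x Dx /=; rewrite lee_fin (le_trans (fg _ Dx)) //; exact: ler_norm.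
Qed.

Lemma integrableMl_cst d (T : measurableType d) (nu : {measure set T -> \bar R})
    (D : set T) (f : T -> R) (r : R) : measurable D ->
  nu.-integrable D (EFin \o f) -> nu.-integrable D (EFin \o (fun x => r * f x)).
Proof.
by move=> mD /(integrableZl mD r); apply: eq_integrable.
Qed.

Lemma cvg_oneDsqrV_nat (M : R) : (fun n : nat => M / (1 + n%:R ^+ 2)) @ \oo --> (0 : R).
Proof.
rewrite -(mulr0 M); apply: cvgM; first exact: cvg_cst.
apply: (@squeeze_cvgr _ _ _ _ (cst 0) (@harmonic R)).
- apply: nearW => n /=; rewrite invr_ge0 ltW ?oneDsqr_pos //=.
  rewrite lef_pV2 ?posrE ?oneDsqr_pos //.
  rewrite -natrX -[1]/(1%:R) -natrD ler_nat add1n ltnS.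
  by case: n => // n; rewrite expnS expn1 leq_pmulr.
- exact: cvg_cst.
- exact: cvg_harmonic.
Qed.

(** Integration by parts on the whole line, in the form needed for functions that decay like
    [(1 + x^2)^-1]. *)
Lemma Rint_deriv0 (h h' : R -> R) (M : R) :
  (forall x : R, is_derive x (1 : R) h (h' x)) -> continuous h' ->
  mu.-integrable [set: R] (EFin \o h') ->
  (forall x, `|h x| <= M / (1 + x ^+ 2)) -> \int[mu]_x h' x = 0.
Proof.
move=> dh ch' ih' hM.
pose f n x := h' x * \1_(`[- n%:R, n%:R]%classic) x.
have cf : (fun n => \int[mu]_x f n x) @ \oo --> \int[mu]_x h' x.
  apply: (@Rint_dominated_cvg _ (measurableTypeR R) mu setT f h' (fun x => `|h' x|)) => //.
  - move=> n; apply: measurable_indicM => //.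
    exact: continuous_measurable_fun.
  - move=> x _; apply: cvg_near_cst; near=> n.
    rewrite /f indicE mem_set ?mulr1 //= in_itv /= -ler_norml.
    by near: n; exact: nbhs_infty_ger.
  - exact: (integrable_norm ih').
  - move=> n x _; rewrite normrM indicE [X in _ * X <= _]ger0_norm //.
    by case: (_ \in _); rewrite ?mulr1 ?mulr0 ?normr_ge0.
have c0 : (fun n => \int[mu]_x f n x) @ \oo --> (0 : R).
  apply/norm_cvg0P.
  apply: (@squeeze_cvgr _ _ _ _ (cst 0) (fun n => (2 * M) / (1 + n%:R ^+ 2))).
  - apply: nearW => n; rewrite normr_ge0 /=.
    rewrite -Rintegral_indic (@Rint_FTC h) //.
    + apply: (le_trans (ler_normB _ _)); rewrite -mulrA mulr_natl mulr2n.
      by rewrite lerD // (le_trans (hM _)) // sqrrN.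
    + by rewrite lerNl (@le_trans _ _ 0) // oppr_le0.
    + by move=> x _; exact: ch'.
  - exact: cvg_cst.
  - exact: cvg_oneDsqrV_nat.
exact: (cvg_unique _ cf c0).
Unshelve. all: by end_near. Qed.

(** By [exp (x^2) >= (1 + x^2 / 2)^2], the reciprocal of [1 + x^2] dominates the Gaussian
    moments in use. *)
Lemma gauss_moment_le (x : R) : (1 + x ^+ 2) * gauss_fun x <= 4 / (1 + x ^+ 2).
Proof.
rewrite /gauss_fun expRN.
have h : (1 + x ^+ 2) / 2 <= expR (x ^+ 2 / 2).
  by apply: le_trans (expR_ge1Dx _); have := sqr_ge0 x; lra.
have h2 : ((1 + x ^+ 2) / 2) ^+ 2 <= expR (x ^+ 2).
  have -> : x ^+ 2 = x ^+ 2 / 2 + x ^+ 2 / 2 by lra.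
  rewrite [in leRHS]expRD -expr2 lerXn2r ?nnegrE ?expR_ge0 //.
    by rewrite divr_ge0 // addr_ge0 // -splitr sqr_ge0.
  by rewrite -splitr.
have e0 := expR_gt0 (x ^+ 2); have p0 := oneDsqr_pos x.
rewrite ler_pdivrMr // mulrAC ler_pdivlMr //.
by move: h2; rewrite expr_div_n ler_pdivrMr // expr2; lra.
Qed.

Lemma measurable_gauss_moment :
  measurable_fun [set: R] (fun x : R => (1 + x ^+ 2) * gauss_fun x).
Proof.
apply: measurable_funM; last exact: measurable_gauss_fun.
exact: continuous_measurable_fun (@continuous_oneDsqr R).
Qed.

Lemma integrable_gauss_moment :
  mu.-integrable [set: R] (EFin \o (fun x : R => (1 + x ^+ 2) * gauss_fun x)).
Proof.
apply: (@integrable_dominated _ (measurableTypeR R) mu setT _ (fun x => 4 * (1 + x ^+ 2)^-1)) => //.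
- exact: measurable_gauss_moment.
- move=> x _; rewrite ger0_norm; first exact: gauss_moment_le.
  by rewrite mulr_ge0 ?gauss_fun_ge0 // ltW // oneDsqr_pos.
- by apply: integrableMl_cst => //; exact: integrable_oneDsqrV.
Qed.

End Calculus.

(** * The Fourier transform of the Gaussian *)

Section GaussFourier.
Context {R : realType}.
Notation mu := (@lebesgue_measure R).

Let K (t : R) : R := \int[mu]_y (cos (2 * t * y) * gauss_fun y).

Lemma measurable_cos_mul (t : R) : measurable_fun [set: R] (fun y : R => cos (2 * t * y)).
Proof.
apply: continuous_measurable_fun => y.
by apply: continuous_comp; [exact: mulrl_continuous|exact: continuous_cos].
Qed.

Lemma measurable_sin_mul (t : R) : measurable_fun [set: R] (fun y : R => sin (2 * t * y)).
Proof.
apply: continuous_measurable_fun => y.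
by apply: continuous_comp; [exact: mulrl_continuous|exact: continuous_sin].
Qed.

Lemma gauss_fun_le_moment (y : R) : gauss_fun y <= (1 + y ^+ 2) * gauss_fun y.
Proof. by rewrite ler_peMl ?gauss_fun_ge0 // lerDl sqr_ge0. Qed.

Lemma integrable_cos_gauss (t : R) :
  mu.-integrable [set: R] (EFin \o (fun y => cos (2 * t * y) * gauss_fun y)).
Proof.
apply: (@integrable_dominated _ _ (measurableTypeR R) mu setT _ (fun x => (1 + x ^+ 2) * gauss_fun x)) => //.
- by apply: measurable_funM; [exact: measurable_cos_mul|exact: measurable_gauss_fun].
- move=> y _; rewrite normrM (ger0_norm (gauss_fun_ge0 y)).
  apply: le_trans (gauss_fun_le_moment y).
  by rewrite ler_piMl ?gauss_fun_ge0 // cos_max.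
- exact: integrable_gauss_moment.
Qed.

Lemma norm_le_oneDsqr (y : R) : `|y| <= 1 + y ^+ 2.
Proof.
have := sqr_ge0 (`|y| - 1); have := sqr_ge0 `|y|; rewrite -[y ^+ 2]real_normK ?num_real //; nra.
Qed.

Lemma is_derive_cos_gauss (t y : R) :
  is_derive t (1 : R) (fun t : R => cos (2 * t * y) * gauss_fun y)
    (- (2 * y) * sin (2 * t * y) * gauss_fun y).
Proof. by apply: is_derive_eq; rewrite /GRing.scale /= ?mulr1; ring. Qed.

Lemma int_cos_gauss_derive (t : R) :
  \int[mu]_y (- (2 * y) * sin (2 * t * y) * gauss_fun y) = - (2 * t) * K t.
Proof.
pose h y := sin (2 * t * y) * gauss_fun y.
pose h' y := 2 * t * (cos (2 * t * y) * gauss_fun y) +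
  (- (2 * y) * sin (2 * t * y) * gauss_fun y).
have msin : measurable_fun [set: R] (fun y => - (2 * y) * sin (2 * t * y) * gauss_fun y).
  apply: measurable_funM; last exact: measurable_gauss_fun.
  apply: measurable_funM; last exact: measurable_sin_mul.
  by apply: measurableT_comp => //.
have isin : mu.-integrable [set: R] (EFin \o (fun y => - (2 * y) * sin (2 * t * y) * gauss_fun y)).
  apply: (@integrable_dominated _ _ (measurableTypeR R) mu setT _
    (fun x => 2 * ((1 + x ^+ 2) * gauss_fun x))) => //.
    move=> y _; rewrite !normrM (ger0_norm (gauss_fun_ge0 y)) normrN normrM mulrA.
    rewrite ler_wpM2r ?gauss_fun_ge0 // (ger0_norm (ler0n _ _)).
    rewrite -mulrA ler_wpM2l // -[leRHS]mulr1 ler_pM ?norm_le_oneDsqr //.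
    exact: sin_max.
  by apply: integrableMl_cst => //; exact: integrable_gauss_moment.
have icos : mu.-integrable [set: R] (EFin \o (fun y => 2 * t * (cos (2 * t * y) * gauss_fun y))).
  by apply: integrableMl_cst => //; exact: integrable_cos_gauss.
have : \int[mu]_y h' y = 0.
  apply: (@Rint_deriv0 _ h h' 4).
  - move=> y; rewrite /h /h'.
    by apply: is_derive_eq; rewrite /GRing.scale /gauss_fun /= ?mulr1; ring.
  - by move=> y; apply: derivable_continuous; rewrite /h' /gauss_fun; apply: ex_derive.
  - by rewrite /h'; have := integrableD measurableT icos isin; apply: eq_integrable.
  - move=> y; apply: le_trans (gauss_moment_le y).
    apply: le_trans (gauss_fun_le_moment y).
    by rewrite normrM (ger0_norm (gauss_fun_ge0 y)) ler_piMl ?gauss_fun_ge0 // sin_max.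
rewrite /h' RintegralD // RintegralZl //; last exact: integrable_cos_gauss.
by rewrite addrC => /eqP; rewrite addr_eq0 => /eqP ->; rewrite mulNr.
Qed.

Lemma is_derive_K (t : R) : is_derive t (1 : R) K (- (2 * t) * K t).
Proof.
have tI : `](t - 1), (t + 1)[%classic t by rewrite /= in_itv /=; apply/andP; split; lra.
have intf x : `](t - 1), (t + 1)[%classic x ->
    mu.-integrable [set: R] (EFin \o (fun y => cos (2 * x * y) * gauss_fun y)).
  by move=> _; exact: integrable_cos_gauss.
have der x y : `](t - 1), (t + 1)[%classic x -> [set: R] y ->
    derivable ((fun x y : R => cos (2 * x * y) * gauss_fun y) ^~ y) x 1.
  by move=> _ _; apply: ex_derive; exact: is_derive_cos_gauss.
have G0 y : 0 <= 2 * ((1 + y ^+ 2) * gauss_fun y) :> R.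
  by rewrite !mulr_ge0 ?gauss_fun_ge0 // ltW // oneDsqr_pos.
have iG : mu.-integrable [set: R] (EFin \o (fun x : R => 2 * ((1 + x ^+ 2) * gauss_fun x))).
  by apply: integrableMl_cst => //; exact: integrable_gauss_moment.
have p1 x y : partial1of2 (fun x y : R => cos (2 * x * y) * gauss_fun y) x y =
    - (2 * y) * sin (2 * x * y) * gauss_fun y.
  rewrite partial1of2E; apply: derive_val; exact: is_derive_cos_gauss.
have Gub x y : `](t - 1), (t + 1)[%classic x -> [set: R] y ->
    `|partial1of2 (fun x y : R => cos (2 * x * y) * gauss_fun y) x y|
      <= 2 * ((1 + y ^+ 2) * gauss_fun y).
  move=> _ _; rewrite p1 !normrM (ger0_norm (gauss_fun_ge0 y)) normrN normrM mulrA.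
  rewrite ler_wpM2r ?gauss_fun_ge0 // (ger0_norm (ler0n _ _)).
  rewrite -mulrA ler_wpM2l // -[leRHS]mulr1 ler_pM ?norm_le_oneDsqr //.
  exact: sin_max.
have dK := @derivable_under_integral R _ (measurableTypeR R) mu _ _ measurableT
  t (t - 1) (t + 1) tI intf der _ G0 iG Gub.
have eK := @differentiation_under_integral R _ (measurableTypeR R) mu _ _ measurableT
  t (t - 1) (t + 1) tI intf der _ G0 iG Gub.
apply: DeriveDef; first exact: dK.
rewrite -derive1E; rewrite eK -int_cos_gauss_derive.
by apply: eq_Rintegral => y _; rewrite p1.
Qed.

(** Both sides solve [K' = - 2 t K]: the derivative of the integral is a multiple of the
    integral itself, by an integration by parts in [y]. *)
Lemma gauss_fourier (t : R) :
  \int[mu]_y (cos (2 * t * y) * gauss_fun y) = Num.sqrt pi * gauss_fun t.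
Proof.
rewrite -/(K t).
have K0 : K 0 = Num.sqrt pi.
  rewrite /K /Rintegral.
  under eq_integral do rewrite mulr0 mul0r cos0 mul1r.
  by rewrite integralT_gauss.
have cK := @is_derive_0_is_cst _ (fun t => K t * expR (t ^+ 2)) t 0.
have {cK} : K t * expR (t ^+ 2) = K 0 * expR (0 ^+ 2).
  apply: cK => x.
  have hK := is_derive_K x.
  apply: is_derive_eq; rewrite /GRing.scale /= !mulr1; ring.
rewrite K0 expr0n /= expR0 mulr1 => <-.
by rewrite /gauss_fun -mulrA -expRD subrr expR0 mulr1.
Qed.

Lemma Rint_gauss_translate (l : R) : \int[mu]_r gauss_fun (l - r) = Num.sqrt pi.
Proof.
rewrite /Rintegral -[Num.sqrt pi]/(fine (Num.sqrt pi)%:E) -integralT_gauss; congr fine.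
rewrite -(@integral_affine _ _ 1 l) //; last 2 first.
- exact: continuous_gauss_fun.
- exact: gauss_fun_ge0.
by apply: eq_integral => r _; rewrite !mul1r /gauss_fun -sqrrN opprB.
Qed.

End GaussFourier.

(** * Interpolation between two lines *)

Section Interp.
Context {R : realType}.
Notation mu := (@lebesgue_measure R).

(** Tonelli: a nonnegative kernel whose integral in the second variable is bounded preserves
    integrability. *)
Lemma integrable_kernel d1 d2 (T1 : measurableType d1) (T2 : measurableType d2)
  (m1 : {sigma_finite_measure set T1 -> \bar R})
  (m2 : {sigma_finite_measure set T2 -> \bar R})
  (D : set T1) (a : T1 -> R) (k : T1 * T2 -> R) (r : R) :
  measurable D -> measurable_fun [set: T1] a -> m1.-integrable D (EFin \o a) ->
  measurable_fun [set: T1 * T2] k -> (forall z, 0 <= k z) ->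
  (forall x, (\int[m2]_y (k (x, y))%:E <= r%:E)%E) ->
  (m1 \x m2)%E.-integrable (D `*` [set: T2]) (EFin \o (fun z => a z.1 * k z)).
Proof.
move=> mD ma ia mk k0 kr.
have mDT : measurable (D `*` [set: T2]) by exact: measurableX.
apply/(integrable_mkcond _ mDT).
have -> : (EFin \o (fun z => a z.1 * k z)) \_ (D `*` [set: T2]) =
    (fun z => (a z.1 * \1_D z.1 * k z)%:E).
  apply/funext => -[x y]; rewrite patchE indicE /= in_setX in_setT andbT.
  by case: ifPn; rewrite ?mulr1 ?mulr0 ?mul0r.
have ma1 : measurable_fun [set: T1] (fun x => a x * \1_D x) by exact: measurable_indicM.
have iaD := integrable_indicM mD ia.
apply/integrable12ltyP.
  apply/measurable_EFinP/measurable_funM => //.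
  exact: (measurableT_comp ma1 measurable_fst).
have mkx x : measurable_fun [set: T2] (fun y => (k (x, y))%:E).
  by apply/measurable_EFinP; exact: (measurableT_comp mk (measurable_pair1 x)).
apply: (@le_lt_trans _ _ (\int[m1]_x (`|a x * \1_D x|%:E * r%:E))%E).
  apply: ge0_le_integral => //.
  - by move=> x _; apply: integral_ge0.
  - apply: (@measurable_fun_fubini_tonelli_F _ _ _ _ _ m2
      (fun z => `|(a z.1 * \1_D z.1 * k z)%:E|%E)) => //.
    apply: measurableT_comp => //; apply/measurable_EFinP/measurable_funM => //.
    exact: (measurableT_comp ma1 measurable_fst).
  - apply: emeasurable_funM => //; apply/measurable_EFinP.
    exact: measurableT_comp.
  - move=> x _ /=.
    under eq_integral do rewrite normrM (ger0_norm (k0 _)) EFinM.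
    rewrite ge0_integralZl //; first by apply: lee_wpmul2l; [rewrite lee_fin|exact: kr].
    by move=> y _; rewrite lee_fin.
rewrite ge0_integralZr //; last 2 first.
- by apply/measurable_EFinP; exact: measurableT_comp.
- have [x] : exists x : T1, True by exists point.
  by move=> _; apply: le_trans (kr x); apply: integral_ge0 => y _; rewrite lee_fin.
apply: lte_mul_pinfty => //; first exact: integral_ge0.
have := integrable_norm iaD.
move/integrableP => [_].
under eq_integral do rewrite /= normr_id.
by move=> h; rewrite ge0_fin_numE //; exact: integral_ge0.
by rewrite ltry.
Qed.

Definition gauss_moment2 : R := \int[mu]_y ((1 + y ^+ 2) * gauss_fun y).

Lemma gauss_moment_ge0 : 0 <= gauss_moment2.
Proof.
by apply: Rintegral_ge0 => y _; rewrite mulr_ge0 ?gauss_fun_ge0 // ltW // oneDsqr_pos.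
Qed.

Definition three_lines_const (theta : R) : R :=
  expR 1 * (4 * gauss_moment2 / Num.sqrt pi) * (4 / Num.min theta (1 - theta) ^+ 2)
    * pi / Num.sqrt pi + 1.

Lemma three_lines_const_gt0 theta : 0 < three_lines_const theta.
Proof.
rewrite ltr_wpDl // divr_ge0 ?sqrtr_ge0 // mulr_ge0 ?pi_ge0 // mulr_ge0 //.
  by rewrite mulr_ge0 ?expR_ge0 // divr_ge0 ?sqrtr_ge0 // mulr_ge0 // gauss_moment_ge0.
by rewrite divr_ge0 // sqr_ge0.
Qed.

Section strip.
Context d (T : measurableType d) (nu : {sigma_finite_measure set T -> \bar R}).
Variables (D : set T) (mD : measurable D).
Variables (lam om : T -> R).
Hypotheses (mlam : measurable_fun [set: T] lam) (mom : measurable_fun [set: T] om).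

Lemma measurable_cosT (f : T -> R) : measurable_fun [set: T] f ->
  measurable_fun [set: T] (fun x => cos (f x)).
Proof. by move=> mf; exact: (bm_cos setT mf).1. Qed.

Lemma integrable_cosM (B g : T -> R) : measurable_fun [set: T] B ->
  nu.-integrable D (EFin \o B) -> measurable_fun [set: T] g ->
  (forall x, `|g x| <= 1) -> nu.-integrable D (EFin \o (fun x => B x * g x)).
Proof.
move=> mB iB mg g1.
apply: (@integrable_dominated _ _ _ nu D _ (fun x => `|B x|)) => //.
- by apply: measurable_funTS; exact: measurable_funM.
- by move=> x _; rewrite normrM ler_piMr.
- exact: (integrable_norm iB).
Qed.

(** By [gauss_fourier], the Gaussian in [lam - s] is an average over [y] of the oscillating
    factors of the hypothesis, with shifts [c] proportional to [s]; the quadratic growth in [y] is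
    absorbed by the second moment. *)
Lemma gauss_localization (B : T -> R) (M s : R) : 0 <= M ->
  measurable_fun [set: T] B -> nu.-integrable D (EFin \o B) ->
  (forall y c, `|\int[nu]_(x in D) (B x * cos (om x + y * lam x + c))| <= M * (1 + y ^+ 2)) ->
  Num.sqrt pi * `|\int[nu]_(x in D) (B x * cos (om x) * gauss_fun (lam x - s))|
    <= 4 * M * gauss_moment2.
Proof.
move=> M0 mB iB hB.
have mBc : measurable_fun [set: T] (fun x => B x * cos (om x)).
  by apply: measurable_funM => //; exact: measurable_cosT.
have iBc : nu.-integrable D (EFin \o (fun x => B x * cos (om x))).
  apply: integrable_cosM => //; first exact: measurable_cosT.
  by move=> x; exact: cos_max.
have mls : measurable_fun [set: T] (fun x => lam x - s).
  exact: measurable_funB.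
have mtau : measurable_fun [set: T * measurableTypeR R] (fun z => 2 * (lam z.1 - s) * z.2).
  apply: measurable_funM; last exact: measurable_snd.
  apply: measurable_funM => //.
  exact: (measurableT_comp mls measurable_fst).
have mct : measurable_fun [set: T * measurableTypeR R] (fun z => cos (2 * (lam z.1 - s) * z.2)).
  exact: (bm_cos setT mtau).1.
pose F (z : T * measurableTypeR R) :=
  B z.1 * cos (om z.1) * gauss_fun z.2 * cos (2 * (lam z.1 - s) * z.2).
have mBg : measurable_fun [set: T * measurableTypeR R]
    (fun z => B z.1 * cos (om z.1) * gauss_fun z.2).
  apply: measurable_funM; first exact: (measurableT_comp mBc measurable_fst).
  exact: (measurableT_comp (@measurable_gauss_fun R) measurable_snd).
have mF : measurable_fun [set: T * measurableTypeR R] F by exact: measurable_funM.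
have iF : (nu \x mu)%E.-integrable (D `*` [set: measurableTypeR R]) (EFin \o F).
  have := @integrable_kernel _ _ _ (measurableTypeR R) nu mu D _
    (fun z => gauss_fun z.2) (Num.sqrt pi) mD mBc iBc.
  case/(_ _ _ _)/Wrap.
  - exact: (measurableT_comp (@measurable_gauss_fun R) measurable_snd).
  - by move=> z; exact: gauss_fun_ge0.
  - by move=> x /=; rewrite integralT_gauss.
  move=> iBg; apply: (@integrable_dominated _ _ _ (nu \x mu)%E _ _
    (fun z => `|B z.1 * cos (om z.1) * gauss_fun z.2|)) => //.
  - exact: measurableX.
  - exact: measurable_funTS.
  - by move=> z _; rewrite normrM ler_piMr // cos_max.
  - exact: (integrable_norm iBg).
have E1 : Num.sqrt pi * \int[nu]_(x in D) (B x * cos (om x) * gauss_fun (lam x - s)) =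
    \int[nu]_(x in D) \int[mu]_y F (x, y).
  rewrite -RintegralZl //; last first.
    apply: integrable_cosM => //.
      exact: (measurableT_comp (@measurable_gauss_fun R) mls).
    by move=> x; rewrite ger0_norm ?gauss_fun_ge0 // gauss_fun_le1.
  apply: eq_Rintegral => x _; rewrite mulrCA -gauss_fourier -RintegralZl //.
    by apply: eq_Rintegral => y _; rewrite /F /= [cos (2 * _ * y) * _]mulrC mulrA.
  exact: integrable_cos_gauss.
have bd y : `|\int[nu]_(x in D) F (x, y)| <= 4 * M * ((1 + y ^+ 2) * gauss_fun y).
  have iBy t c : nu.-integrable D (EFin \o (fun x => B x * cos (om x + t * lam x + c))).
    apply: integrable_cosM => //.
      apply: measurable_cosT; apply: measurable_funD => //.
      by apply: measurable_funD => //; exact: measurable_funM.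
    by move=> x; exact: cos_max.
  have -> : \int[nu]_(x in D) F (x, y) = gauss_fun y / 2 *
      (\int[nu]_(x in D) (B x * cos (om x + (2 * y) * lam x + - (2 * y * s))) +
       \int[nu]_(x in D) (B x * cos (om x + (- (2 * y)) * lam x + 2 * y * s))).
    rewrite -RintegralD // -RintegralZl //; last exact: (integrableD mD (iBy _ _) (iBy _ _)).
    apply: eq_Rintegral => x _; rewrite /F /=.
    have -> : om x + 2 * y * lam x + - (2 * y * s) = om x + 2 * (lam x - s) * y by ring.
    have -> : om x + - (2 * y) * lam x + 2 * y * s = om x - 2 * (lam x - s) * y by ring.
    by rewrite cosB cosD; field.
  have h1 := hB (2 * y) (- (2 * y * s)).
  have h2 := hB (- (2 * y)) (2 * y * s).
  rewrite normrM ger0_norm ?divr_ge0 ?gauss_fun_ge0 //.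
  apply: (@le_trans _ _ (gauss_fun y / 2 * (M * (1 + (2 * y) ^+ 2) + M * (1 + (- (2 * y)) ^+ 2)))).
    apply: ler_wpM2l; first by rewrite divr_ge0 ?gauss_fun_ge0.
    by apply: (le_trans (ler_normD _ _)); exact: lerD.
  have -> : gauss_fun y / 2 * (M * (1 + (2 * y) ^+ 2) + M * (1 + (- (2 * y)) ^+ 2)) =
    M * (1 + 4 * y ^+ 2) * gauss_fun y by field.
  have -> : 4 * M * ((1 + y ^+ 2) * gauss_fun y) = M * (4 + 4 * y ^+ 2) * gauss_fun y by ring.
  apply: ler_wpM2r; first exact: gauss_fun_ge0.
  by apply: ler_wpM2l => //; rewrite lerD2r ler1n.
rewrite -{1}[Num.sqrt pi]ger0_norm ?sqrtr_ge0 // -normrM E1.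
rewrite -Rint_prod // Rint_prod2 //.
rewrite /gauss_moment2 -RintegralZl //; last exact: integrable_gauss_moment.
have iM : mu.-integrable [set: R] (EFin \o (fun y => 4 * M * ((1 + y ^+ 2) * gauss_fun y))).
  by apply: integrableMl_cst => //; exact: integrable_gauss_moment.
apply: normr_Rint_le => //.
apply: (@integrable_dominated _ _ (measurableTypeR R) mu setT _ _ measurableT _ _ iM) => //.
exact: (@measurable_Rint2 R _ _ _ (measurableTypeR R) nu D F mD mF).
Qed.

(** Completing the square: a Gaussian absorbs an exponential weight by a shift of its centre,
    and leaves the factor [expR (x * r)] behind. *)
Lemma gauss_tilt (x l r : R) :
  expR (x * l) * gauss_fun (l - r) =
  expR (x * r + x ^+ 2 / 4) * gauss_fun (l - (r + x / 2)).
Proof. by rewrite /gauss_fun -!expRD; congr expR; field. Qed.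

(** The first exponential decays for negative [r], the second one for positive [r]. *)
Lemma expR_two_sided (theta r : R) : 0 < theta < 1 ->
  expR (theta * r) <= 4 / (Num.min theta (1 - theta)) ^+ 2 / (1 + r ^+ 2) \/
  expR ((theta - 1) * r) <= 4 / (Num.min theta (1 - theta)) ^+ 2 / (1 + r ^+ 2).
Proof.
move=> /andP[t0 t1]; set k := Num.min _ _.
have k0 : 0 < k by rewrite lt_min t0 subr_gt0.
have kt : k <= theta by rewrite ge_min lexx.
have kt1 : k <= 1 - theta by rewrite ge_min lexx orbT.
suff main a : `|r| * k <= a -> expR (- a) <= 4 / k ^+ 2 / (1 + r ^+ 2).
  case: (lerP r 0) => r0; [left|right].
    rewrite -[theta * r]opprK; apply: main.
    by rewrite ler0_norm // -mulrN mulrC ler_wpM2r // oppr_ge0.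
  rewrite -[_ * r]opprK; apply: main.
  by rewrite gtr0_norm // -mulNr opprB mulrC ler_wpM2r // ltW.
move=> ra; rewrite expRN.
have a0 : 0 <= a by apply: le_trans ra; rewrite mulr_ge0 // ltW.
have h1 : (1 + a / 2) ^+ 2 <= expR a.
  rewrite [in leRHS](splitr a) expRD -expr2 lerXn2r ?nnegrE ?expR_ge0 //.
    by rewrite addr_ge0 // divr_ge0.
  exact: expR_ge1Dx.
have h2 : k ^+ 2 / 4 * (1 + r ^+ 2) <= expR a.
  apply: le_trans h1.
  have k1 : k <= 1 by apply: (le_trans kt); exact: ltW.
  have : (`|r| * k) ^+ 2 <= a ^+ 2 by rewrite lerXn2r ?nnegrE // mulr_ge0 // ltW.
  rewrite exprMn real_normK ?num_real // => h.
  have : k ^+ 2 <= 1 by rewrite exprn_ile1 // ltW.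
  by nra.
have p := oneDsqr_pos r; have k2 : 0 < k ^+ 2 by rewrite exprn_gt0.
rewrite -[leRHS]invrK lef_pV2 ?posrE ?expR_gt0 //; last first.
  by rewrite invr_gt0 divr_gt0 // divr_gt0.
by rewrite !invfM !invrK; lra.
Qed.

(** The three lines theorem for [z |-> int A exp (z lam + i om)], with [z = x + i y] and
    hypotheses on the lines [Re z = 0] and [Re z = 1].  The integral is decomposed by Gaussians in
    [lam - r]; for each [r] the piece is estimated from the line that is the better one for it. *)
Lemma three_lines (theta : R) (A : T -> R) (M : R) : 0 < theta < 1 -> 0 <= M ->
  measurable_fun [set: T] A -> nu.-integrable D (EFin \o A) ->
  nu.-integrable D (EFin \o (fun x => A x * expR (lam x))) ->
  (forall y c, `|\int[nu]_(x in D) (A x * cos (om x + y * lam x + c))| <= M * (1 + y ^+ 2)) ->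
  (forall y c, `|\int[nu]_(x in D) (A x * expR (lam x) * cos (om x + y * lam x + c))|
     <= M * (1 + y ^+ 2)) ->
  `|\int[nu]_(x in D) (A x * expR (theta * lam x) * cos (om x))|
    <= three_lines_const theta * M.
Proof.
move=> /[dup] t01 /andP[t0 t1] M0 mA iA iB h0 h1.
have sp : 0 < Num.sqrt pi :> R by rewrite sqrtr_gt0 pi_gt0.
pose k := Num.min theta (1 - theta).
pose Cr := 4 / k ^+ 2 : R.
have Cr0 : 0 <= Cr by rewrite divr_ge0 // sqr_ge0.
pose C1 := expR 1 * (4 * gauss_moment2 / Num.sqrt pi) : R.
have C10 : 0 <= C1 by rewrite mulr_ge0 ?expR_ge0 // divr_ge0 ?mulr_ge0 ?gauss_moment_ge0 // ltW.
have mexp x : measurable_fun [set: T] (fun z => expR (x * lam z)).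
  by apply: (measurableT_comp (@measurable_expR R)); exact: measurable_funM.
pose B z := A z * expR (1 * lam z).
have mB : measurable_fun [set: T] B by exact: measurable_funM.
have iB' : nu.-integrable D (EFin \o B).
  by apply: eq_integrable iB => // z _ /=; rewrite /B mul1r.
pose At z := A z * expR (theta * lam z).
have mAt : measurable_fun [set: T] At by exact: measurable_funM.
have iAt : nu.-integrable D (EFin \o At).
  apply: (@integrable_dominated _ _ _ nu D _ (fun z => `|A z| + `|B z|)) => //.
  - exact: measurable_funTS.
  - move=> z _; rewrite /At /B mul1r !normrM !(ger0_norm (expR_ge0 _)) -[X in X + _]mulr1 -mulrDr.
    apply: ler_wpM2l => //.
    case: (lerP (lam z) 0) => l0.
      apply: (@le_trans _ _ 1); last by rewrite lerDl expR_ge0.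
      by rewrite -expR0 ler_expR pmulr_rle0.
    apply: (@le_trans _ _ (expR (lam z))); last by rewrite lerDr.
    by rewrite ler_expR ger_pMl // ltW.
  - exact: (integrableD mD (integrable_norm iA) (integrable_norm iB')).
have mAc : measurable_fun [set: T] (fun z => At z * cos (om z)).
  by apply: measurable_funM => //; exact: measurable_cosT.
have iAc : nu.-integrable D (EFin \o (fun z => At z * cos (om z))).
  apply: integrable_cosM => //; first exact: measurable_cosT.
  by move=> x; exact: cos_max.
pose F (z : T * measurableTypeR R) := At z.1 * cos (om z.1) * gauss_fun (lam z.1 - z.2).
have mg : measurable_fun [set: T * measurableTypeR R] (fun z => gauss_fun (lam z.1 - z.2)).
  apply: (measurableT_comp (@measurable_gauss_fun R)); apply: measurable_funB.
    exact: (measurableT_comp mlam measurable_fst).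
  exact: measurable_snd.
have mF : measurable_fun [set: T * measurableTypeR R] F.
  by apply: measurable_funM => //; exact: (measurableT_comp mAc measurable_fst).
have tr l : (\int[mu]_y (gauss_fun (l - y))%:E = (Num.sqrt pi)%:E)%E.
  rewrite -integralT_gauss -(@integral_affine _ (@gauss_fun R) 1 l) //; last 2 first.
  - exact: continuous_gauss_fun.
  - exact: gauss_fun_ge0.
  by apply: eq_integral => r _; rewrite !mul1r /gauss_fun -sqrrN opprB.
have iF : (nu \x mu)%E.-integrable (D `*` [set: measurableTypeR R]) (EFin \o F).
  have k0 (z : T * measurableTypeR R) : 0 <= gauss_fun (lam z.1 - z.2) :> R.
    exact: gauss_fun_ge0.
  have kr x : (\int[mu]_y (gauss_fun (lam x - y))%:E <= (Num.sqrt pi)%:E)%E by rewrite tr.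
  exact: (@integrable_kernel _ _ _ (measurableTypeR R) nu mu D _ _ _ mD mAc iAc mg k0 kr).
(* Averaging over the centre of the Gaussian reproduces the integral, with its total mass. *)
have E1 : Num.sqrt pi * \int[nu]_(x in D) (At x * cos (om x)) =
    \int[nu]_(x in D) \int[mu]_y F (x, y).
  rewrite -RintegralZl //; apply: eq_Rintegral => x _.
  rewrite /F /= RintegralZl //; first by rewrite Rint_gauss_translate mulrC.
  apply/integrableP; split.
    apply/measurable_EFinP.
    exact: (measurableT_comp mg (measurable_pair1 x)).
  under eq_integral do rewrite gee0_abs ?lee_fin ?gauss_fun_ge0 //.
  by rewrite tr ltry.
have tilt (x r : R) (E : T -> R) : -1 <= x <= 1 -> measurable_fun [set: T] E ->
    nu.-integrable D (EFin \o E) ->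
    (forall y c, `|\int[nu]_(x in D) (E x * cos (om x + y * lam x + c))| <= M * (1 + y ^+ 2)) ->
    `|\int[nu]_(z in D) (E z * cos (om z) * (expR (x * lam z) * gauss_fun (lam z - r)))|
      <= C1 * M * expR (x * r).
  move=> /andP[xl xr] mE iE hE.
  under eq_Rintegral do rewrite gauss_tilt mulrCA.
  rewrite RintegralZl //; last first.
    apply: integrable_cosM => //; last 2 first.
    - apply: (measurableT_comp (@measurable_gauss_fun R)); exact: measurable_funB.
    - by move=> z; rewrite ger0_norm ?gauss_fun_ge0 // gauss_fun_le1.
    - by apply: measurable_funM => //; exact: measurable_cosT.
    - by apply: integrable_cosM => //; [exact: measurable_cosT|move=> z; exact: cos_max].
  rewrite normrM ger0_norm ?expR_ge0 // expRD [X in X * _ <= _]mulrC.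
  rewrite -[X in X <= _]mulrA [X in _ * X <= _]mulrC [X in X <= _]mulrA.
  apply: ler_wpM2r; first exact: expR_ge0.
  have loc := gauss_localization (r + x / 2) M0 mE iE hE.
  have -> : C1 * M = expR 1 * (4 * gauss_moment2 / Num.sqrt pi * M) by rewrite /C1 -mulrA.
  apply: ler_pM => //.
    by rewrite ler_expR; nra.
  by rewrite mulrAC ler_pdivlMr // mulrC (le_trans loc) // mulrAC.
have bd r : `|\int[nu]_(x in D) F (x, r)| <= C1 * M * Cr * (1 + r ^+ 2)^-1.
  rewrite -mulrA.
  have [h|h] := expR_two_sided r t01.
    apply: (@le_trans _ _ (C1 * M * expR (theta * r))); last first.
      by apply: ler_wpM2l => //; exact: mulr_ge0.
    apply: le_trans (tilt theta r A _ mA iA h0); last by apply/andP; split; lra.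
    by rewrite le_eqVlt; apply/orP; left; apply/eqP; congr `|_|; apply: eq_Rintegral => x _;
      rewrite /F /At /=; ring.
  apply: (@le_trans _ _ (C1 * M * expR ((theta - 1) * r))); last first.
    by apply: ler_wpM2l => //; exact: mulr_ge0.
  apply: le_trans (tilt (theta - 1) r B _ mB iB' _); last 2 first.
  - by apply/andP; split; lra.
  - move=> y c; apply: le_trans (h1 y c); rewrite le_eqVlt; apply/orP; left; apply/eqP.
    by congr `|_|; apply: eq_Rintegral => x _; rewrite /B mul1r.
  rewrite le_eqVlt; apply/orP; left; apply/eqP; congr `|_|; apply: eq_Rintegral => x _.
  rewrite /F /At /B /=.
  have -> : expR (theta * lam x) = expR (1 * lam x) * expR ((theta - 1) * lam x).
    by rewrite -expRD; congr expR; ring.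
  ring.
have iM : mu.-integrable [set: R] (EFin \o (fun r => C1 * M * Cr * (1 + r ^+ 2)^-1)).
  by apply: integrableMl_cst => //; exact: integrable_oneDsqrV.
have : Num.sqrt pi * `|\int[nu]_(x in D) (At x * cos (om x))| <= C1 * M * Cr * pi.
  rewrite -{1}[Num.sqrt pi]ger0_norm ?sqrtr_ge0 // -normrM E1 -Rint_prod // Rint_prod2 //.
  have -> : C1 * M * Cr * pi = \int[mu]_r (C1 * M * Cr * (1 + r ^+ 2)^-1).
    rewrite RintegralZl //; last exact: integrable_oneDsqrV.
    by rewrite /Rintegral integral_oneDsqr.
  apply: normr_Rint_le => //.
  apply: (@integrable_dominated _ _ (measurableTypeR R) mu setT _ _ measurableT _ _ iM) => //.
  exact: (@measurable_Rint2 R _ _ _ (measurableTypeR R) nu D F mD mF).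
rewrite mulrC -ler_pdivlMr // => h; apply: (le_trans h).
rewrite /three_lines_const -/k -/Cr -/C1 mulrDl mul1r ler_wpDr //.
by rewrite le_eqVlt; apply/orP; left; apply/eqP; ring.
Qed.

End strip.
End Interp.

(** * Oscillatory integrals with one stationary point *)

Section Osc.
Context {R : realType}.
Notation mu := (@lebesgue_measure R).

Lemma Rint_itv_split (f : R -> R) (a b c : R) : a <= b -> b <= c ->
  (forall x, a <= x <= c -> {for x, continuous f}) ->
  \int[mu]_(x in `[a, c]) f x =
  \int[mu]_(x in `[a, b]) f x + \int[mu]_(x in `[b, c]) f x.
Proof.
move=> ab bc cf; have i := continuous_itv_integrable cf.
apply/eqP; rewrite addrC -subr_eq; apply/eqP.
rewrite (@Rintegral_itvB _ _ (BLeft a) (BRight c)) //.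
rewrite Rintegral_itv_obnd_cbnd //.
by apply: integrableS i => //; apply: subset_itv; rewrite bnd_simp.
Qed.

Lemma normr_Rint_itv_le1 (f : R -> R) (a b : R) : a <= b ->
  (forall x, a <= x <= b -> {for x, continuous f}) ->
  (forall x, `|f x| <= 1) -> `|\int[mu]_(x in `[a, b]) f x| <= b - a.
Proof.
move=> ab cf f1.
have -> : b - a = \int[mu]_(x in `[a, b]) (1 : R).
  by rewrite (@Rint_FTC _ id (fun=> 1)) // => x _; exact: cst_continuous.
apply: normr_Rint_le => //; first exact: continuous_itv_integrable.
by apply: continuous_itv_integrable => x _; exact: cst_continuous.
Qed.

(** The integrand is the derivative of [sin (psi + rho) / psi'] up to two terms that contain
    [psi'' / psi'^2] and [rho' / psi']; the function [H] is an antiderivative of a majorant of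
    these.  Only [psi] has to be free of stationary points. *)
Lemma nonstationary_phase (psi psi1 psi2 rho rho1 H H1 : R -> R) (a b e : R) : a <= b ->
  (forall u, a <= u <= b -> is_derive u 1 psi (psi1 u)) ->
  (forall u, a <= u <= b -> is_derive u 1 psi1 (psi2 u)) ->
  (forall u, a <= u <= b -> is_derive u 1 rho (rho1 u)) ->
  (forall u, a <= u <= b -> is_derive u 1 H (H1 u)) ->
  (forall u, a <= u <= b -> {for u, continuous psi2}) ->
  (forall u, a <= u <= b -> {for u, continuous rho1}) ->
  (forall u, a <= u <= b -> {for u, continuous H1}) ->
  (forall u, a <= u <= b -> psi1 u != 0) ->
  (forall u, a <= u <= b -> `|psi1 u|^-1 <= e) ->
  (forall u, a <= u <= b -> `|psi2 u| / psi1 u ^+ 2 + `|rho1 u| / `|psi1 u| <= H1 u) ->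
  `|\int[mu]_(u in `[a, b]) cos (psi u + rho u)| <= 2 * e + (H b - H a).
Proof.
move=> ab dpsi dpsi1 drho dH cpsi2 crho1 cH1 nz he hH.
pose G u := sin (psi u + rho u) / psi1 u.
pose E u := cos (psi u + rho u) * rho1 u / psi1 u - sin (psi u + rho u) * psi2 u / psi1 u ^+ 2.
have cpsi u : a <= u <= b -> {for u, continuous psi}.
  by move=> /dpsi h; apply: derivable_continuous; apply: ex_derive.
have cpsi1 u : a <= u <= b -> {for u, continuous psi1}.
  by move=> /dpsi1 h; apply: derivable_continuous; apply: ex_derive.
have crho u : a <= u <= b -> {for u, continuous rho}.
  by move=> /drho h; apply: derivable_continuous; apply: ex_derive.
have ccos u : a <= u <= b -> {for u, continuous (fun u => cos (psi u + rho u))}.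
  move=> uab; apply: continuous_comp; last exact: continuous_cos.
  by apply: cvgD; [exact: cpsi|exact: crho].
have csin u : a <= u <= b -> {for u, continuous (fun u => sin (psi u + rho u))}.
  move=> uab; apply: continuous_comp; last exact: continuous_sin.
  by apply: cvgD; [exact: cpsi|exact: crho].
have cE u : a <= u <= b -> {for u, continuous E}.
  move=> uab; apply: cvgB.
    apply: cvgM; first by apply: cvgM; [exact: ccos|exact: crho1].
    by apply: cvgV; [exact: nz|exact: cpsi1].
  apply: cvgM; first by apply: cvgM; [exact: csin|exact: cpsi2].
  apply: cvgV; first by rewrite expf_neq0 // nz.
  by apply: cvgM; exact: cpsi1.
have dG u : a <= u <= b -> is_derive u 1 G (cos (psi u + rho u) + E u).
  move=> uab; have := dpsi _ uab; have := dpsi1 _ uab; have := drho _ uab => d1 d2 d3.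
  have d4 := is_deriveV (nz _ uab) d2.
  have d5 : is_derive u 1 (fun u => psi u + rho u) (psi1 u + rho1 u) by exact: is_deriveD.
  have d6 := @is_derive1_comp _ (@sin R) (fun u => psi u + rho u) u _ _ (is_derive_sin _) d5.
  have d7 := is_deriveM d6 d4.
  apply: (is_derive_eq d7); rewrite /E /GRing.scale /=.
  by field; exact: nz.
have icos : mu.-integrable `[a, b] (EFin \o (fun u => cos (psi u + rho u))).
  exact: continuous_itv_integrable.
have iE : mu.-integrable `[a, b] (EFin \o E) by exact: continuous_itv_integrable.
have : \int[mu]_(u in `[a, b]) (cos (psi u + rho u) + E u) = G b - G a.
  by apply: Rint_FTC => // u uab; apply: cvgD; [exact: ccos|exact: cE].
rewrite RintegralD // => I0.
have -> : \int[mu]_(u in `[a, b]) cos (psi u + rho u) =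
  (G b - G a) - \int[mu]_(u in `[a, b]) E u by rewrite -I0; ring.
have hab : a <= a <= b by rewrite lexx.
have hbb : a <= b <= b by rewrite lexx andbT.
have hG u : a <= u <= b -> `|G u| <= e.
  move=> uab; rewrite /G normrM normfV -[e]mul1r; apply: ler_pM => //; last exact: he.
  exact: sin_max.
apply: (le_trans (ler_normB _ _)); apply: lerD.
  apply: (le_trans (ler_normB _ _)); rewrite mulr_natl mulr2n.
  by apply: lerD; exact: hG.
rewrite -(Rint_FTC ab dH cH1); apply: normr_Rint_le => //.
  exact: continuous_itv_integrable.
move=> u; rewrite /= in_itv /= => uab; apply: le_trans (hH _ uab).
rewrite /E [X in _ <= X]addrC; apply: (le_trans (ler_normB _ _)) => /=.
apply: lerD; rewrite !normrM normfV.
  by rewrite -mulrA ler_piMl ?cos_max // mulr_ge0 // invr_ge0.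
rewrite (ger0_norm (sqr_ge0 _)) -mulrA ler_piMl ?sin_max // mulr_ge0 //.
by rewrite invr_ge0 sqr_ge0.
Qed.

(** The quotient on the left is [tanh (|tau| / 2)]; for [tau = ln u - ln u0] it becomes the quotient
    of [|u - u0|] by [u + u0] that [stationary_point] asks for. *)
Lemma expR_sub1_ge (q tau : R) :
  `|q| / (1 + `|q|) * (`|expR tau - 1| / (expR tau + 1)) <= `|expR (q * tau) - 1|.
Proof.
set de := `|expR tau - 1| / (expR tau + 1).
have e1 : 0 < expR tau + 1 by rewrite addr_gt0 // expR_gt0.
have de0 : 0 <= de by rewrite divr_ge0 // ltW.
have de1 : de <= 1.
  rewrite ler_pdivrMr // mul1r; apply: (le_trans (ler_normB _ _)).
  by rewrite normr1 ger0_norm ?expR_ge0.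
have det : de <= `|tau|.
  rewrite ler_pdivrMr //.
  have h1 := expR_ge1Dx tau; have h2 := expR_ge1Dx (- tau).
  case: (lerP 0 tau) => t0.
    have h4 : expR tau * expR (- tau) = 1 by rewrite -expRD subrr expR0.
    have h3 : expR tau * (1 + - tau) <= expR tau * expR (- tau).
      by rewrite ler_wpM2l ?expR_ge0.
    rewrite [X in X <= _]ger0_norm ?subr_ge0 -?expR0 ?ler_expR // expR0.
    rewrite ger0_norm //; lra.
  have h3 : expR tau <= 1 by rewrite -expR0 ler_expR ltW.
  have := expR_ge0 tau.
  rewrite ler0_norm ?subr_le0 // ltr0_norm //; nra.
set a := `|q * tau|.
have a0 : 0 <= a by exact: normr_ge0.
have ha : a <= `|expR (q * tau) - 1| * (1 + a).
  rewrite /a; set s := q * tau; have h1 := expR_ge1Dx s.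
  have h2 := expR_ge1Dx (- s); have h3 := expR_gt0 s.
  case: (lerP 0 s) => h.
    rewrite (ger0_norm h) [X in _ <= X * _]ger0_norm; last lra.
    nra.
  have h4 : expR s * expR (- s) = 1 by rewrite -expRD subrr expR0.
  have h5 : expR s * (1 + - s) <= expR s * expR (- s) by rewrite ler_wpM2l // ltW.
  have h6 : expR s <= 1 by rewrite -expR0 ler_expR ltW.
  rewrite (ltr0_norm h) [X in _ <= X * _]ler0_norm ?subr_le0 //; lra.
have q1 : 0 < 1 + `|q| by rewrite ltr_pwDl.
rewrite mulrAC ler_pdivrMr //.
have q0 := normr_ge0 q.
have h5 : `|q| * de <= a by rewrite /a normrM ler_wpM2l.
have h6 : `|q| * de * a <= `|q| * a by rewrite -mulrA ler_wpM2l // ler_piMl.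
rewrite -(@ler_pM2r _ (1 + a)); last by rewrite ltr_pwDl.
rewrite [leRHS]mulrAC; apply: (@le_trans _ _ (a * (1 + `|q|))); last first.
  by rewrite ler_wpM2r // ltW.
nra.
Qed.

(** The function [x * u^q] takes the value one at most once on the half-line, at [u0]; if it
    never does, then [x <= 0] and [u0 = 0] serves. *)
Lemma stationary_point (q x : R) : q != 0 ->
  exists u0 : R, forall u, 0 < u -> u != u0 ->
    x * expR (q * ln u) != 1 /\
    (u * `|x * expR (q * ln u) - 1|)^-1 <= 2 * (1 + `|q|) / `|q| * (u^-1 + `|u - u0|^-1).
Proof.
move=> q0; have aq : 0 < `|q| by rewrite normr_gt0.
have K1 : 1 <= 2 * (1 + `|q|) / `|q| by rewrite ler_pdivlMr // mul1r; nra.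
case: (lerP x 0) => x0.
  exists 0 => u u0 _; have e0 := expR_gt0 (q * ln u).
  have w0 : x * expR (q * ln u) <= 0 by rewrite pmulr_lle0.
  split; first by apply/negP => /eqP h; move: w0; rewrite h; lra.
  rewrite subr0 (gtr0_norm u0).
  set w := x * _ in w0 *.
  have -> : `|w - 1| = 1 - w by rewrite ler0_norm ?opprB //; lra.
  apply: (@le_trans _ _ u^-1).
    rewrite lef_pV2 ?posrE ?mulr_gt0 //; last lra.
    by nra.
  have iu : 0 < u^-1 by rewrite invr_gt0.
  nra.
exists (expR (- ln x / q)) => u u0 uu0; set v := expR (- ln x / q).
have v0 : 0 < v by exact: expR_gt0.
have wE : x * expR (q * ln u) = expR (q * (ln u - ln v)).
  rewrite /v expRK -{1}(lnK x0) -expRD; congr expR.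
  by field.
have tE : expR (ln u - ln v) = u / v by rewrite expRD expRN !lnK.
have := expR_sub1_ge q (ln u - ln v); rewrite wE tE.
have -> : `|u / v - 1| / (u / v + 1) = `|u - v| / (u + v).
  have -> : u / v - 1 = (u - v) / v by field; rewrite gt_eqF.
  rewrite normrM normfV (gtr0_norm v0).
  by field; rewrite !gt_eqF // ?addr_gt0 // divr_gt0.
set W := `|_ - 1| => hW.
have duv : 0 < `|u - v| by rewrite normr_gt0 subr_eq0.
have uv : 0 < u + v by rewrite addr_gt0.
have qq : 0 < 1 + `|q| by rewrite ltr_pwDl.
have k0 : 0 < `|q| / (1 + `|q|) * (`|u - v| / (u + v)) by rewrite mulr_gt0 ?divr_gt0.
have W0 : 0 < W by exact: lt_le_trans hW.
split; first by rewrite -subr_eq0 -normr_gt0.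
apply: (@le_trans _ _ (u * (`|q| / (1 + `|q|) * (`|u - v| / (u + v))))^-1).
  by rewrite lef_pV2 ?posrE ?(mulr_gt0 u0 k0) ?(mulr_gt0 u0 W0) // ler_pM2l.
have -> : (u * (`|q| / (1 + `|q|) * (`|u - v| / (u + v))))^-1 =
    (1 + `|q|) / `|q| * ((u + v) / `|u - v| / u).
  by field; rewrite !gt_eqF.
have -> : 2 * (1 + `|q|) / `|q| * (u^-1 + `|u - v|^-1) =
    (1 + `|q|) / `|q| * (2 * (u^-1 + `|u - v|^-1)) by ring.
apply: ler_wpM2l; first by rewrite divr_ge0 // ltW.
have -> : 2 * (u^-1 + `|u - v|^-1) = (2 * (u + `|u - v|)) / `|u - v| / u.
  by field; rewrite !gt_eqF.
rewrite ler_pM2r ?invr_gt0 // ler_pM2r ?invr_gt0 //.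
have := ler_norm (u - v); have := ler_norm (v - u); rewrite (distrC v u); lra.
Qed.
End Osc.

(** The pieces [[a, p1]] and [[p2, p3]] are short; the other two stay to the right of one and at
    unit distance from [u0].  Clipping the cut points to [[a, b]] lets any of the pieces be
    degenerate. *)
Lemma cut_around (R : realFieldType) (a b u0 : R) : 0 <= a -> a <= b -> exists p1 p2 p3 : R,
  [/\ a <= p1, p1 <= p2, p2 <= p3, p3 <= b &
   [/\ p1 - a <= 1, p3 - p2 <= 2, p1 = p2 \/ (1 <= p1 /\ p2 <= u0 - 1) &
       p3 = b \/ (1 <= p3 /\ u0 + 1 <= p3)]].
Proof.
move=> a0 ab; pose clip s := Num.min (Num.max s a) b.
have clip_a s : a <= clip s by rewrite le_min ab le_max lexx orbT.
have clip_b s : clip s <= b by rewrite ge_min lexx orbT.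
have clip_mono s t : s <= t -> clip s <= clip t by move=> st; rewrite le_min2 // le_max2.
have clip_up s : clip s = a \/ clip s <= s.
  rewrite /clip; case: (leP s a) => sa; first by left; rewrite min_l.
  by right; rewrite ge_min lexx.
have clip_dn s : clip s = b \/ s <= clip s.
  rewrite /clip; case: (leP (Num.max s a) b) => sb; last by left.
  by right; rewrite le_max lexx.
set v := Num.max 1 (u0 - 1); set w := Num.max 1 (u0 + 1).
have v1 : 1 <= v by rewrite le_max lexx.
have vw : v <= w by rewrite le_max2 //; lra.
have wv : w <= v + 2.
  by rewrite ge_max -!lerBlDr !le_max; apply/andP; split; apply/orP; [left|right]; lra.
exists (clip 1), (clip v), (clip w).
have h1 := clip_mono _ _ v1; have h2 := clip_mono _ _ vw.
split=> //; split.
- by case: (clip_up 1) => [->|h]; lra.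
- case: (clip_up w) => [e|wu]; first by have := clip_a v; lra.
  by case: (clip_dn v) => [e|vd]; [have := clip_b w|]; lra.
- case: (clip_up v) => [e|vu]; first by left; have := clip_a 1; lra.
  case: (clip_dn 1) => [e|d1]; first by left; have := clip_b v; lra.
  case: (leP (clip v) 1) => c1; [left; lra|right; split=> //].
  by move: vu; rewrite le_max => /orP[|//]; lra.
- case: (clip_dn w) => [->|wd]; [by left|right].
  by move: wd; rewrite ge_max => /andP.
Qed.

Section Osc2.
Context {R : realType}.
Notation mu := (@lebesgue_measure R).

(** In the variable [u] the linear phase is [x * u^(q+2)], the dispersive one [u^2]; the
    logarithm is the trace of the imaginary part of the interpolation parameter. *)
Definition phase (q x y c u : R) : R :=
  x * u ^+ 2 * expR (q * ln u) - u ^+ 2 + (y * ln u + c).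

Lemma continuous_cos_phase (q x y c u : R) : 0 < u ->
  {for u, continuous (fun u => cos (phase q x y c u))}.
Proof.
move=> u0; have dl := is_derive1_ln u0.
by apply: derivable_continuous; rewrite /phase; apply: ex_derive.
Qed.

(** The derivative of [psi = x u^(q+2) - u^2] is [2 u (w - 1)] with [w = x (q+2) / 2 * u^q], so
    [stationary_point] bounds its reciprocal, uniformly in [x].  The logarithm plays the role of
    [rho] and costs the factor [1 + |y|]. *)
Lemma osc_nonstationary (q : R) : q != 0 -> -1 <= q ->
  exists2 C : R, 0 < C & forall x y : R, exists u0 : R, forall (c a b : R), 1 <= a -> a <= b ->
   (b <= u0 - 1 \/ u0 + 1 <= a) ->
   `|\int[mu]_(u in `[a, b]) cos (phase q x y c u)| <= C * (1 + `|y|).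
Proof.
move=> q0 qN1; have aq : 0 < `|q| by rewrite normr_gt0.
pose K := 2 * (1 + `|q|) / `|q|.
have K0 : 0 < K by rewrite divr_gt0 // mulr_gt0 // ltr_pwDl.
pose L := (q + 1) * K + `|q| * K ^+ 2 + K.
have L0 : 0 < L.
  have h1 : 0 <= (q + 1) * K by apply: mulr_ge0; [lra|exact: ltW].
  have h2 : 0 <= `|q| * K ^+ 2 by rewrite mulr_ge0 // sqr_ge0.
  by rewrite /L; lra.
exists (2 * K + 2 * L); first by rewrite addr_gt0 // mulr_gt0.
move=> x y; have [u0 hu0] := stationary_point (x * (q + 2) / 2) q0.
exists u0 => c a b a1 ab hs.
have out u : a <= u <= b -> 1 <= u /\ 1 <= `|u - u0|.
  move=> /andP[au ub]; split; first exact: le_trans au.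
  have [h|h] := hs; first by rewrite distrC ger0_norm; lra.
  by rewrite ger0_norm; lra.
have pos u : a <= u <= b -> 0 < u by move=> /out[h _]; lra.
have nu0 u : a <= u <= b -> u - u0 != 0.
  by move=> /out[_ h]; rewrite -normr_gt0; lra.
pose w u := x * (q + 2) / 2 * expR (q * ln u).
pose psi u := x * u ^+ 2 * expR (q * ln u) - u ^+ 2.
pose psi1 u := 2 * u * (w u - 1).
pose psi2 u := 2 * ((q + 1) * w u - 1).
pose rho u := y * ln u + c.
pose rho1 u := y * u^-1.
pose H u := - (L * (1 + `|y|)) * (u^-1 + (u - u0)^-1).
pose H1 u := L * (1 + `|y|) * (u ^- 2 + (u - u0) ^- 2).
have y1 : 0 < 1 + `|y| by rewrite ltr_pwDl.
have wbd u : a <= u <= b -> w u != 1 /\ (u * `|w u - 1|)^-1 <= K * (u^-1 + `|u - u0|^-1).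
  by move=> uab; apply: hu0; [exact: pos|rewrite -subr_eq0; exact: nu0].
have inv2 u : a <= u <= b -> u^-1 + `|u - u0|^-1 <= 2.
  move=> /out[h1 h2]; have := @invf_le1 _ u; have := @invf_le1 _ `|u - u0|.
  rewrite h1 h2 => i1 i2; have := i1 (lt_le_trans ltr01 h2); have := i2 (lt_le_trans ltr01 h1); lra.
apply: (@le_trans _ _ (2 * K + (H b - H a))).
  apply: (@nonstationary_phase _ psi psi1 psi2 rho rho1 H H1 a b K ab).
  - move=> u uab; have u0' := pos _ uab; have dl := is_derive1_ln u0'; rewrite /psi /psi1 /w.
    by apply: is_derive_eq; rewrite /GRing.scale /= ?mulr1; field; rewrite gt_eqF.
  - move=> u uab; have u0' := pos _ uab; have dl := is_derive1_ln u0'; rewrite /psi1 /psi2 /w.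
    by apply: is_derive_eq; rewrite /GRing.scale /= ?mulr1; field; rewrite gt_eqF.
  - move=> u uab; have u0' := pos _ uab; have dl := is_derive1_ln u0'; rewrite /rho /rho1.
    by apply: is_derive_eq; rewrite /GRing.scale /= ?mulr1; ring.
  - move=> u uab; have u0' := pos _ uab; have dl := is_derive1_ln u0'; rewrite /H /H1.
    have d1 := @is_deriveV _ id u 1 1 (lt0r_neq0 u0') (is_derive_id _ _).
    have d2 : is_derive u (1 : R) (fun u => u - u0) 1.
      by apply: is_derive_eq; rewrite subr0.
    have d3 := @is_deriveV _ (fun u => u - u0) u 1 1 (nu0 _ uab) d2.
    by apply: is_derive_eq; rewrite /GRing.scale /= ?mulr1; ring.
  - move=> u uab; have u0' := pos _ uab; have dl := is_derive1_ln u0'.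
    by apply: derivable_continuous; rewrite /psi2 /w; apply: ex_derive.
  - move=> u uab; apply: cvgM; first exact: cvg_cst.
    by apply: cvgV; [exact: lt0r_neq0 (pos _ uab)|exact: cvg_id].
  - move=> u uab; apply: cvgM; first exact: cvg_cst.
    apply: cvgD.
      apply: cvgV; first by rewrite expf_neq0 // lt0r_neq0 // (pos _ uab).
      by apply: exprn_continuous.
    apply: cvgV; first by rewrite expf_neq0 // nu0.
    have : {for u, continuous (fun u => (u - u0) ^+ 2)}.
      by apply: derivable_continuous; apply: ex_derive.
    exact.
  - move=> u uab; have [w1 _] := wbd _ uab.
    apply: mulf_neq0; last by rewrite subr_eq0.
    by apply: mulf_neq0; [rewrite pnatr_eq0|exact: lt0r_neq0 (pos _ uab)].
  - move=> u uab; have [w1 wb] := wbd _ uab; have u0' := pos _ uab.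
    have w1' : 0 < `|w u - 1| by rewrite normr_gt0 subr_eq0.
    have -> : `|psi1 u|^-1 = 2^-1 * (u * `|w u - 1|)^-1.
      rewrite /psi1 !normrM (gtr0_norm u0') ger0_norm //.
      by field; rewrite !gt_eqF.
    have := inv2 _ uab; have : 0 <= u^-1 + `|u - u0|^-1 by rewrite addr_ge0 ?invr_ge0 // ltW.
    nra.
  - move=> u uab; have [w1 wb] := wbd _ uab; have u0' := pos _ uab.
    have w1' : 0 < `|w u - 1| by rewrite normr_gt0 subr_eq0.
    set A := u^-1 + `|u - u0|^-1 in wb; set Z := (u * `|w u - 1|)^-1 in wb.
    have Z0 : 0 <= Z by rewrite invr_ge0 mulr_ge0 // ltW.
    have iu : 0 < u^-1 by rewrite invr_gt0.
    have uA : u^-1 <= A by rewrite lerDl invr_ge0.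
    have A2 : A ^+ 2 <= 2 * (u ^- 2 + (u - u0) ^- 2).
      rewrite /A -[(u - u0) ^+ 2]real_normK ?num_real // -!exprVn.
      have := sqr_ge0 (u^-1 - `|u - u0|^-1); nra.
    have p2 : `|psi2 u| / psi1 u ^+ 2 <= 2^-1 * ((q + 1) * (u^-1 * Z) + `|q| * Z ^+ 2).
      have -> : psi1 u ^+ 2 = 4 * u ^+ 2 * `|w u - 1| ^+ 2.
        by rewrite real_normK ?num_real // /psi1; ring.
      have -> : 2^-1 * ((q + 1) * (u^-1 * Z) + `|q| * Z ^+ 2) =
          2 * ((q + 1) * `|w u - 1| + `|q|) / (4 * u ^+ 2 * `|w u - 1| ^+ 2).
        by rewrite /Z; field; rewrite !gt_eqF.
      apply: ler_wpM2r.
        by rewrite invr_ge0; apply: mulr_ge0; [apply: mulr_ge0 => //|]; exact: sqr_ge0.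
      rewrite /psi2 normrM ger0_norm // ler_wpM2l //.
      have -> : (q + 1) * w u - 1 = (q + 1) * (w u - 1) + q by ring.
      apply: (le_trans (ler_normD _ _)).
      by rewrite normrM [`|q + 1|]ger0_norm //; lra.
    have p3 : `|rho1 u| / `|psi1 u| <= 2^-1 * (`|y| * (u^-1 * Z)).
      rewrite /rho1 /psi1 !normrM (gtr0_norm u0') (gtr0_norm iu) /Z normr_nat.
      rewrite le_eqVlt; apply/orP; left; apply/eqP.
      by field; rewrite !gt_eqF.
    have A0 : 0 <= A by lra.
    have h1 : u^-1 * Z <= K * A ^+ 2.
      apply: (@le_trans _ _ (A * (K * A))); first by apply: ler_pM => //; exact: ltW.
      by rewrite le_eqVlt; apply/orP; left; apply/eqP; ring.
    have h2 : Z ^+ 2 <= K ^+ 2 * A ^+ 2.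
      by rewrite -exprMn lerXn2r ?nnegrE // mulr_ge0 // ltW.
    apply: (@le_trans _ _ (2^-1 * (L * (1 + `|y|) * A ^+ 2))); last first.
      rewrite /H1; have : 0 <= L * (1 + `|y|) by rewrite mulr_ge0 // ltW.
      nra.
    apply: (le_trans (lerD p2 p3)); rewrite -mulrDr ler_wpM2l //.
    have h3 : (q + 1) * (u^-1 * Z) <= (q + 1) * (K * A ^+ 2) by rewrite ler_wpM2l //; lra.
    have h4 : `|q| * Z ^+ 2 <= `|q| * (K ^+ 2 * A ^+ 2) by rewrite ler_wpM2l.
    have h5 : `|y| * (u^-1 * Z) <= `|y| * (K * A ^+ 2) by rewrite ler_wpM2l.
    have h6 : 0 <= `|y| * (((q + 1) * K + `|q| * K ^+ 2) * A ^+ 2).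
      apply: mulr_ge0 => //; apply: mulr_ge0; last exact: sqr_ge0.
      by apply: addr_ge0; apply: mulr_ge0; [lra|exact: ltW| by []|exact: sqr_ge0].
    have h7 : 0 <= K * A ^+ 2 by rewrite mulr_ge0 ?sqr_ge0 // ltW.
    rewrite /L; nra.
have HH : H b - H a <= 2 * (L * (1 + `|y|)).
  have -> : H b - H a = L * (1 + `|y|) * (a^-1 + (a - u0)^-1 - b^-1 - (b - u0)^-1).
    by rewrite /H; ring.
  rewrite [leRHS]mulrC ler_wpM2l //; first by rewrite mulr_ge0 // ltW.
  have [oa1 oa2] : 1 <= a /\ 1 <= `|a - u0| by apply: out; rewrite lexx.
  have [ob1 ob2] : 1 <= b /\ 1 <= `|b - u0| by apply: out; rewrite lexx andbT.
  have ia : a^-1 <= 1 by rewrite invf_le1 //; lra.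
  have ib : 0 < b^-1 by rewrite invr_gt0; lra.
  have [h|h] := hs.
    have : (a - u0)^-1 < 0 by rewrite invr_lt0; lra.
    have : - (b - u0)^-1 <= 1 by rewrite -invrN invf_le1; lra.
    lra.
  have : (a - u0)^-1 <= 1 by rewrite invf_le1; lra.
  have : 0 < (b - u0)^-1 by rewrite invr_gt0; lra.
  lra.
have y0 := normr_ge0 y.
apply: (@le_trans _ _ (2 * K + 2 * (L * (1 + `|y|)))); first by rewrite lerD2l.
nra.
Qed.

(** Near the origin and near the stationary point the length of the interval is a sufficient
    bound; [osc_nonstationary] covers the rest. *)
Lemma osc_bound (q : R) : q != 0 -> -1 <= q ->
  exists2 C : R, 0 < C & forall x y c a b : R, 0 < a -> a <= b ->
   `|\int[mu]_(u in `[a, b]) cos (phase q x y c u)| <= C * (1 + `|y|).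
Proof.
move=> q0 qN1; have [C C0 hC] := osc_nonstationary q0 qN1.
(* Two non-stationary pieces, and two short ones of lengths one and two. *)
exists (2 * C + 3); first by rewrite addr_gt0 // mulr_gt0.
move=> x y c a b a0 ab; have [u0 {}hC] := hC x y.
pose I s t := \int[mu]_(u in `[s, t]) cos (phase q x y c u).
have cf s : a <= s -> {for s, continuous (fun u => cos (phase q x y c u))}.
  by move=> as_; apply: continuous_cos_phase; exact: lt_le_trans as_.
have split s r t : a <= s -> s <= r -> r <= t -> I s t = I s r + I r t.
  move=> as_ sr rt; apply: Rint_itv_split => // u /andP[su _].
  by apply: cf; exact: le_trans su.
have triv s t : a <= s -> s <= t -> `|I s t| <= t - s.
  move=> as_ st; apply: normr_Rint_itv_le1 => //; last by move=> u; exact: cos_max.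
  by move=> u /andP[su _]; apply: cf; exact: le_trans su.
have y0 := normr_ge0 y.
have [p1 [p2 [p3 [ap1 p12 p23 p3b [l1 l3 c2 c4]]]]] := cut_around u0 (ltW a0) ab.
have ap2 := le_trans ap1 p12; have ap3 := le_trans ap2 p23.
rewrite -/(I a b).
have -> : I a b = I a p1 + I p1 p2 + I p2 p3 + I p3 b.
  by rewrite -(split a) // -(split a) // -(split a).
have b1 : `|I a p1| <= 1 := le_trans (triv _ _ (lexx _) ap1) l1.
have b3 : `|I p2 p3| <= 2 := le_trans (triv _ _ ap2 p23) l3.
have Cy : 0 <= C * (1 + `|y|) by rewrite mulr_ge0 // ?ltW // ltr_pwDl.
have point s : `|I s s| <= C * (1 + `|y|) by rewrite /I set_itv1 Rintegral_set1 normr0.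
have b2 : `|I p1 p2| <= C * (1 + `|y|).
  by case: c2 => [->|[p11 p2u]]; [exact: point|apply: hC => //; left].
have b4 : `|I p3 b| <= C * (1 + `|y|).
  by case: c4 => [->|[p31 p3u]]; [exact: point|apply: hC => //; right].
apply: (le_trans (ler_normD _ _)); apply: (@le_trans _ _ (1 + C * (1 + `|y|) + 2 + C * (1 + `|y|))).
  apply: lerD => //; apply: (le_trans (ler_normD _ _)); apply: lerD => //.
  by apply: (le_trans (ler_normD _ _)); apply: lerD.
nra.
Qed.

Lemma Rint_subst (F f G : R -> R) (a b : R) : 0 < a -> a <= b ->
  (forall x : R, 0 < x -> is_derive x 1 F (f x)) ->
  (forall x, 0 < x -> {for x, continuous f}) ->
  (forall x y, 0 < x -> x < y -> F x < F y) ->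
  (forall x, F a <= x -> {for x, continuous G}) ->
  \int[mu]_(u in `[F a, F b]) G u = \int[mu]_(x in `[a, b]) (G (F x) * f x).
Proof.
move=> a0 ab dF cf iF cG.
have cF (x : R) : 0 < x -> {for x, continuous F}.
  by move=> /dF h; apply: derivable_continuous; apply: ex_derive.
have b0 : 0 < b by exact: lt_le_trans ab.
have E (x : R) : 0 < x -> (derive1 F) x = f x.
  by move=> /dF h; rewrite derive1E; apply: derive_val.
have cF' (x : R) : 0 < x -> {for x, continuous (derive1 F)}.
  move=> x0; rewrite /prop_for /continuous_at E //.
  apply: cvg_trans (cf _ x0); apply: near_eq_cvg; near=> y.
  rewrite E //; near: y; exact: lt_nbhsr.
rewrite /Rintegral integration_by_substitution_increasing //.
- congr fine; apply: eq_integral => x; rewrite inE /= in_itv /= => /andP[ax _].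
  by rewrite -[LHS]/((G (F x) * derive1 F x)%:E) E //; exact: lt_le_trans ax.
- move=> x y; rewrite !in_itv /= => /andP[ax _] _; apply: iF; exact: lt_le_trans ax.
- by move=> x; rewrite in_itv /= => /andP[ax _]; apply: cF'; exact: lt_trans ax.
- by apply/cvg_ex; exists ((derive1 F) a); apply: cvg_at_right_filter; exact: cF'.
- by apply/cvg_ex; exists ((derive1 F) b); apply: cvg_at_left_filter; exact: cF'.
- split.
  + move=> x; rewrite in_itv /= => /andP[ax _].
    have := dF x (lt_trans a0 ax) => h; exact: ex_derive.
  + by apply: cvg_at_right_filter; exact: cF.
  + by apply: cvg_at_left_filter; exact: cF.
- by apply: continuous_in_subspaceT => x; rewrite inE /= in_itv /= => /andP[h _]; exact: cG.
Unshelve. all: by end_near. Qed.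

End Osc2.

(** * The one-dimensional kernel *)

Section Kernel1.
Context {R : realType}.
Notation mu := (@lebesgue_measure R).

(** The phase of the kernel on the positive half-line; [y * ln s] is the phase of the
    imaginary power of the weight. *)
Definition disp (alpha t x y c s : R) : R :=
  x * s - t * expR (alpha * ln s) + y * ln s + c.

Lemma continuous_disp (a alpha t x y c s : R) : 0 < s ->
  {for s, continuous (fun s => expR (a * ln s) * cos (disp alpha t x y c s))}.
Proof.
move=> s0; have dl := is_derive1_ln s0.
by apply: derivable_continuous; rewrite /disp; apply: ex_derive.
Qed.

(** The substitution [u = t^(1/2) s^(alpha/2)] turns [s^(- (1 - alpha / 2)) ds] into a multiple of
    [du] and the dispersive part of the phase into [u^2]. *)
Lemma kernel_halfline_gt0 (alpha : R) : 0 < alpha <= 2 -> alpha != 1 ->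
  exists2 C : R, 0 < C & forall t x y c a b : R, 0 < t -> 0 < a -> a <= b ->
  `|\int[mu]_(s in `[a, b]) (expR (- (1 - alpha / 2) * ln s) * cos (disp alpha t x y c s))|
    <= C * (1 + `|y|) / Num.sqrt t.
Proof.
move=> /andP[al0 al2] al1; pose q := 2 / alpha - 2.
have alnz : alpha != 0 by rewrite gt_eqF.
have q0 : q != 0.
  rewrite /q subr_eq0; apply/negP => /eqP h; move/negP: al1; apply; apply/eqP.
  have : 2 = 2 * alpha by rewrite -{2}h mulfVK.
  lra.
have qN1 : -1 <= q.
  have : 1 <= 2 / alpha by rewrite ler_pdivlMr // mul1r.
  rewrite /q; lra.
have [C C0 hC] := osc_bound q0 qN1.
exists (C * (2 / alpha) ^+ 2); first by rewrite mulr_gt0 // exprn_gt0 // divr_gt0.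
move=> t x y c a b t0 a0 ab; set sg := Num.sqrt t.
have sg0 : 0 < sg by rewrite sqrtr_gt0.
have sg2 : sg ^+ 2 = t by rewrite sqr_sqrtr // ltW.
pose U s := sg * expR (alpha / 2 * ln s).
pose U' s := sg * (alpha / 2) * expR (- (1 - alpha / 2) * ln s).
have U0 s : 0 < U s by rewrite mulr_gt0 // expR_gt0.
have lnU s : ln (U s) = ln sg + alpha / 2 * ln s.
  by rewrite /U lnM ?posrE ?expR_gt0 // expRK.
have dU (s : R) : 0 < s -> is_derive s 1 U (U' s).
  move=> s0; have dl := is_derive1_ln s0; rewrite /U /U'.
  have -> : expR (- (1 - alpha / 2) * ln s) = s^-1 * expR (alpha / 2 * ln s).
    by rewrite -{2}(lnK s0) -expRN -expRD; congr expR; ring.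
  by apply: is_derive_eq; rewrite /GRing.scale /= ?mulr1; ring.
have ph (s : R) : 0 < s ->
    cos (phase q (x * expR (- (2 / alpha * ln sg))) (2 / alpha * y) (c - 2 / alpha * y * ln sg) (U s))
    = cos (disp alpha t x y c s).
  move=> s0; congr cos; rewrite /phase /disp lnU.
  have -> : x * expR (- (2 / alpha * ln sg)) * U s ^+ 2 * expR (q * (ln sg + alpha / 2 * ln s)) =
     x * s.
    rewrite -mulrA -mulrA; congr (x * _).
    have -> : U s ^+ 2 = expR (2 * (ln sg + alpha / 2 * ln s)).
      rewrite -lnU; have -> : 2 * ln (U s) = ln (U s) + ln (U s) by ring.
      by rewrite expRD lnK ?posrE // expr2.
    rewrite -!expRD -[RHS](lnK s0); congr expR; rewrite /q; field; exact: alnz.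
  have -> : U s ^+ 2 = t * expR (alpha * ln s).
    by rewrite /U exprMn sg2 expr2 -expRD; congr (_ * expR _); field.
  by field; exact: alnz.
have -> : \int[mu]_(s in `[a, b]) (expR (- (1 - alpha / 2) * ln s) * cos (disp alpha t x y c s)) =
    2 / alpha / sg * \int[mu]_(u in `[U a, U b])
     cos (phase q (x * expR (- (2 / alpha * ln sg))) (2 / alpha * y) (c - 2 / alpha * y * ln sg) u).
  rewrite (@Rint_subst _ U U' _ a b) //; last 3 first.
  - move=> s s0; have dl := is_derive1_ln s0.
    by apply: derivable_continuous; rewrite /U'; apply: ex_derive.
  - move=> r s r0 rs; rewrite /U ltr_pM2l // ltr_expR ltr_pM2l ?divr_gt0 //.
    by rewrite ltr_ln // posrE // (lt_trans r0).
  - by move=> u Uu; apply: continuous_cos_phase; exact: lt_le_trans Uu.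
  have h s : `[a, b]%classic s -> 0 < s.
    by rewrite /= in_itv /= => /andP[as_ _]; exact: lt_le_trans as_.
  rewrite -RintegralZl //.
    apply: eq_Rintegral => s; rewrite inE => /h s0; rewrite ph // /U'.
    by field; rewrite alnz gt_eqF.
  apply: continuous_itv_integrable => s /andP[as_ _].
  have s0 : 0 < s by exact: lt_le_trans as_.
  have c1 : {for s, continuous (fun s => cos (phase q (x * expR (- (2 / alpha * ln sg)))
      (2 / alpha * y) (c - 2 / alpha * y * ln sg) (U s)))}.
    have d1 := dU s s0.
    apply: (@continuous_comp _ _ _ U (fun u => cos (phase q (x * expR (- (2 / alpha * ln sg)))
      (2 / alpha * y) (c - 2 / alpha * y * ln sg) u))).
      by apply: derivable_continuous; apply: ex_derive.
    exact: continuous_cos_phase.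
  have c2 : {for s, continuous U'}.
    have dl := is_derive1_ln s0.
    by apply: derivable_continuous; rewrite /U'; apply: ex_derive.
  exact: (cvgM c1 c2).
have Uab : U a <= U b.
  rewrite /U ler_pM2l // ler_expR ler_pM2l ?divr_gt0 // ler_ln //.
  by rewrite posrE (lt_le_trans a0).
have al21 : 1 <= 2 / alpha by rewrite ler_pdivlMr // mul1r.
have iy := normr_ge0 y.
have k0 : 0 < 2 / alpha / sg by rewrite !divr_gt0.
rewrite normrM (gtr0_norm k0).
have := hC (x * expR (- (2 / alpha * ln sg))) (2 / alpha * y) (c - 2 / alpha * y * ln sg) _ _ (U0 a) Uab.
rewrite -(ler_pM2l k0) => h; apply: (le_trans h).
rewrite normrM (gtr0_norm (lt_le_trans ltr01 al21)).
have -> : C * (2 / alpha) ^+ 2 * (1 + `|y|) / sg =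
    2 / alpha / sg * (C * (2 / alpha + 2 / alpha * `|y|)) by ring.
by rewrite ler_pM2l // ler_pM2l // lerD2r.
Qed.

(** Negating all parameters negates the phase, and the cosine is even. *)
Lemma kernel_halfline (alpha : R) : 0 < alpha <= 2 -> alpha != 1 ->
  exists2 C : R, 0 < C & forall t x y c a b : R, t != 0 -> 0 < a -> a <= b ->
  `|\int[mu]_(s in `[a, b]) (expR (- (1 - alpha / 2) * ln s) * cos (disp alpha t x y c s))|
    <= C * (1 + `|y|) / Num.sqrt `|t|.
Proof.
move=> al al1; have [C C0 hC] := kernel_halfline_gt0 al al1; exists C => //.
move=> t x y c a b; rewrite neq_lt => /orP[t0|t0] a0 ab; last first.
  by rewrite (gtr0_norm t0); exact: hC.
rewrite (ltr0_norm t0) -[`|y|]normrN.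
have := hC (- t) (- x) (- y) (- c) a b; rewrite oppr_gt0 => /(_ t0 a0 ab).
congr (`|_| <= _); apply: eq_Rintegral => s _; congr (_ * _).
by rewrite -cosN; congr cos; rewrite /disp; ring.
Qed.

End Kernel1.

Section Kernel2.
Context {R : realType}.
Notation mu := (@lebesgue_measure R).

Lemma bm_expR d (T : measurableType d) (D : set T) (f : T -> R) :
  bm D f -> bm D (fun x => expR (f x)).
Proof.
move=> [mf [M fM]]; split; first exact: (measurableT_comp (@measurable_expR R) mf).
exists (expR M) => x Dx; rewrite ger0_norm ?expR_ge0 // ler_expR.
by apply: le_trans (fM _ Dx); exact: ler_norm.
Qed.

Lemma bmZ d (T : measurableType d) (D : set T) (f : T -> R) (r : R) :
  bm D f -> bm D (fun x => r * f x).
Proof. by move=> bf; apply: bmM => //; exact: bm_cst. Qed.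

(** The frequencies kept by the truncation; the logarithm is bounded on them. *)
Definition annulus (N : R) : set (measurableTypeR R) := `[- N, - N^-1] `|` `[N^-1, N].

Lemma measurable_annulus N : measurable (annulus N).
Proof. by apply: measurableU; exact: measurable_itv. Qed.

Lemma annulus_lty N : (mu (annulus N) < +oo)%E.
Proof.
apply: (@le_lt_trans _ _ (mu `[(- N)%R, (- N^-1)%R]%classic + mu `[N^-1%R, N]%classic)%E).
  by apply: measureU2; exact: measurable_itv.
by apply: lte_add_pinfty; exact: itv_lt_pinfty.
Qed.

Lemma annulusP N s : 1 <= N -> annulus N s -> N^-1 <= `|s| <= N.
Proof.
move=> N1; have N0 : 0 < N^-1 by rewrite invr_gt0 (lt_le_trans ltr01).
case; rewrite /= in_itv /= => /andP[h1 h2].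
  by rewrite ler0_norm; [apply/andP; split; lra|lra].
by rewrite ger0_norm; [apply/andP; split; lra|lra].
Qed.

Lemma annulusPP N s : 1 <= N -> N^-1 <= `|s| <= N -> annulus N s.
Proof.
move=> N1 /andP[h1 h2]; rewrite /annulus /= !in_itv /=.
case: (leP 0 s) h1 h2 => s0.
  by rewrite (ger0_norm s0) => h1 h2; right; rewrite h1.
by rewrite (ltr0_norm s0) => h1 h2; left; apply/andP; split; lra.
Qed.

Lemma measurable_lnabs : measurable_fun [set: measurableTypeR R] (fun s : R => ln `|s|).
Proof. by apply: (measurableT_comp (@measurable_ln R)); exact: normr_measurable. Qed.

Lemma bm_lnabs N : 1 <= N -> bm (annulus N) (fun s : R => ln `|s|).
Proof.
move=> N1; split; first exact: measurable_lnabs.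
have N0 : 0 < N by exact: lt_le_trans N1.
exists (ln N) => s /(annulusP N1)/andP[h1 h2].
have s0 : 0 < `|s| by apply: lt_le_trans h1; rewrite invr_gt0.
rewrite ler_norml; apply/andP; split; last by rewrite ler_ln.
by rewrite -lnV ?posrE // ler_ln // posrE invr_gt0.
Qed.

Lemma Rint_annulus (f : R -> R) (N : R) : 1 <= N -> bm (annulus N) f ->
  (forall s, s < 0 -> {for s, continuous f}) ->
  \int[mu]_(s in annulus N) f s =
  \int[mu]_(s in `[N^-1, N]) f (- s) + \int[mu]_(s in `[N^-1, N]) f s.
Proof.
move=> N1 bf cf; have N0 : 0 < N by exact: lt_le_trans N1.
have NV : 0 < N^-1 by rewrite invr_gt0.
have NN : N^-1 <= N.
  by apply: (@le_trans _ _ 1) => //; rewrite invf_le1.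
rewrite /annulus Rintegral_setU //=; last 2 first.
- apply: bm_integrable => //; [exact: measurable_annulus|exact: annulus_lty].
- apply/disj_setPS => s /= [] /=; rewrite !in_itv /= => /andP[_ h1] /andP[h2 _]; lra.
congr (_ + _); rewrite /Rintegral integration_by_substitution_oppr //.
apply: continuous_in_subspaceT => s; rewrite inE /= in_itv /= => /andP[_ h].
apply: cf; lra.
Qed.

Definition disp2 (alpha t x y s : R) : R :=
  x * s - t * expR (alpha * ln `|s|) + y * ln `|s|.

Lemma measurable_disp2 (alpha t x y : R) :
  measurable_fun [set: measurableTypeR R] (disp2 alpha t x y).
Proof.
have ml := measurable_lnabs.
apply: measurable_funD; last by apply: measurable_funM.
apply: measurable_funB; first exact: measurable_funM.
apply: measurable_funM => //; apply: (measurableT_comp (@measurable_expR R)).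
exact: measurable_funM.
Qed.

Lemma kernel_line (alpha : R) : 0 < alpha <= 2 -> alpha != 1 ->
  exists2 C : R, 0 < C & forall t x y c N : R, t != 0 -> 1 <= N ->
  `|\int[mu]_(s in annulus N)
      (expR (- (1 - alpha / 2) * ln `|s|) * cos (disp2 alpha t x y s + c))|
    <= C * (1 + `|y|) / Num.sqrt `|t|.
Proof.
move=> al al1; have [C C0 hC] := kernel_halfline al al1.
exists (2 * C); first by rewrite mulr_gt0.
move=> t x y c N t0 N1; have N0 : 0 < N by exact: lt_le_trans N1.
have NV : 0 < N^-1 by rewrite invr_gt0.
have NN : N^-1 <= N.
  by apply: (@le_trans _ _ 1) => //; rewrite invf_le1.
rewrite Rint_annulus //; last 2 first.
- apply: bmM; first by apply/bm_expR/bmZ/bm_lnabs.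
  by apply: bm_cos; apply: measurable_funD => //; exact: measurable_disp2.
- move=> s s0; rewrite /disp2.
  have ns0 : 0 < - s by rewrite oppr_gt0.
  have c1 := @continuous_disp R (- (1 - alpha / 2)) alpha t (- x) y c (- s) ns0.
  have : {for s, continuous (fun s => expR (- (1 - alpha / 2) * ln (- s)) * cos (disp alpha t (- x) y c (- s)))}.
    have c0 : {for s, continuous (-%R : R -> R)} by exact: opp_continuous.
    exact: (continuous_comp c0 c1).
  move=> c2; rewrite /prop_for /continuous_at.
  rewrite (_ : expR (- (1 - alpha / 2) * ln `|s|) *
    cos (x * s - t * expR (alpha * ln `|s|) + y * ln `|s| + c) =
    expR (- (1 - alpha / 2) * ln (- s)) * cos (disp alpha t (- x) y c (- s))); last first.
    by rewrite ltr0_norm // /disp mulrNN.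
  apply: cvg_trans c2; apply: near_eq_cvg; near=> r.
  rewrite ltr0_norm /disp ?mulrNN //.
  by near: r; exact: lt_nbhsl.
have h s : s \in `[N^-1, N]%classic -> 0 < s.
  by rewrite inE /= in_itv /= => /andP[h _]; exact: lt_le_trans h.
apply: (le_trans (ler_normD _ _)).
have -> : 2 * C * (1 + `|y|) / Num.sqrt `|t| =
  C * (1 + `|y|) / Num.sqrt `|t| + C * (1 + `|y|) / Num.sqrt `|t| by ring.
apply: lerD.
- apply: le_trans (hC t (- x) y c N^-1 N t0 NV NN).
  rewrite le_eqVlt; apply/orP; left; apply/eqP; congr `|_|; apply: eq_Rintegral => s /h s0.
  by rewrite /disp2 /disp normrN (gtr0_norm s0) (_ : x * - s = - x * s) //; ring.
- apply: le_trans (hC t x y c N^-1 N t0 NV NN).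
  rewrite le_eqVlt; apply/orP; left; apply/eqP; congr `|_|; apply: eq_Rintegral => s /h s0.
  by rewrite /disp2 /disp (gtr0_norm s0).
Unshelve. all: by end_near. Qed.

End Kernel2.

(** * Products of sigma-finite measures *)

Section sigma_finite_product.
Context d1 d2 (T1 : measurableType d1) (T2 : measurableType d2) {R : realType}.
Variables (m1 : {sigma_finite_measure set T1 -> \bar R}) (m2 : {sigma_finite_measure set T2 -> \bar R}).

(** The product measure under a name that carries its sigma-finiteness, so that products can be
    iterated. *)
Definition sfprod : set (T1 * T2)%type -> \bar R := (m1 \x m2)%E.
HB.instance Definition _ := Measure.on sfprod.
Lemma sfprod_sigma_finite : sigma_finite setT sfprod.
Proof.
have [F FT Ffin] := sigma_finiteT m1; have [G GT Gfin] := sigma_finiteT m2.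
pose e (n : nat) : nat * nat := odflt (0, 0)%N (unpickle n).
exists (fun n => F (e n).1 `*` G (e n).2).
  apply/seteqP; split => // -[x y] _.
  have [i _ Fi] : (\bigcup_i F i) x by rewrite -FT.
  have [j _ Gj] : (\bigcup_i G i) y by rewrite -GT.
  by exists (pickle (i, j)) => //; rewrite /e pickleK.
move=> n; have [mF lF] := Ffin (e n).1; have [mG lG] := Gfin (e n).2.
split; first exact: measurableX.
exact: (finite_measureX mF mG lF lG).
Qed.
HB.instance Definition _ := Measure_isSigmaFinite.Build _ _ _ sfprod sfprod_sigma_finite.
End sigma_finite_product.

(** * The kernel in the plane and Bessel's inequality *)

Section Bessel.
Context {R : realType}.
Notation mu := (@lebesgue_measure R).
Notation RR := (measurableTypeR R).
Notation mu2 := (sfprod (@lebesgue_measure R) (@lebesgue_measure R)).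

Lemma kernel_plane (alpha1 alpha2 : R) : 0 < alpha1 <= 2 -> alpha1 != 1 ->
  0 < alpha2 <= 2 -> alpha2 != 1 ->
  exists2 C : R, 0 < C & forall t x1 x2 y1 y2 c N : R, t != 0 -> 1 <= N ->
  `|\int[mu2]_(z in annulus N `*` annulus N)
      (expR (- (1 - alpha1 / 2) * ln `|z.1|) * expR (- (1 - alpha2 / 2) * ln `|z.2|) *
       cos (disp2 alpha1 t x1 y1 z.1 + (disp2 alpha2 t x2 y2 z.2 + c)))|
    <= C * (1 + `|y1|) * (1 + `|y2|) / `|t|.
Proof.
move=> h1 h1' h2 h2'.
have [C1 C10 H1] := kernel_line h1 h1'; have [C2 C20 H2] := kernel_line h2 h2'.
exists (2 * (C1 * C2)); first by rewrite !mulr_gt0.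
move=> t x1 x2 y1 y2 c N t0 N1.
have -> : 2 * (C1 * C2) * (1 + `|y1|) * (1 + `|y2|) / `|t| =
    2 * ((C1 * (1 + `|y1|) / Num.sqrt `|t|) * (C2 * (1 + `|y2|) / Num.sqrt `|t|)).
  have E : `|t| = Num.sqrt `|t| * Num.sqrt `|t| by rewrite -expr2 sqr_sqrtr.
  rewrite [X in _ / X = _]E.
  by field; rewrite gt_eqF // sqrtr_gt0 normr_gt0.
have ba (a : R) : bm (annulus N) (fun s : R => expR (a * ln `|s|)).
  by apply/bm_expR/bmZ/bm_lnabs.
apply: (@normr_Rint_cosD _ _ _ RR RR mu mu _ _ (measurable_annulus N) (measurable_annulus N)
  (annulus_lty N) (annulus_lty N) _ (disp2 alpha1 t x1 y1) _
  (fun s => disp2 alpha2 t x2 y2 s + c) _ _ (ba _) (ba _)).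
- exact: measurable_disp2.
- by apply: measurable_funD => //; exact: measurable_disp2.
- by move=> c'; exact: H1.
- move=> c'; under eq_Rintegral do rewrite -addrA; exact: H2.
Qed.

(** The double zeros at both ends remove all boundary terms from two integrations by parts. *)
Definition bump (L s : R) : R := (1 - (s / L) ^+ 2) ^+ 2.

Lemma bump_ge0 L s : 0 <= bump L s. Proof. exact: sqr_ge0. Qed.

(** The trivial bound [2 L], together with two integrations by parts for large [x]. *)
Lemma bump_fourier (L x c : R) : 0 < L ->
  `|\int[mu]_(s in `[- L, L]) (bump L s * cos (x * s + c))| <= 18 * (L / (1 + (L * x) ^+ 2)).
Proof.
move=> L0; have LL : - L <= L by lra.
have Ln : L != 0 by rewrite gt_eqF.
pose v1 s := - 4 * (s / L ^+ 2) * (1 - (s / L) ^+ 2).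
pose v2 s := - 4 / L ^+ 2 + 12 * s ^+ 2 / L ^+ 4.
have sL s : `[- L, L]%classic s -> (s / L) ^+ 2 <= 1.
  rewrite /= in_itv /= => /andP[h1 h2].
  by rewrite expr_div_n ler_pdivrMr ?exprn_gt0 // mul1r; nra.
have cb : continuous (fun s => bump L s * cos (x * s + c)).
  by move=> s; apply: derivable_continuous; rewrite /bump; apply: ex_derive.
have c2 : continuous (fun s => v2 s * cos (x * s + c)).
  by move=> s; apply: derivable_continuous; rewrite /v2; apply: ex_derive.
have ib : mu.-integrable `[- L, L] (EFin \o (fun s => bump L s * cos (x * s + c))).
  by apply: continuous_itv_integrable => s _; exact: cb.
have i2 : mu.-integrable `[- L, L] (EFin \o (fun s => v2 s * cos (x * s + c))).
  by apply: continuous_itv_integrable => s _; exact: c2.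
have ic r : mu.-integrable `[- L, L] (EFin \o (fun=> r : R)).
  by apply: continuous_itv_integrable => s _; exact: cst_continuous.
have cst r : \int[mu]_(s in `[- L, L]) (r : R) = r * (2 * L).
  have -> : \int[mu]_(s in `[- L, L]) (r : R) = r * L - r * - L; last by ring.
  apply: (@Rint_FTC _ (fun s => r * s) (fun=> r)) => // s _; last exact: cst_continuous.
  by apply: is_derive_eq; rewrite /GRing.scale /= mulr1.
have E : x ^+ 2 * \int[mu]_(s in `[- L, L]) (bump L s * cos (x * s + c)) =
    - \int[mu]_(s in `[- L, L]) (v2 s * cos (x * s + c)).
  apply/eqP; rewrite -subr_eq0 opprK -RintegralZl // -RintegralD //; last first.
    exact: integrableMl_cst.
  pose F s := x * bump L s * sin (x * s + c) + v1 s * cos (x * s + c).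
  have -> : \int[mu]_(s in `[- L, L]) (x ^+ 2 * (bump L s * cos (x * s + c)) + v2 s * cos (x * s + c))
      = F L - F (- L).
    apply: Rint_FTC => // s _.
      rewrite /F /bump /v1 /v2.
      by apply: is_derive_eq; rewrite /GRing.scale /= ?mulr1; field; exact: Ln.
    by apply: cvgD; [apply: cvgM; [exact: cvg_cst|exact: cb]|exact: c2].
  by rewrite /F /bump /v1; apply/eqP; field; exact: Ln.
set I := \int[mu]_(s in _) _ in E *.
have I1 : `|I| <= 2 * L.
  rewrite -[2 * L]mul1r -(cst 1); apply: normr_Rint_le => // s /sL h.
  rewrite normrM ger0_norm ?bump_ge0 // mulr_ile1 ?bump_ge0 ?cos_max //.
  by rewrite /bump exprn_ile1 ?subr_ge0 // lerBlDr lerDl sqr_ge0.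
have I2 : x ^+ 2 * `|I| <= 16 / L.
  rewrite -[x ^+ 2]ger0_norm ?sqr_ge0 // -normrM E normrN.
  have -> : 16 / L = 8 / L ^+ 2 * (2 * L) by field.
  rewrite -cst; apply: normr_Rint_le => // s /sL h.
  rewrite normrM -[leRHS]mulr1; apply: ler_pM => //; last exact: cos_max.
  have -> : v2 s = (12 * (s / L) ^+ 2 - 4) / L ^+ 2 by rewrite /v2; field; exact: Ln.
  rewrite normrM normfV (ger0_norm (sqr_ge0 L)) ler_pM2r ?invr_gt0 ?exprn_gt0 //.
  by rewrite ler_norml; have := sqr_ge0 (s / L); lra.
have p := oneDsqr_pos (L * x).
rewrite mulrA ler_pdivlMr // exprMn mulrDr mulr1.
have : L ^+ 2 * (x ^+ 2 * `|I|) <= L ^+ 2 * (16 / L) by rewrite ler_wpM2l ?sqr_ge0.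
have -> : L ^+ 2 * (16 / L) = 16 * L by field.
lra.
Qed.

(** The majorant of the Fourier transform of [bump L]; its integral does not depend on [L]. *)
Definition poisson (L x : R) : R := 18 * (L / (1 + (L * x) ^+ 2)).

Lemma poisson_ge0 L x : 0 < L -> 0 <= poisson L x.
Proof.
by move=> L0; rewrite /poisson mulr_ge0 // divr_ge0 // ltW // oneDsqr_pos.
Qed.

Lemma poisson_le L x : 0 < L -> poisson L x <= 18 * L.
Proof.
move=> L0; rewrite /poisson ler_pM2l // ler_pdivrMr ?oneDsqr_pos //.
by have := sqr_ge0 (L * x); nra.
Qed.

Lemma continuous_poisson L : continuous (poisson L).
Proof.
move=> x; apply: cvgM; first exact: cvg_cst.
apply: cvgM; first exact: cvg_cst.
apply: cvgV; first by rewrite gt_eqF // oneDsqr_pos.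
have : {for x, continuous (fun x => 1 + (L * x) ^+ 2)}.
  by apply: derivable_continuous; apply: ex_derive.
exact.
Qed.

Lemma integral_poisson L x0 : 0 < L -> (\int[mu]_x (poisson L (x - x0))%:E = (18 * pi)%:E)%E.
Proof.
move=> L0; rewrite /poisson.
under eq_integral do rewrite EFinM.
rewrite ge0_integralZl //; last 2 first.
- apply/measurable_EFinP; apply: continuous_measurable_fun => x.
  have : {for x, continuous (fun x => (L / (1 + (L * (x - x0)) ^+ 2)))}; last exact.
  apply: cvgM; first exact: cvg_cst.
  apply: cvgV; first by rewrite gt_eqF // oneDsqr_pos.
  have : {for x, continuous (fun x => 1 + (L * (x - x0)) ^+ 2)}; last exact.
  by apply: derivable_continuous; apply: ex_derive.
- by move=> x _; rewrite lee_fin divr_ge0 // ltW // oneDsqr_pos.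
rewrite EFinM -integral_oneDsqr; congr (_ * _)%E.
rewrite -(@integral_affine _ (fun y => (1 + y ^+ 2)^-1) L x0) //.
- by move=> y; exact: continuous_oneDsqrV.
- by move=> y; rewrite invr_ge0 ltW // oneDsqr_pos.
Qed.

Lemma Rint_le_integral d (T : measurableType d) (nu : {measure set T -> \bar R})
    (D : set T) (f : T -> R) (r : R) : measurable D -> measurable_fun [set: T] f ->
  (forall x, 0 <= f x) -> (\int[nu]_x (f x)%:E <= r%:E)%E -> \int[nu]_(x in D) f x <= r.
Proof.
move=> mD mf f0 fr.
have h : (\int[nu]_(x in D) (f x)%:E <= r%:E)%E.
  apply: le_trans fr; apply: ge0_subset_integral => //.
  - exact/measurable_EFinP.
  - by move=> x _; rewrite lee_fin.
rewrite -lee_fin /Rintegral fineK // ge0_fin_numE.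
  exact: le_lt_trans h (ltry _).
by apply: integral_ge0 => x _; rewrite lee_fin.
Qed.

Lemma Rint_poisson2_le (L x0 y0 : R) (D : set (RR * RR)) : 0 < L -> measurable D ->
  \int[mu2]_(z in D) (poisson L (z.1 - x0) * poisson L (z.2 - y0)) <= (18 * pi) ^+ 2.
Proof.
move=> L0 mD.
have mp (a : R) : measurable_fun [set: RR] (fun s : R => poisson L (s - a)).
  apply: continuous_measurable_fun => x.
  have : {for x, continuous (fun x => poisson L (x - a))}; last exact.
  apply: (@continuous_comp _ _ _ (fun x => x - a) (poisson L)); last exact: continuous_poisson.
  by apply: derivable_continuous; apply: ex_derive.
have mpp : measurable_fun [set: RR * RR] (fun z => poisson L (z.1 - x0) * poisson L (z.2 - y0)).
  by apply: measurable_funM; [exact: (measurableT_comp (mp x0) measurable_fst)|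
    exact: (measurableT_comp (mp y0) measurable_snd)].
apply: Rint_le_integral => //.
  by move=> z; rewrite mulr_ge0 // poisson_ge0.
rewrite (fubini_tonelli1 (fun z : RR * RR => (poisson L (z.1 - x0) * poisson L (z.2 - y0))%:E)) //; last 2 first.
- exact/measurable_EFinP.
- by move=> z; rewrite lee_fin mulr_ge0 // poisson_ge0.
rewrite /fubini_F /=.
under eq_integral => x _.
  under eq_integral do rewrite EFinM.
  rewrite ge0_integralZl //; last 3 first.
  - by apply/measurable_EFinP; exact: mp.
  - by move=> y _; rewrite lee_fin poisson_ge0.
  - by rewrite lee_fin poisson_ge0.
  rewrite integral_poisson //.
  over.
rewrite ge0_integralZr //; last 3 first.
- by apply/measurable_EFinP; exact: mp.
- by move=> y _; rewrite lee_fin poisson_ge0.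
- by rewrite lee_fin mulr_ge0 // pi_ge0.
by rewrite integral_poisson // -EFinM expr2.
Qed.

Definition lin (zeta : RR * RR) (z : RR * RR) : R := zeta.1 * z.1 + zeta.2 * z.2.

Section bessel.
Variables (D : set (RR * RR)) (f phi : RR * RR -> R).
Hypotheses (mD : measurable D) (fD : (mu2 D < +oo)%E).
Hypotheses (bf : bm D f) (mphi : measurable_fun [set: RR * RR] phi).

Let C zeta := \int[mu2]_(z in D) (f z * cos (lin zeta z + phi z)).
Let S zeta := \int[mu2]_(z in D) (f z * sin (lin zeta z + phi z)).

Lemma measurable_lin zeta : measurable_fun [set: RR * RR] (lin zeta).
Proof. by apply: measurable_funD; apply: measurable_funM. Qed.

Lemma measurable_lin2 : measurable_fun [set: (RR * RR) * (RR * RR)] (fun p => lin p.1 p.2).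
Proof.
have m1 := @measurable_fst _ _ (RR * RR)%type (RR * RR)%type.
have m2 := @measurable_snd _ _ (RR * RR)%type (RR * RR)%type.
have f1 := @measurable_fst _ _ RR RR.
have f2 := @measurable_snd _ _ RR RR.
apply: measurable_funD; apply: measurable_funM.
- exact: (measurableT_comp f1 m1).
- exact: (measurableT_comp f1 m2).
- exact: (measurableT_comp f2 m1).
- exact: (measurableT_comp f2 m2).
Qed.

(** Expanding the square of a Fourier integral makes the frequency appear only in a phase
    difference, so that a later integration over frequencies can be done first. *)
Lemma energy_double (zeta : RR * RR) :
  C zeta ^+ 2 + S zeta ^+ 2 = \int[(mu2 \x mu2)%E]_(p in D `*` D)
    (f p.1 * f p.2 * cos ((lin zeta p.1 + phi p.1) + - (lin zeta p.2 + phi p.2))).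
Proof.
have mlp : measurable_fun [set: RR * RR] (fun z => lin zeta z + phi z).
  by apply: measurable_funD => //; exact: measurable_lin.
rewrite (@Rint_cosD _ _ _ _ _ mu2 mu2 D D mD mD fD fD f (fun z => lin zeta z + phi z)
   f (fun z => - (lin zeta z + phi z)) bf bf mlp); last exact: measurableT_comp.
under [X in _ = _ * X - _]eq_Rintegral do rewrite cosN.
under [X in _ = _ - _ * X]eq_Rintegral do rewrite sinN mulrN.
rewrite -/(C zeta) -/(S zeta).
have -> : \int[mu2]_(y in D) - (f y * sin (lin zeta y + phi y)) = - S zeta.
  rewrite -mulN1r -RintegralZl //.
    by apply: eq_Rintegral => y _; rewrite mulN1r.
  by apply: bm_integrable => //; apply: bmM => //; apply: bm_sin.
by rewrite !expr2; ring.
Qed.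

Lemma Rint_subset_ge0 d (T : measurableType d) (nu : {measure set T -> \bar R})
    (A B : set T) (g : T -> R) : measurable A -> measurable B -> A `<=` B ->
  nu.-integrable B (EFin \o g) -> (forall x, B x -> 0 <= g x) ->
  \int[nu]_(x in A) g x <= \int[nu]_(x in B) g x.
Proof.
move=> mA mB AB ig g0; rewrite /Rintegral; apply: fine_le.
- by apply: integrable_fin_num => //; exact: (integrableS mB).
- exact: integrable_fin_num.
- apply: ge0_subset_integral => //; first exact: (measurable_int nu).
Qed.

Lemma energy_kernel (L : R) (z z' : RR * RR) : 0 < L ->
  `|\int[mu2]_(zeta in `[- L, L] `*` `[- L, L])
     (bump L zeta.1 * bump L zeta.2 *
      cos ((lin zeta z + phi z) + - (lin zeta z' + phi z')))|
  <= 2 * (poisson L (z.1 - z'.1) * poisson L (z.2 - z'.2)).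
Proof.
move=> L0.
have bb : bm `[- L, L]%classic (bump L : RR -> R).
  split; first by apply: continuous_measurable_fun => s; apply: derivable_continuous;
    rewrite /bump; apply: ex_derive.
  exists 1 => s; rewrite /= in_itv /= => /andP[h1 h2].
  have h : (s / L) ^+ 2 <= 1 by rewrite expr_div_n ler_pdivrMr ?exprn_gt0 // mul1r; nra.
  rewrite ger0_norm ?bump_ge0 // exprn_ile1 ?subr_ge0 //.
  by rewrite lerBlDr lerDl sqr_ge0.
have mL (a c : R) : measurable_fun [set: RR] (fun s : R => a * s + c).
  by apply: measurable_funD => //; apply: measurable_funM.
have mI : measurable (`[- L, L]%classic : set RR) by exact: measurable_itv.
have fI := itv_lt_pinfty (- L) L.
have := @normr_Rint_cosD R _ _ RR RR mu mu _ _ mI mI fI fI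
  (bump L) (fun s => (z.1 - z'.1) * s + 0) (bump L) (fun s => (z.2 - z'.2) * s + (phi z - phi z'))
  (poisson L (z.1 - z'.1)) (poisson L (z.2 - z'.2)) bb bb (mL _ _) (mL _ _).
have h (a c c' : R) : `|\int[mu]_(s in `[- L, L]) (bump L s * cos (a * s + c + c'))| <= poisson L a.
  by under eq_Rintegral do rewrite -addrA; exact: bump_fourier.
move=> /(_ (fun c => h _ _ c) (fun c => h _ _ c)).
congr (`|_| <= _); apply: eq_Rintegral => zeta _; congr (_ * cos _).
by rewrite /lin; ring.
Qed.

Lemma bm_itv_bump (L : R) : 0 < L ->
  bm (`[- L, L] `*` `[- L, L]) (fun zeta : RR * RR => bump L zeta.1 * bump L zeta.2).
Proof.
move=> L0.
have bb : bm `[- L, L]%classic (bump L : RR -> R).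
  split; first by apply: continuous_measurable_fun => s; apply: derivable_continuous;
    rewrite /bump; apply: ex_derive.
  exists 1 => s; rewrite /= in_itv /= => /andP[h1 h2].
  have h : (s / L) ^+ 2 <= 1 by rewrite expr_div_n ler_pdivrMr ?exprn_gt0 // mul1r; nra.
  rewrite ger0_norm ?bump_ge0 // exprn_ile1 ?subr_ge0 //.
  by rewrite lerBlDr lerDl sqr_ge0.
by apply: bmM; [exact: bm_fst|exact: bm_snd].
Qed.

Lemma measurable_phase2 (h : R -> R) : measurable_fun [set: R] h ->
  measurable_fun [set: (RR * RR) * (RR * RR)] (fun p => f p.2 * h (lin p.1 p.2 + phi p.2)).
Proof.
move=> mh.
have m2 := @measurable_snd _ _ (RR * RR)%type (RR * RR)%type.
apply: measurable_funM; first exact: (measurableT_comp bf.1 m2).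
apply: (measurableT_comp mh); apply: measurable_funD; first exact: measurable_lin2.
exact: (measurableT_comp mphi m2).
Qed.

Lemma bm_phase2 (h : R -> R) (V : set (RR * RR)) : measurable_fun [set: R] h -> (forall x, `|h x| <= 1) ->
  bm (V `*` D) (fun p => f p.2 * h (lin p.1 p.2 + phi p.2)).
Proof.
move=> mh h1; split; first exact: measurable_phase2.
have [_ [M fM]] := bf; exists M => -[zeta z] [_ /= Dz].
by rewrite normrM -[M]mulr1; apply: ler_pM => //; exact: fM.
Qed.

Lemma bm_C (V : set (RR * RR)) : measurable V -> (mu2 V < +oo)%E -> bm V C.
Proof.
move=> mV fV; apply: (@bm_Rint R _ _ _ _ mu2 V D mD fD
  (fun p => f p.2 * cos (lin p.1 p.2 + phi p.2))).
apply: bm_phase2 => //; last by move=> x; exact: cos_max.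
by apply: continuous_measurable_fun; exact: continuous_cos.
Qed.

Lemma bm_S (V : set (RR * RR)) : measurable V -> (mu2 V < +oo)%E -> bm V S.
Proof.
move=> mV fV; apply: (@bm_Rint R _ _ _ _ mu2 V D mD fD
  (fun p => f p.2 * sin (lin p.1 p.2 + phi p.2))).
apply: bm_phase2 => //; last by move=> x; exact: sin_max.
by apply: continuous_measurable_fun; exact: continuous_sin.
Qed.

Lemma mul2_le_sqrD (a b : R) : a * b * 2 <= a ^+ 2 + b ^+ 2.
Proof. have := sqr_ge0 (a - b); nra. Qed.

Lemma half_mul_half (a b : R) : 2^-1 <= a -> 2^-1 <= b -> 1 <= 4 * (a * b).
Proof. by move=> ha hb; nra. Qed.

Lemma annulus_sub_itv (N s : R) : 1 <= N -> annulus N s -> `[- (2 * N), 2 * N]%classic s.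
Proof.
move=> N1 /(annulusP N1)/andP[_]; rewrite /= in_itv /= ler_norml => /andP[h1 h2].
by apply/andP; split; lra.
Qed.

Lemma bump_annulus (N s : R) : 1 <= N -> annulus N s -> 2^-1 <= bump (2 * N) s.
Proof.
move=> N1 /(annulusP N1)/andP[_ h]; have N0 : 0 < N by exact: lt_le_trans N1.
have h2 : (s / (2 * N)) ^+ 2 <= 4^-1.
  rewrite expr_div_n ler_pdivrMr ?exprn_gt0 ?mulr_gt0 // exprMn -[s ^+ 2]real_normK ?num_real //.
  have := normr_ge0 s; nra.
have := sqr_ge0 (s / (2 * N)); rewrite /bump; nra.
Qed.

(** Schur's test.  After [energy_double], the integral over the frequencies is the Fourier
    transform of the cut-off, a kernel with integral at most [(18 * pi)^2] in each variable. *)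
Lemma bump_energy (L : R) : 0 < L ->
  \int[mu2]_(zeta in `[- L, L] `*` `[- L, L])
     (bump L zeta.1 * bump L zeta.2 * (C zeta ^+ 2 + S zeta ^+ 2))
  <= 2 * (18 * pi) ^+ 2 * \int[mu2]_(z in D) (f z ^+ 2).
Proof.
move=> L0; set V := `[- L, L] `*` `[- L, L].
have mI : measurable (`[- L, L]%classic : set RR) by exact: measurable_itv.
have fI := itv_lt_pinfty (- L) L.
have mV : measurable V by exact: measurableX.
have fV : (mu2 V < +oo)%E by exact: (finite_measureX mI mI fI fI).
have mDD : measurable (D `*` D) by exact: measurableX.
have fDD : ((sfprod mu2 mu2) (D `*` D) < +oo)%E by exact: (finite_measureX mD mD fD fD).
pose w zeta : R := bump L zeta.1 * bump L zeta.2.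
pose th (zeta z : RR * RR) := lin zeta z + phi z.
pose F (p : (RR * RR) * ((RR * RR) * (RR * RR))) :=
  w p.1 * (f p.2.1 * f p.2.2 * cos (th p.1 p.2.1 + - th p.1 p.2.2)).
have bw : bm V w by exact: bm_itv_bump.
have b1 : bm (D `*` D) (fun p => f p.1) by exact: bm_fst.
have b2 : bm (D `*` D) (fun p => f p.2) by exact: bm_snd.
have bff : bm (D `*` D) (fun p => f p.1 * f p.2) by exact: bmM.
have mth : measurable_fun [set: (RR * RR) * (RR * RR)] (fun p => th p.1 p.2).
  apply: measurable_funD; first exact: measurable_lin2.
  exact: (measurableT_comp mphi measurable_snd).
have mcos : measurable_fun [set: (RR * RR) * ((RR * RR) * (RR * RR))]
    (fun p => th p.1 p.2.1 + - th p.1 p.2.2).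
  apply: measurable_funB.
  - apply: (@measurableT_comp _ _ _ _ _ _ (fun q => th q.1 q.2) _ (fun p => (p.1, p.2.1))) => //.
    apply: measurable_fun_pair => //.
    exact: (measurableT_comp measurable_fst measurable_snd).
  - apply: (@measurableT_comp _ _ _ _ _ _ (fun q => th q.1 q.2) _ (fun p => (p.1, p.2.2))) => //.
    apply: measurable_fun_pair => //.
    exact: (measurableT_comp measurable_snd measurable_snd).
have bF : bm (V `*` (D `*` D)) F.
  apply: bmM; first exact: (bm_fst _ bw).
  by apply: bmM; [exact: (bm_snd _ bff)|exact: bm_cos].
have -> : \int[mu2]_(zeta in V) (bump L zeta.1 * bump L zeta.2 * (C zeta ^+ 2 + S zeta ^+ 2)) =
    \int[mu2]_(zeta in V) \int[sfprod mu2 mu2]_(p in D `*` D) F (zeta, p).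
  apply: eq_Rintegral => zeta Vz; rewrite energy_double -RintegralZl //.
  apply: bm_integrable => //; apply: bmM => //; apply: bm_cos.
  exact: (measurableT_comp mcos (measurable_pair1 zeta)).
rewrite -(@Rint_prod_bm R _ _ _ _ mu2 (sfprod mu2 mu2) V (D `*` D) mV mDD fV fDD F bF).
rewrite (@Rint_prod2_bm R _ _ _ _ mu2 (sfprod mu2 mu2) V (D `*` D) mV mDD fV fDD F bF).
pose k (p : (RR * RR) * (RR * RR)) := poisson L (p.1.1 - p.2.1) * poisson L (p.1.2 - p.2.2).
have mp : measurable_fun [set: R] (poisson L).
  by apply: continuous_measurable_fun; exact: continuous_poisson.
have k0 p : 0 <= k p by rewrite mulr_ge0 // poisson_ge0.
have bk : bm (D `*` D) k.
  split; last first.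
    exists (18 * L * (18 * L)) => p _; rewrite ger0_norm // ler_pM ?poisson_ge0 // poisson_le //.
  have m1 := @measurable_fst _ _ (RR * RR)%type (RR * RR)%type.
  have m2 := @measurable_snd _ _ (RR * RR)%type (RR * RR)%type.
  have f1 := @measurable_fst _ _ RR RR.
  have f2 := @measurable_snd _ _ RR RR.
  apply: measurable_funM; apply: (measurableT_comp mp); apply: measurable_funB.
  - exact: (measurableT_comp f1 m1).
  - exact: (measurableT_comp f1 m2).
  - exact: (measurableT_comp f2 m1).
  - exact: (measurableT_comp f2 m2).
have bf2 : bm D (fun z => f z ^+ 2) by exact: (bmM bf bf).
have b12 : bm (D `*` D) (fun p => f p.1 ^+ 2) by exact: (bm_fst _ bf2).
have b22 : bm (D `*` D) (fun p => f p.2 ^+ 2) by exact: (bm_snd _ bf2).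
have i1 : (sfprod mu2 mu2).-integrable (D `*` D) (EFin \o (fun p => f p.1 ^+ 2 * k p)).
  by apply: bm_integrable => //; exact: bmM.
have i2 : (sfprod mu2 mu2).-integrable (D `*` D) (EFin \o (fun p => f p.2 ^+ 2 * k p)).
  by apply: bm_integrable => //; exact: bmM.
have if2 : mu2.-integrable D (EFin \o (fun z => f z ^+ 2)) by exact: bm_integrable.
have p0 : 0 <= (18 * pi) ^+ 2 :> R by exact: sqr_ge0.
have kle z : D z -> \int[mu2]_(z' in D) k (z, z') <= (18 * pi) ^+ 2.
  move=> Dz; have := @Rint_poisson2_le L z.1 z.2 D L0 mD.
  congr (_ <= _); apply: eq_Rintegral => z' _; rewrite /k /poisson /=.
  by rewrite -(sqrrN (L * (z.1 - z'.1))) -(sqrrN (L * (z.2 - z'.2))) -!mulrN !opprB.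
have kle2 z : D z -> \int[mu2]_(z' in D) k (z', z) <= (18 * pi) ^+ 2.
  by move=> Dz; exact: (@Rint_poisson2_le L z.1 z.2 D L0 mD).
have J1 : \int[sfprod mu2 mu2]_(p in D `*` D) (f p.1 ^+ 2 * k p) <=
    (18 * pi) ^+ 2 * \int[mu2]_(z in D) (f z ^+ 2).
  have bfk : bm (D `*` D) (fun p => f p.1 ^+ 2 * k p) by exact: bmM.
  rewrite (@Rint_prod_bm R _ _ _ _ mu2 mu2 D D mD mD fD fD _ bfk) -RintegralZl //.
  apply: Rint_le => //.
  - exact: (bm_integrable mD fD (@bm_Rint R _ _ _ _ mu2 D D mD fD _ bfk)).
  - exact: integrableMl_cst.
  - move=> z Dz /=; rewrite RintegralZl //; last first.
      by apply: bm_integrable => //; exact: (bm_section1 Dz bk).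
    by rewrite mulrC ler_wpM2r ?sqr_ge0 // kle.
have J2 : \int[sfprod mu2 mu2]_(p in D `*` D) (f p.2 ^+ 2 * k p) <=
    (18 * pi) ^+ 2 * \int[mu2]_(z in D) (f z ^+ 2).
  have bfk : bm (D `*` D) (fun p => f p.2 ^+ 2 * k p) by exact: bmM.
  rewrite (@Rint_prod2_bm R _ _ _ _ mu2 mu2 D D mD mD fD fD _ bfk) -RintegralZl //.
  apply: Rint_le => //.
  - exact: (bm_integrable mD fD (@bm_Rint2 R _ _ _ _ mu2 D D mD fD _ bfk)).
  - exact: integrableMl_cst.
  - move=> z Dz /=; rewrite RintegralZl //; last first.
      by apply: bm_integrable => //; exact: (bm_section2 Dz bk).
    by rewrite mulrC ler_wpM2r ?sqr_ge0 // kle2.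
apply: (le_trans (ler_norm _)).
apply: (@le_trans _ _ (\int[sfprod mu2 mu2]_(p in D `*` D) (f p.1 ^+ 2 * k p + f p.2 ^+ 2 * k p))).
  apply: normr_Rint_le => //.
  - exact: (bm_integrable mDD fDD (@bm_Rint2 R _ _ _ _ mu2 V (D `*` D) mV fV F bF)).
  - exact: (integrableD mDD i1 i2).
  - move=> [z z'] [/= Dz Dz'].
    have -> : \int[mu2]_(zeta in V) F (zeta, (z, z')) = f z * f z' *
       \int[mu2]_(zeta in V) (w zeta * cos (th zeta z + - th zeta z')).
      rewrite -RintegralZl //.
        by apply: eq_Rintegral => zeta _; rewrite /F /=; ring.
      apply: bm_integrable => //; apply: bmM => //; apply: bm_cos.
      exact: (measurableT_comp mcos (measurable_pair2 (z, z'))).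
    rewrite normrM; have ek := @energy_kernel L z z' L0.
    apply: (@le_trans _ _ (`|f z * f z'| * (2 * k (z, z')))); first by rewrite ler_wpM2l.
    rewrite -mulrDl mulrA; apply: ler_wpM2r; first exact: k0.
    rewrite normrM -[f z ^+ 2]real_normK ?num_real // -[f z' ^+ 2]real_normK ?num_real //.
    exact: mul2_le_sqrD.
rewrite RintegralD //.
by apply: (le_trans (lerD J1 J2)); rewrite le_eqVlt; apply/orP; left; apply/eqP; ring.
Qed.

(** [bump (2 * N)] is at least one half on [annulus N], so the energy with the smooth cut-off
    controls the one with the sharp cut-off; the constant does not see [N]. *)
Lemma bessel (N : R) : 1 <= N ->
  \int[mu2]_(zeta in annulus N `*` annulus N) (C zeta ^+ 2 + S zeta ^+ 2)
  <= 8 * (18 * pi) ^+ 2 * \int[mu2]_(z in D) (f z ^+ 2).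
Proof.
move=> N1; have N0 : 0 < N by exact: lt_le_trans N1.
(* Twice the outer radius keeps the bump away from its zeros. *)
pose L := 2 * N; have L0 : 0 < L by rewrite mulr_gt0.
set V := `[- L, L] `*` `[- L, L] : set (RR * RR).
have mI : measurable (`[- L, L]%classic : set RR) by exact: measurable_itv.
have fI := itv_lt_pinfty (- L) L.
have mV : measurable V by exact: measurableX.
have fV : (mu2 V < +oo)%E by exact: (finite_measureX mI mI fI fI).
have mA := @measurable_annulus R N; have fA := @annulus_lty R N.
have mQ : measurable (annulus N `*` annulus N) by exact: measurableX.
have fQ : (mu2 (annulus N `*` annulus N) < +oo)%E by exact: (finite_measureX mA mA fA fA).
have bE U : measurable U -> (mu2 U < +oo)%E -> bm U (fun zeta => C zeta ^+ 2 + S zeta ^+ 2).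
  move=> mU fU; have bC := bm_C mU fU; have bS := bm_S mU fU.
  by apply: bmD; [exact: (bmM bC bC)|exact: (bmM bS bS)].
have bw : bm V (fun zeta => bump L zeta.1 * bump L zeta.2) by exact: bm_itv_bump.
have bG : bm V (fun zeta => 4 * (bump L zeta.1 * bump L zeta.2 * (C zeta ^+ 2 + S zeta ^+ 2))).
  by apply: bmZ; apply: bmM => //; exact: bE.
have iG : mu2.-integrable V (EFin \o (fun zeta => 4 * (bump L zeta.1 * bump L zeta.2 * (C zeta ^+ 2 + S zeta ^+ 2)))).
  exact: bm_integrable.
have E0 zeta : 0 <= C zeta ^+ 2 + S zeta ^+ 2 by rewrite addr_ge0 // sqr_ge0.
have QV : annulus N `*` annulus N `<=` V.
  by move=> -[x y] [/= /(annulus_sub_itv N1) hx /(annulus_sub_itv N1) hy].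
have hb s : annulus N s -> 2^-1 <= bump L s by exact: bump_annulus.
apply: (@le_trans _ _ (\int[mu2]_(zeta in V) (4 * (bump L zeta.1 * bump L zeta.2 * (C zeta ^+ 2 + S zeta ^+ 2))))).
  apply: (@le_trans _ _ (\int[mu2]_(zeta in annulus N `*` annulus N) (4 * (bump L zeta.1 * bump L zeta.2 * (C zeta ^+ 2 + S zeta ^+ 2))))).
    apply: Rint_le => //.
    - by apply: bm_integrable => //; exact: bE.
    - exact: (integrableS mV).
    - move=> zeta [/= /hb h1 /hb h2]; rewrite mulrA ler_peMl //.
      exact: half_mul_half.
  apply: Rint_subset_ge0 => // zeta _.
  by rewrite mulr_ge0 // mulr_ge0 // mulr_ge0 // bump_ge0.
rewrite RintegralZl //; last by apply: bm_integrable => //; apply: bmM => //; exact: bE.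
have := bump_energy L0; rewrite -/V => h.
apply: (@le_trans _ _ (4 * (2 * (18 * pi) ^+ 2 * \int[mu2]_(z in D) f z ^+ 2))).
  by rewrite ler_wpM2l.
by rewrite le_eqVlt; apply/orP; left; apply/eqP; ring.
Qed.

End bessel.
End Bessel.

(** * The edge bounds of the analytic family *)

Section Spow.
Context {R : realType}.

(** The power of the modulus with the sign kept: the amplitude remains real, and the
    interpolation only changes the exponent [s]. *)
Definition spow (s r : R) : R := r * `|r| `^ (s - 1).

Lemma spow1 r : spow 1 r = r.
Proof. by rewrite /spow subrr powRr0 mulr1. Qed.

Lemma spowE s r : r != 0 -> spow s r = Num.sg r * expR (s * ln `|r|).
Proof.
move=> r0; rewrite /spow /powR normr_eq0 (negbTE r0) {1}[r]numEsg -mulrA; congr (_ * _).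
have rp : 0 < `|r| by rewrite normr_gt0.
by rewrite -{1}(lnK rp) -expRD; congr expR; ring.
Qed.

Lemma normr_spow s r : s != 0 -> `|spow s r| = `|r| `^ s.
Proof.
move=> s0; have [->|r0] := eqVneq r 0.
  by rewrite /spow mul0r normr0 powR0.
rewrite spowE // normrM normr_sg r0 mul1r ger0_norm ?expR_ge0 //.
by rewrite /powR normr_eq0 (negbTE r0).
Qed.

Lemma spow_sqr s r : s != 0 -> spow s r ^+ 2 = `|r| `^ (2 * s).
Proof.
move=> s0; rewrite -real_normK ?num_real // normr_spow // -powR_mulrn ?powR_ge0 //.
by rewrite -powRrM mulrC.
Qed.

Lemma spow_tilt s u r : spow s r * expR (u * (s * ln `|r|)) = spow (s * (1 + u)) r.
Proof.
have [->|r0] := eqVneq r 0; first by rewrite /spow !mul0r.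
rewrite !spowE // -[LHS]mulrA -expRD; congr (_ * expR _); ring.
Qed.

Lemma measurable_spow s : measurable_fun [set: R] (spow s).
Proof.
apply: measurable_funM => //.
exact: (measurableT_comp (@measurable_powR R _) (@normr_measurable R _)).
Qed.

Lemma bm_spow d (T : measurableType d) (D : set T) (f : T -> R) s : 0 < s ->
  bm D f -> bm D (fun x => spow s (f x)).
Proof.
move=> s0 [mf [M fM]]; split; first exact: (measurableT_comp (measurable_spow s) mf).
exists (`|M| `^ s) => x Dx; rewrite normr_spow ?gt_eqF //.
apply: ge0_ler_powR; [exact: ltW|by rewrite nnegrE|by rewrite nnegrE|].
by rewrite (le_trans (fM _ Dx)) // ler_norm.
Qed.

Lemma inner2_le_sqrD (a b c d : R) :
  a * c + b * d <= 2^-1 * ((a ^+ 2 + b ^+ 2) + (c ^+ 2 + d ^+ 2)).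
Proof. have := sqr_ge0 (a - c); have := sqr_ge0 (b - d); nra. Qed.

Lemma sqr1D_le (v : R) : (1 + v) * (1 + v) <= 2 * (1 + v ^+ 2).
Proof. have := sqr_ge0 (v - 1); nra. Qed.

Lemma half_sum_le (a b k : R) : a <= k -> b <= k -> 2^-1 * (a + b) <= k.
Proof. lra. Qed.

Lemma beta_itv (al : R) : 0 < al <= 2 -> 0 <= 1 - al / 2 <= 1.
Proof. by move=> /andP[h1 h2]; apply/andP; split; lra. Qed.

End Spow.

Section Core.
Context {R : realType}.
Notation mu := (@lebesgue_measure R).
Notation RR := (measurableTypeR R).
Notation PP := (RR * RR)%type.
Notation mu2 := (sfprod (@lebesgue_measure R) (@lebesgue_measure R)).
Notation mu4 := (sfprod mu2 mu2).
Notation mu6 := (sfprod mu4 mu2).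

Variables (alpha1 alpha2 t N c : R).
Hypotheses (al1 : 0 < alpha1 <= 2) (al1' : alpha1 != 1).
Hypotheses (al2 : 0 < alpha2 <= 2) (al2' : alpha2 != 1).
Hypotheses (t0 : t != 0) (N1 : 1 <= N).
Variables (D E : set PP) (f g : PP -> R).
Hypotheses (mD : measurable D) (mE : measurable E).
Hypotheses (fD : (mu2 D < +oo)%E) (fE : (mu2 E < +oo)%E).
Hypotheses (bf : bm D f) (bg : bm E g).
Variable p : R.
Hypothesis p0 : 0 < p.
Hypothesis f1 : \int[mu2]_(z in D) `|f z| `^ p <= 1.
Hypothesis g1 : \int[mu2]_(z in E) `|g z| `^ p <= 1.

Let be1 := 1 - alpha1 / 2.
Let be2 := 1 - alpha2 / 2.
Let Q : set PP := annulus N `*` annulus N.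
Let s := p / 2.

Let s0 : 0 < s. Proof. by rewrite divr_gt0. Qed.

Definition logweight (b1 b2 : R) (zeta : PP) : R := b1 * ln `|zeta.1| + b2 * ln `|zeta.2|.

(** Powers written by logarithms; they agree with the power function off the coordinate axes. *)
Definition symb (a1 a2 t : R) (zeta : PP) : R :=
  t * (expR (a1 * ln `|zeta.1|) + expR (a2 * ln `|zeta.2|)).

Lemma measurable_logweight b1 b2 : measurable_fun [set: PP] (logweight b1 b2).
Proof.
apply: measurable_funD; apply: measurable_funM => //.
- exact: (measurableT_comp (@measurable_lnabs R) measurable_fst).
- exact: (measurableT_comp (@measurable_lnabs R) measurable_snd).
Qed.

Lemma measurable_symb a1 a2 r : measurable_fun [set: PP] (symb a1 a2 r).
Proof.
apply: measurable_funM => //; apply: measurable_funD;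
  apply: (measurableT_comp (@measurable_expR R)); apply: measurable_funM => //.
- exact: (measurableT_comp (@measurable_lnabs R) measurable_fst).
- exact: (measurableT_comp (@measurable_lnabs R) measurable_snd).
Qed.

Lemma bm_logweight b1 b2 : bm Q (logweight b1 b2).
Proof.
have bl := bm_lnabs N1.
by apply: bmD; apply: bmZ; [exact: (bm_fst _ bl)|exact: (bm_snd _ bl)].
Qed.

(** With [p = 2 s], the analytic family is [amp * exp ((x + i y) lam) * exp (i om)]: at [x = 0] the
    amplitudes are the powers [p / 2] of [f] and [g], at [x = 1] they are the powers [p] and carry
    the weight [|zeta|^(-be)] and the factor [|t|], and at [x = theta] they are [f] and [g]
    themselves. *)
Definition om (q : PP * PP * PP) : R :=
  lin q.2 q.1.2 - lin q.2 q.1.1 - symb alpha1 alpha2 t q.2 + c.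

Let lf (z : PP) := s * ln `|f z|.
Let lg (z : PP) := s * ln `|g z|.

Definition lam (q : PP * PP * PP) : R :=
  lf q.1.1 + lg q.1.2 + (ln `|t| - logweight be1 be2 q.2).

Definition amp (q : PP * PP * PP) : R := spow s (f q.1.1) * spow s (g q.1.2).

Let mQ : measurable Q.
Proof. by apply: measurableX; exact: measurable_annulus. Qed.
Let fQ : (mu2 Q < +oo)%E.
Proof. by apply: finite_measureX; try exact: measurable_annulus; exact: annulus_lty. Qed.
Let mDE : measurable (D `*` E). Proof. exact: measurableX. Qed.
Let fDE : (mu4 (D `*` E) < +oo)%E.
Proof. exact: (finite_measureX mD mE fD fE). Qed.

Let mf11 : measurable_fun [set: PP * PP * PP] (fun q => q.1.1).
Proof. exact: (measurableT_comp measurable_fst measurable_fst). Qed.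
Let mf12 : measurable_fun [set: PP * PP * PP] (fun q => q.1.2).
Proof. exact: (measurableT_comp measurable_snd measurable_fst). Qed.
Let mf2 : measurable_fun [set: PP * PP * PP] (fun q => q.2).
Proof. exact: measurable_snd. Qed.

Let mlf : measurable_fun [set: PP] lf.
Proof.
apply: measurable_funM => //; apply: (measurableT_comp (@measurable_ln R)).
exact: (measurableT_comp (@normr_measurable R _) bf.1).
Qed.
Let mlg : measurable_fun [set: PP] lg.
Proof.
apply: measurable_funM => //; apply: (measurableT_comp (@measurable_ln R)).
exact: (measurableT_comp (@normr_measurable R _) bg.1).
Qed.

Lemma measurable_om : measurable_fun [set: PP * PP * PP] om.
Proof.
have ml := @measurable_lin2 R.
apply: measurable_funD => //; apply: measurable_funB; last first.
  exact: (measurableT_comp (measurable_symb _ _ _) mf2).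
apply: measurable_funB.
- apply: (@measurableT_comp _ _ _ _ _ _ (fun q => lin q.1 q.2) _ (fun q => (q.2, q.1.2))) => //.
  exact: measurable_fun_pair.
- apply: (@measurableT_comp _ _ _ _ _ _ (fun q => lin q.1 q.2) _ (fun q => (q.2, q.1.1))) => //.
  exact: measurable_fun_pair.
Qed.

Lemma measurable_lam : measurable_fun [set: PP * PP * PP] lam.
Proof.
apply: measurable_funD.
  by apply: measurable_funD; [exact: (measurableT_comp mlf mf11)|exact: (measurableT_comp mlg mf12)].
apply: measurable_funB => //.
exact: (measurableT_comp (measurable_logweight _ _) mf2).
Qed.

Lemma bm_amp : bm ((D `*` E) `*` Q) amp.
Proof.
apply: (@bm_fst _ _ _ _ _ _ _ (fun q => spow s (f q.1) * spow s (g q.2))).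
by apply: bmM; [exact: (bm_fst _ (bm_spow s0 bf))|exact: (bm_snd _ (bm_spow s0 bg))].
Qed.

(** The real part of the parameter changes the exponents of [f], [g], [t] and of the weight
    simultaneously. *)
Lemma amp_tilt u q : amp q * expR (u * lam q) =
  spow (s * (1 + u)) (f q.1.1) * spow (s * (1 + u)) (g q.1.2) *
  (expR (u * ln `|t|) * expR (- u * logweight be1 be2 q.2)).
Proof.
rewrite -!spow_tilt /amp /lam -/lf -/lg -expRD.
have -> : u * (lf q.1.1 + lg q.1.2 + (ln `|t| - logweight be1 be2 q.2)) =
  u * lf q.1.1 + u * lg q.1.2 + (u * ln `|t| + - u * logweight be1 be2 q.2) by ring.
by rewrite !expRD /lf /lg; ring.
Qed.

Lemma bm_section_phase (y d : R) (zeta : PP) :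
  measurable_fun [set: PP] (fun z => - lin zeta z + y * lf z) /\
  measurable_fun [set: PP] (fun w => lin zeta w + (y * lg w + d)).
Proof.
split; apply: measurable_funD.
- by apply: measurableT_comp => //; exact: measurable_lin.
- exact: measurable_funM.
- exact: measurable_lin.
- by apply: measurable_funD => //; exact: measurable_funM.
Qed.

(** On the line [Re z = 0] the symbol has modulus one.  For fixed frequency the double integral
    over [D] and [E] factors, and the product of two Fourier integrals is bounded by the mean of
    their squares, to which [bessel] applies. *)
Lemma edge_L2 (y d : R) :
  `|\int[mu6]_(q in (D `*` E) `*` Q) (amp q * cos (om q + y * lam q + d))|
    <= 8 * (18 * pi) ^+ 2.
Proof.
have mphi : measurable_fun [set: PP * PP * PP] (fun q => om q + y * lam q + d).
  apply: measurable_funD => //; apply: measurable_funD; first exact: measurable_om.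
  by apply: measurable_funM => //; exact: measurable_lam.
have bF : bm ((D `*` E) `*` Q) (fun q => amp q * cos (om q + y * lam q + d)).
  by apply: bmM; [exact: bm_amp|exact: bm_cos].
rewrite (@Rint_prod2_bm R _ _ _ _ mu4 mu2 (D `*` E) Q mDE mQ fDE fQ _ bF).
pose a z := spow s (f z); pose b w := spow s (g w).
have ba : bm D a by exact: bm_spow.
have bb : bm E b by exact: bm_spow.
pose phif z := - (y * lf z).
have mphif : measurable_fun [set: PP] phif.
  by apply: measurableT_comp => //; exact: measurable_funM.
pose phig w := y * lg w.
have mphig : measurable_fun [set: PP] phig by exact: measurable_funM.
pose Cf zeta := \int[mu2]_(z in D) (a z * cos (lin zeta z + phif z)).
pose Sf zeta := \int[mu2]_(z in D) (a z * sin (lin zeta z + phif z)).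
pose Cg zeta := \int[mu2]_(z in E) (b z * cos (lin zeta z + phig z)).
pose Sg zeta := \int[mu2]_(z in E) (b z * sin (lin zeta z + phig z)).
have bCf : bm Q Cf by exact: bm_C.
have bSf : bm Q Sf by exact: bm_S.
have bCg : bm Q Cg by exact: bm_C.
have bSg : bm Q Sg by exact: bm_S.
have inner zeta : `|\int[mu4]_(r in D `*` E) (amp (r, zeta) * cos (om (r, zeta) + y * lam (r, zeta) + d))|
    <= 2^-1 * ((Cf zeta ^+ 2 + Sf zeta ^+ 2) + (Cg zeta ^+ 2 + Sg zeta ^+ 2)).
  pose del := d + c - symb alpha1 alpha2 t zeta + y * (ln `|t| - logweight be1 be2 zeta).
  have [m1 m2] := bm_section_phase y del zeta.
  have -> : \int[mu4]_(r in D `*` E) (amp (r, zeta) * cos (om (r, zeta) + y * lam (r, zeta) + d)) =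
      \int[mu4]_(r in D `*` E) (a r.1 * b r.2 *
         cos ((- lin zeta r.1 + y * lf r.1) + (lin zeta r.2 + (y * lg r.2 + del)))).
    apply: eq_Rintegral => r _; congr (_ * cos _).
    by rewrite /om /lam /del /=; ring.
  rewrite (@Rint_cosD R _ _ _ _ mu2 mu2 D E mD mE fD fE a (fun z => - lin zeta z + y * lf z)
    b (fun w => lin zeta w + (y * lg w + del)) ba bb m1 m2).
  have -> : \int[mu2]_(x in D) (a x * cos (- lin zeta x + y * lf x)) = Cf zeta.
    apply: eq_Rintegral => z _; congr (_ * _); rewrite -cosN; congr cos.
    by rewrite /phif opprD opprK.
  have -> : \int[mu2]_(x in D) (a x * sin (- lin zeta x + y * lf x)) = - Sf zeta.
    have bs : bm D (fun z => a z * sin (lin zeta z + phif z)).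
      apply: bmM => //; apply: bm_sin; apply: measurable_funD => //; exact: measurable_lin.
    rewrite -[RHS]mulN1r /Sf -RintegralZl //; last exact: bm_integrable.
    apply: eq_Rintegral => z _; rewrite mulN1r -mulrN -sinN; congr (_ * _).
    by congr sin; rewrite /phif; ring.
  set X := \int[mu2]_(x in E) (b x * cos _); set Y := \int[mu2]_(x in E) (b x * sin _).
  (* The energy does not see the shift [del] of the phase, which depends on [zeta] only. *)
  have XY : X ^+ 2 + Y ^+ 2 = Cg zeta ^+ 2 + Sg zeta ^+ 2.
    rewrite /Cg /Sg (energy_double mE fE bb mphig).
    rewrite (@energy_double R E b (fun w => y * lg w + del) mE fE bb _ zeta).
      apply: eq_Rintegral => r _; congr (_ * cos _).
      by rewrite /phig; ring.
    exact: measurable_funD.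
  rewrite -XY; apply: (le_trans (ler_normB _ _)); rewrite !normrM normrN.
  rewrite -[Cf zeta ^+ 2]real_normK ?num_real // -[Sf zeta ^+ 2]real_normK ?num_real //.
  rewrite -[X ^+ 2]real_normK ?num_real // -[Y ^+ 2]real_normK ?num_real //.
  exact: inner2_le_sqrD.
have sqf : \int[mu2]_(z in D) (a z ^+ 2) <= 1.
  apply: le_trans f1; rewrite le_eqVlt; apply/orP; left; apply/eqP.
  by apply: eq_Rintegral => z _; rewrite /a spow_sqr ?gt_eqF // /s mulrC divfK.
have sqg : \int[mu2]_(z in E) (b z ^+ 2) <= 1.
  apply: le_trans g1; rewrite le_eqVlt; apply/orP; left; apply/eqP.
  by apply: eq_Rintegral => z _; rewrite /b spow_sqr ?gt_eqF // /s mulrC divfK.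
have Bf := @bessel R D a phif mD fD ba mphif N N1.
have Bg := @bessel R E b phig mE fE bb mphig N N1.
have bef : bm Q (fun zeta => Cf zeta ^+ 2 + Sf zeta ^+ 2).
  by apply: bmD; [exact: (bmM bCf bCf)|exact: (bmM bSf bSf)].
have beg : bm Q (fun zeta => Cg zeta ^+ 2 + Sg zeta ^+ 2).
  by apply: bmD; [exact: (bmM bCg bCg)|exact: (bmM bSg bSg)].
have bM : bm Q (fun zeta => 2^-1 * ((Cf zeta ^+ 2 + Sf zeta ^+ 2) + (Cg zeta ^+ 2 + Sg zeta ^+ 2))).
  by apply: bmZ; exact: bmD.
apply: (@le_trans _ _ (\int[mu2]_(zeta in Q)
    (2^-1 * ((Cf zeta ^+ 2 + Sf zeta ^+ 2) + (Cg zeta ^+ 2 + Sg zeta ^+ 2))))).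
  apply: (normr_Rint_le mQ).
  - exact: (bm_integrable mQ fQ (@bm_Rint2 R _ _ _ _ mu4 (D `*` E) Q mDE fDE _ bF)).
  - exact: (bm_integrable mQ fQ bM).
  - by move=> zeta _; exact: inner.
have ief := bm_integrable mQ fQ bef; have ieg := bm_integrable mQ fQ beg.
rewrite (RintegralZl _ mQ (bm_integrable mQ fQ (bmD bef beg))) (RintegralD mQ ief ieg).
have K0 : 0 <= 8 * (18 * pi) ^+ 2 :> R by rewrite mulr_ge0 // sqr_ge0.
have h1 : \int[mu2]_(x in Q) (Cf x ^+ 2 + Sf x ^+ 2) <= 8 * (18 * pi) ^+ 2.
  exact: (le_trans Bf (ler_piMr K0 sqf)).
have h2 : \int[mu2]_(x in Q) (Cg x ^+ 2 + Sg x ^+ 2) <= 8 * (18 * pi) ^+ 2.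
  exact: (le_trans Bg (ler_piMr K0 sqg)).
exact: (half_sum_le h1 h2).
Qed.

(** On the line [Re z = 1] the integral over the frequencies is the kernel of the weighted
    propagator, which is bounded by a multiple of [1 / |t|]; the amplitudes are integrable. *)
Lemma edge_L1 (C : R) : 0 < C ->
  (forall t x1 x2 y1 y2 c N : R, t != 0 -> 1 <= N ->
  `|\int[mu2]_(z in annulus N `*` annulus N)
      (expR (- (1 - alpha1 / 2) * ln `|z.1|) * expR (- (1 - alpha2 / 2) * ln `|z.2|) *
       cos (disp2 alpha1 t x1 y1 z.1 + (disp2 alpha2 t x2 y2 z.2 + c)))|
    <= C * (1 + `|y1|) * (1 + `|y2|) / `|t|) ->
  forall y d,
  `|\int[mu6]_(q in (D `*` E) `*` Q) (amp q * expR (lam q) * cos (om q + y * lam q + d))|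
    <= 2 * C * (1 + y ^+ 2).
Proof.
move=> C0 hC y d.
have mphi : measurable_fun [set: PP * PP * PP] (fun q => om q + y * lam q + d).
  apply: measurable_funD => //; apply: measurable_funD; first exact: measurable_om.
  by apply: measurable_funM => //; exact: measurable_lam.
pose a z := spow p (f z); pose b w := spow p (g w).
have ba : bm D a by exact: bm_spow.
have bb : bm E b by exact: bm_spow.
pose W (zeta : PP) := expR (- be1 * ln `|zeta.1|) * expR (- be2 * ln `|zeta.2|) : R.
have s2 : s * (1 + 1) = p by rewrite /s; field.
have t0' : 0 < `|t| by rewrite normr_gt0.
have tilt q : amp q * expR (lam q) = a q.1.1 * b q.1.2 * (`|t| * W q.2).
  have := amp_tilt 1 q; rewrite mul1r => ->; rewrite s2 mul1r lnK ?posrE //; congr (_ * (_ * _)).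
  by rewrite /W /logweight -expRD; congr expR; rewrite mulN1r opprD !mulNr.
have bW : bm Q W.
  have bl k : bm (annulus N) (fun x : RR => expR (k * ln `|x|)) by apply/bm_expR/bmZ/bm_lnabs.
  by apply: bmM; [exact: (bm_fst _ (bl _))|exact: (bm_snd _ (bl _))].
pose F (q : PP * PP * PP) := a q.1.1 * b q.1.2 * (`|t| * (W q.2 * cos (om q + y * lam q + d))).
have bab : bm (D `*` E) (fun q => a q.1 * b q.2).
  by apply: bmM; [exact: bm_fst|exact: bm_snd].
have bF : bm ((D `*` E) `*` Q) F.
  apply: bmM; first exact: (bm_fst _ bab).
  apply: bmZ; apply: bmM; first exact: (bm_snd _ bW).
  exact: bm_cos.
rewrite (_ : \int[mu6]_(q in (D `*` E) `*` Q) _ = \int[mu6]_(q in (D `*` E) `*` Q) F q); last first.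
  by apply: eq_Rintegral => q _; rewrite tilt /F !mulrA.
rewrite (@Rint_prod_bm R _ _ _ _ mu4 mu2 (D `*` E) Q mDE mQ fDE fQ _ bF).
have by1 (be : R) : 0 <= be <= 1 -> 1 + `|- (y * be)| <= 1 + `|y|.
  by move=> /andP[b0 b1]; rewrite lerD2l normrN normrM (ger0_norm b0) ler_piMr.
have be1b : 0 <= be1 <= 1 by exact: beta_itv.
have be2b : 0 <= be2 <= 1 by exact: beta_itv.
have inner r : `|\int[mu2]_(zeta in Q) F (r, zeta)| <=
    `|a r.1| * `|b r.2| * (2 * C * (1 + y ^+ 2)).
  pose del := y * (lf r.1 + lg r.2 + ln `|t|) + c + d.
  have bc : bm Q (fun zeta => W zeta * cos (om (r, zeta) + y * lam (r, zeta) + d)).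
    by apply: bmM => //; apply: bm_cos; exact: (measurableT_comp mphi (measurable_pair1 r)).
  rewrite /F /= RintegralZl; [|exact: mQ|apply: bm_integrable => //; exact: bmZ].
  rewrite RintegralZl; [|exact: mQ|exact: bm_integrable].
  rewrite !normrM normr_id; apply: ler_wpM2l; first exact: mulr_ge0.
  have -> : \int[mu2]_(zeta in Q) (W zeta * cos (om (r, zeta) + y * lam (r, zeta) + d)) =
    \int[mu2]_(z in annulus N `*` annulus N)
      (expR (- (1 - alpha1 / 2) * ln `|z.1|) * expR (- (1 - alpha2 / 2) * ln `|z.2|) *
       cos (disp2 alpha1 t (r.2.1 - r.1.1) (- (y * be1)) z.1 +
            (disp2 alpha2 t (r.2.2 - r.1.2) (- (y * be2)) z.2 + del))).
    apply: eq_Rintegral => zeta _; congr (_ * cos _).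
    by rewrite /om /lam /disp2 /lin /symb /logweight /del /=; ring.
  have := hC t (r.2.1 - r.1.1) (r.2.2 - r.1.2) (- (y * be1)) (- (y * be2)) del N t0 N1.
  move=> h; apply: (le_trans (ler_wpM2l (ltW t0') h)).
  have -> : `|t| * (C * (1 + `|- (y * be1)|) * (1 + `|- (y * be2)|) / `|t|) =
    C * ((1 + `|- (y * be1)|) * (1 + `|- (y * be2)|)) by field; rewrite gt_eqF.
  have h12 : (1 + `|- (y * be1)|) * (1 + `|- (y * be2)|) <= (1 + `|y|) * (1 + `|y|).
    by apply: ler_pM; rewrite ?addr_ge0 // by1.
  have h3 : (1 + `|y|) * (1 + `|y|) <= 2 * (1 + y ^+ 2).
    rewrite -[y ^+ 2]real_normK ?num_real //.
    exact: sqr1D_le.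
  have -> : 2 * C * (1 + y ^+ 2) = C * (2 * (1 + y ^+ 2)) by ring.
  by rewrite ler_pM2l // (le_trans h12).
have baN : bm D (fun z => `|a z|) by exact: bm_norm.
have bbN : bm E (fun z => `|b z|) by exact: bm_norm.
have babN : bm (D `*` E) (fun r => `|a r.1| * `|b r.2|).
  by apply: bmM; [exact: (bm_fst _ baN)|exact: (bm_snd _ bbN)].
have ia : \int[mu2]_(z in D) `|a z| <= 1.
  apply: le_trans f1; rewrite le_eqVlt; apply/orP; left; apply/eqP.
  by apply: eq_Rintegral => z _; rewrite /a normr_spow ?gt_eqF.
have ib : \int[mu2]_(z in E) `|b z| <= 1.
  apply: le_trans g1; rewrite le_eqVlt; apply/orP; left; apply/eqP.
  by apply: eq_Rintegral => z _; rewrite /b normr_spow ?gt_eqF.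
have K0 : 0 <= 2 * C * (1 + y ^+ 2) by rewrite !mulr_ge0 ?addr_ge0 ?sqr_ge0 // ltW.
have bM : bm (D `*` E) (fun r => `|a r.1| * `|b r.2| * (2 * C * (1 + y ^+ 2))).
  by apply: bmM => //; exact: bm_cst.
apply: (@le_trans _ _ (\int[mu4]_(r in D `*` E) (`|a r.1| * `|b r.2| * (2 * C * (1 + y ^+ 2))))).
  apply: (normr_Rint_le mDE); [|exact: (bm_integrable mDE fDE bM)|by move=> r _; exact: inner].
  exact: (bm_integrable mDE fDE (@bm_Rint R _ _ _ _ mu2 (D `*` E) Q mQ fQ _ bF)).
rewrite (RintegralZr _ mDE (bm_integrable mDE fDE babN)).
rewrite (@Rint_mulX R _ _ _ _ mu2 mu2 D E mD mE fD fE _ _ baN bbN).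
have ge0 (A : set PP) (h : PP -> R) : 0 <= \int[mu2]_(z in A) `|h z|.
  by apply: Rintegral_ge0 => z _; exact: normr_ge0.
exact: (ler_piMl K0 (mulr_ile1 (ge0 D a) (ge0 E b) ia ib)).
Qed.

End Core.

(** * The interpolated bilinear form *)

Section Bilinear.
Context {R : realType}.
Notation mu := (@lebesgue_measure R).
Notation RR := (measurableTypeR R).
Notation PP := (RR * RR)%type.
Notation mu2 := (sfprod (@lebesgue_measure R) (@lebesgue_measure R)).
Notation mu4 := (sfprod mu2 mu2).
Notation mu6 := (sfprod mu4 mu2).

(** The pairing of [g] with the truncated propagator of [f].  The shift [c] of the phase
    provides real and imaginary parts at once. *)
Definition bform (alpha1 alpha2 theta t N c : R) (D E : set PP) (f g : PP -> R) : R :=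
  \int[mu6]_(q in (D `*` E) `*` (annulus N `*` annulus N))
    (f q.1.1 * g q.1.2 * expR (- theta * logweight (1 - alpha1 / 2) (1 - alpha2 / 2) q.2)
     * cos (om alpha1 alpha2 t c q)).

Lemma measurable_Q N : measurable (annulus N `*` annulus N : set PP).
Proof. by apply: measurableX; exact: measurable_annulus. Qed.

Lemma Q_lty N : (mu2 (annulus N `*` annulus N) < +oo)%E.
Proof. by apply: finite_measureX; try exact: measurable_annulus; exact: annulus_lty. Qed.

(** [three_lines] applied to the two edge bounds; for [theta = 0] and [theta = 1] the edge
    bounds themselves are the claim. *)
Lemma bform_normalized (alpha1 alpha2 theta : R) :
  0 < alpha1 <= 2 -> alpha1 != 1 -> 0 < alpha2 <= 2 -> alpha2 != 1 -> 0 <= theta <= 1 ->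
  exists2 C : R, 0 < C & forall (t N c : R) (D E : set PP) (f g : PP -> R),
  t != 0 -> 1 <= N -> measurable D -> measurable E ->
  (mu2 D < +oo)%E -> (mu2 E < +oo)%E -> bm D f -> bm E g ->
  \int[mu2]_(z in D) `|f z| `^ (2 / (1 + theta)) <= 1 ->
  \int[mu2]_(z in E) `|g z| `^ (2 / (1 + theta)) <= 1 ->
  `|bform alpha1 alpha2 theta t N c D E f g| <= C * `|t| `^ (- theta).
Proof.
move=> al1 al1' al2 al2' /andP[th0 th1].
have [C1 C10 hC1] := kernel_plane al1 al1' al2 al2'.
(* [B] and [C1] are the constants of the two edges. *)
pose B := 8 * (18 * pi) ^+ 2 : R.
have B0 : 0 < B by rewrite mulr_gt0 // exprn_gt0 // mulr_gt0 // pi_gt0.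
pose M := B + 2 * C1.
have M0 : 0 < M by rewrite addr_gt0 // mulr_gt0.
pose L := three_lines_const theta.
have L0 : 0 < L by exact: three_lines_const_gt0.
exists ((1 + L) * M); first by rewrite mulr_gt0 // addr_gt0.
move=> t N c D E f g t0 N1 mD mE fD fE bf bg f1 g1.
set p := 2 / (1 + theta) in f1 g1.
have th : 0 < 1 + theta by rewrite ltr_wpDr.
have p0 : 0 < p by rewrite divr_gt0.
have e0 := @edge_L2 R alpha1 alpha2 t N c N1 D E f g mD mE fD fE bf bg p p0 f1 g1.
have e1 := @edge_L1 R alpha1 alpha2 t N c al1 al2 t0 N1 D E f g mD mE fD fE bf bg p p0 f1 g1 C1 C10 hC1.
set Om := (D `*` E) `*` (annulus N `*` annulus N) in e0 e1 *.
have mOm : measurable Om.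
  by apply: measurableX; [exact: measurableX|exact: measurable_Q].
have fOm : (mu6 Om < +oo)%E.
  apply: (@finite_measureX _ _ _ _ _ mu4 mu2).
  - exact: (measurableX mD mE).
  - exact: measurable_Q.
  - exact: (finite_measureX mD mE fD fE).
  - exact: Q_lty.
have bA := bm_amp N bf bg p0.
have bAt u : 0 <= u -> bm Om (fun q => amp f g p q * expR (u * lam alpha1 alpha2 t f g p q)).
  move=> u0.
  have su : 0 < p / 2 * (1 + u) by rewrite mulr_gt0 ?divr_gt0 // ltr_wpDr.
  rewrite (_ : (fun q => _) = (fun q => spow (p / 2 * (1 + u)) (f q.1.1) * spow (p / 2 * (1 + u)) (g q.1.2) *
    (expR (u * ln `|t|) *
     expR (- u * logweight (1 - alpha1 / 2) (1 - alpha2 / 2) q.2)))); last first.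
    by apply/funext => q; rewrite amp_tilt.
  apply: bmM; last first.
    by apply: bmZ; apply: bm_expR; apply: bmZ; exact: (bm_snd _ (bm_logweight N1 _ _)).
  apply: (@bm_fst _ _ _ _ _ _ _ (fun q => spow (p / 2 * (1 + u)) (f q.1) * spow (p / 2 * (1 + u)) (g q.2))).
  by apply: bmM; [exact: (bm_fst _ (bm_spow su bf))|exact: (bm_snd _ (bm_spow su bg))].
have mlam := @measurable_lam R alpha1 alpha2 t D E f g bf bg p.
have mom := @measurable_om R alpha1 alpha2 t c.
have sth : p / 2 * (1 + theta) = 1 by rewrite /p; field; rewrite gt_eqF.
have tilt q : amp f g p q * expR (theta * lam alpha1 alpha2 t f g p q) =
   expR (theta * ln `|t|) * (f q.1.1 * g q.1.2 *
     expR (- theta * logweight (1 - alpha1 / 2) (1 - alpha2 / 2) q.2)).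
  by rewrite amp_tilt sth !spow1 mulrCA.
have main : `|\int[mu6]_(q in Om) (amp f g p q * expR (theta * lam alpha1 alpha2 t f g p q) *
    cos (om alpha1 alpha2 t c q))| <= (1 + L) * M.
  have ML : M <= (1 + L) * M by rewrite mulrDl mul1r lerDl mulr_ge0 // ltW.
  move: th0; rewrite le_eqVlt => /predU1P[th0|th0].
    apply: (le_trans _ ML); apply: (@le_trans _ _ B); last by rewrite lerDl ltW // mulr_gt0.
    have := e0 0 0; rewrite -th0.
    congr (`|_| <= _); apply: eq_Rintegral => q _.
    by rewrite !mul0r expR0 mulr1 !addr0.
  move: th1; rewrite le_eqVlt => /predU1P[th1|th1].
    apply: (le_trans _ ML); apply: (@le_trans _ _ (2 * C1)); last by rewrite lerDr ltW.
    have := e1 0 0; rewrite th1 expr0n /= addr0 mulr1.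
    congr (`|_| <= _); apply: eq_Rintegral => q _.
    by rewrite mul0r mul1r !addr0.
  apply: (@le_trans _ _ (L * M)); last by rewrite ler_pM2r // lerDr.
  apply: (@three_lines R _ _ mu6 Om mOm _ _ mlam mom theta _ M).
  - by rewrite th0.
  - exact: ltW.
  - exact: bA.1.
  - exact: (bm_integrable mOm fOm bA).
  - apply: (bm_integrable mOm fOm); have := bAt 1 ler01.
    by congr bm; apply/funext => q; rewrite mul1r.
  - move=> y c'; apply: (le_trans (e0 y c')).
    rewrite -/B -[B]mulr1; apply: ler_pM => //; first exact: ltW.
      by rewrite lerDl ltW // mulr_gt0.
    by rewrite lerDl sqr_ge0.
  - move=> y c'; apply: (le_trans (e1 y c')); apply: ler_wpM2r.
      by rewrite addr_ge0 // sqr_ge0.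
    by rewrite lerDr ltW.
have t0' : 0 < `|t| by rewrite normr_gt0.
have E1 : \int[mu6]_(q in Om) (amp f g p q * expR (theta * lam alpha1 alpha2 t f g p q) *
    cos (om alpha1 alpha2 t c q)) = expR (theta * ln `|t|) * bform alpha1 alpha2 theta t N c D E f g.
  rewrite /bform -RintegralZl //.
    by apply: eq_Rintegral => q _; rewrite tilt -mulrA.
  apply: (bm_integrable mOm fOm); apply: bmM; last exact: bm_cos.
  apply: bmM; last by apply: bm_expR; apply: bmZ; exact: (bm_snd _ (bm_logweight N1 _ _)).
  apply: (@bm_fst _ _ _ _ _ _ _ (fun q => f q.1 * g q.2)).
  by apply: bmM; [exact: (bm_fst _ bf)|exact: (bm_snd _ bg)].
move: main; rewrite E1 normrM ger0_norm ?expR_ge0 // mulrC -ler_pdivlMr ?expR_gt0 // => h.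
by rewrite /powR gt_eqF // mulNr expRN.
Qed.

(** By homogeneity in [f] and [g]. *)
Lemma bform_bound (alpha1 alpha2 theta : R) :
  0 < alpha1 <= 2 -> alpha1 != 1 -> 0 < alpha2 <= 2 -> alpha2 != 1 -> 0 <= theta <= 1 ->
  exists2 C : R, 0 < C & forall (t N c a b : R) (D E : set PP) (f g : PP -> R),
  t != 0 -> 1 <= N -> measurable D -> measurable E ->
  (mu2 D < +oo)%E -> (mu2 E < +oo)%E -> bm D f -> bm E g -> 0 < a -> 0 < b ->
  \int[mu2]_(z in D) `|f z| `^ (2 / (1 + theta)) <= a `^ (2 / (1 + theta)) ->
  \int[mu2]_(z in E) `|g z| `^ (2 / (1 + theta)) <= b `^ (2 / (1 + theta)) ->
  `|bform alpha1 alpha2 theta t N c D E f g| <= C * `|t| `^ (- theta) * (a * b).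
Proof.
move=> al1 al1' al2 al2' th.
have [C C0 hC] := bform_normalized al1 al1' al2 al2' th; exists C => //.
move=> t N c a b D E f g t0 N1 mD mE fD fE bf bg a0 b0 f1 g1.
have th0 : 0 < 1 + theta by case/andP: th => h _; rewrite ltr_wpDr.
set p := 2 / (1 + theta) in f1 g1.
have p0 : 0 < p by rewrite divr_gt0.
have scale (A : set PP) (h : PP -> R) r : measurable A -> (mu2 A < +oo)%E -> bm A h -> 0 < r ->
    \int[mu2]_(z in A) `|h z| `^ p <= r `^ p ->
    \int[mu2]_(z in A) `|r^-1 * h z| `^ p <= 1.
  move=> mA fA bh r0 hr.
  have bhp : bm A (fun z => `|h z| `^ p).
    have := bm_norm (bm_spow p0 bh).
    by congr bm; apply/funext => z; rewrite normr_spow ?gt_eqF.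
  have -> : \int[mu2]_(z in A) `|r^-1 * h z| `^ p = (r `^ p)^-1 * \int[mu2]_(z in A) `|h z| `^ p.
    rewrite -RintegralZl //; last exact: bm_integrable.
    apply: eq_Rintegral => z _; rewrite normrM gtr0_norm ?invr_gt0 // powRM ?normr_ge0 ?invr_ge0 ?(ltW r0) //.
    by congr (_ * _); rewrite /powR invr_eq0 gt_eqF // lnV ?posrE // mulrN expRN.
  by rewrite mulrC ler_pdivrMr ?powR_gt0 // mul1r.
have := hC t N c D E (fun z => a^-1 * f z) (fun z => b^-1 * g z) t0 N1 mD mE fD fE
  (bmZ _ bf) (bmZ _ bg) (scale _ _ _ mD fD bf a0 f1) (scale _ _ _ mE fE bg b0 g1).
have -> : bform alpha1 alpha2 theta t N c D E (fun z => a^-1 * f z) (fun z => b^-1 * g z) =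
    (a * b)^-1 * bform alpha1 alpha2 theta t N c D E f g.
  rewrite /bform -RintegralZl //.
  - by apply: eq_Rintegral => q _; field; rewrite !gt_eqF.
  - by apply: measurableX; [exact: measurableX|exact: measurable_Q].
  apply: bm_integrable.
  - by apply: measurableX; [exact: measurableX|exact: measurable_Q].
  - apply: (@finite_measureX _ _ _ _ _ mu4 mu2).
    + exact: (measurableX mD mE).
    + exact: measurable_Q.
    + exact: (finite_measureX mD mE fD fE).
    + exact: Q_lty.
  apply: bmM; last by apply: bm_cos; exact: measurable_om.
  apply: bmM; last by apply: bm_expR; apply: bmZ; exact: (bm_snd _ (bm_logweight N1 _ _)).
  apply: (@bm_fst _ _ _ _ _ _ _ (fun q => f q.1 * g q.2)).
  by apply: bmM; [exact: (bm_fst _ bf)|exact: (bm_snd _ bg)].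
have ab0 : 0 < a * b by rewrite mulr_gt0.
by rewrite normrM gtr0_norm ?invr_gt0 // mulrC ler_pdivrMr.
Qed.

(** Fubini's theorem with the integral over [E] outermost: in this order the truncations of the
    frequencies and of [f] can be removed one after the other. *)
Lemma bform_iterated (alpha1 alpha2 theta t N c : R) (D E : set PP) (f g : PP -> R) :
  1 <= N -> measurable D -> measurable E ->
  (mu2 D < +oo)%E -> (mu2 E < +oo)%E -> bm D f -> bm E g ->
  bform alpha1 alpha2 theta t N c D E f g =
  \int[mu2]_(w in E) (g w * \int[mu2]_(zeta in annulus N `*` annulus N)
    (expR (- theta * logweight (1 - alpha1 / 2) (1 - alpha2 / 2) zeta) *
     \int[mu2]_(z in D) (f z * cos (lin zeta w - lin zeta z - symb alpha1 alpha2 t zeta + c)))).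
Proof.
move=> N1 mD mE fD fE bf bg; set Q := annulus N `*` annulus N.
have mQ : measurable Q by exact: measurable_Q.
have fQ : (mu2 Q < +oo)%E by exact: Q_lty.
have mDE : measurable (D `*` E) by exact: measurableX.
have fDE : (mu4 (D `*` E) < +oo)%E by exact: (finite_measureX mD mE fD fE).
have bW : bm Q (fun zeta => expR (- theta * logweight (1 - alpha1 / 2) (1 - alpha2 / 2) zeta)).
  by apply: bm_expR; apply: bmZ; exact: bm_logweight.
set W := fun zeta : PP => expR (- theta * logweight (1 - alpha1 / 2) (1 - alpha2 / 2) zeta).
have bfg : bm (D `*` E) (fun r => f r.1 * g r.2).
  by apply: bmM; [exact: (bm_fst _ bf)|exact: (bm_snd _ bg)].
pose F (q : PP * PP * PP) := f q.1.1 * g q.1.2 * W q.2 * cos (om alpha1 alpha2 t c q).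
have bF : bm ((D `*` E) `*` Q) F.
  apply: bmM; last by apply: bm_cos; exact: measurable_om.
  by apply: bmM; [exact: (bm_fst _ bfg)|exact: (bm_snd _ bW)].
rewrite /bform -/Q -[LHS]/(\int[mu6]_(q in (D `*` E) `*` Q) F q).
rewrite (@Rint_prod2_bm R _ _ _ _ mu4 mu2 (D `*` E) Q mDE mQ fDE fQ _ bF).
pose th (zeta w z : PP) := lin zeta w - lin zeta z - symb alpha1 alpha2 t zeta + c.
pose G (p : PP * PP) := \int[mu2]_(z in D) (f z * cos (th p.1 p.2 z)).
have -> : \int[mu2]_(zeta in Q) \int[mu4]_(r in D `*` E) F (r, zeta) =
    \int[mu2]_(zeta in Q) \int[mu2]_(w in E) (g w * (W zeta * G (zeta, w))).
  apply: eq_Rintegral => zeta; rewrite inE => Qz.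
  have bFz : bm (D `*` E) (fun r => F (r, zeta)) by exact: bm_section2 Qz bF.
  rewrite (@Rint_prod2_bm R _ _ _ _ mu2 mu2 D E mD mE fD fE _ bFz).
  apply: eq_Rintegral => w; rewrite inE => Ew.
  have bFzw : bm D (fun z => f z * cos (th zeta w z)).
    apply: bmM => //; apply: bm_cos; apply: measurable_funD => //.
    apply: measurable_funB => //; apply: measurable_funB => //; exact: measurable_lin.
  rewrite mulrA /G -RintegralZl //; last exact: bm_integrable.
  by apply: eq_Rintegral => z _; rewrite /F /om /th /=; ring.
have bG : bm (Q `*` E) G.
  have := @bm_Rint R _ _ _ _ mu2 (Q `*` E) D mD fD (fun r => f r.2 * cos (th r.1.1 r.1.2 r.2)).
  apply; apply: bmM; first exact: (bm_snd _ bf).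
  apply: bm_cos.
  have h : measurable_fun [set: PP * PP * PP] (fun r => (r.2, r.1.2, r.1.1)).
    apply: measurable_fun_pair; last exact: (measurableT_comp measurable_fst measurable_fst).
    apply: measurable_fun_pair => //; exact: (measurableT_comp measurable_snd measurable_fst).
  exact: (measurableT_comp (measurable_om alpha1 alpha2 t c) h).
pose H (p : PP * PP) := g p.2 * (W p.1 * G p).
have bH : bm (Q `*` E) H.
  by apply: bmM; [exact: (bm_snd _ bg)|apply: bmM => //; exact: (bm_fst _ bW)].
rewrite -[LHS]/(\int[mu2]_(zeta in Q) \int[mu2]_(w in E) H (zeta, w)).
rewrite -(@Rint_prod_bm R _ _ _ _ mu2 mu2 Q E mQ mE fQ fE _ bH).
rewrite (@Rint_prod2_bm R _ _ _ _ mu2 mu2 Q E mQ mE fQ fE _ bH).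
apply: eq_Rintegral => w; rewrite inE => Ew.
rewrite /H /= (RintegralZl _ mQ) //.
by apply: (bm_integrable mQ fQ); apply: bmM bW _; exact: (bm_section2 Ew bG).
Qed.

End Bilinear.

(** * Schwartz functions and the decay of their Fourier transforms *)

Section Schwartz.
Context {R : realType}.
Notation mu := (@lebesgue_measure R).
Notation RR := (measurableTypeR R).
Notation PP := (RR * RR)%type.
Notation mu2 := (sfprod (@lebesgue_measure R) (@lebesgue_measure R)).

(** Open sets of the plane are countable unions of rational rectangles. *)
Lemma open_measurable2 (U : set (R * R)) : open U -> measurable (U : set PP).
Proof.
move=> oU.
pose rect (q : (rat * rat) * (rat * rat)) : set PP :=
  `]ratr q.1.1, ratr q.1.2[%classic `*` `]ratr q.2.1, ratr q.2.2[%classic.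
pose e (n : nat) : (rat * rat) * (rat * rat) := odflt ((0, 0), (0, 0)) (unpickle n).
have -> : U = \bigcup_(n in [set n | rect (e n) `<=` U]) rect (e n).
  apply/seteqP; split => [[x y] Uz|z [n nU]]; last exact: nU.
  have /nbhs_ballP[r /= r0 rU] : nbhs (x, y) U by exact: open_nbhs_nbhs.
  have [q1 q1r] : exists q, ratr q \in `](x - r), x[.
    by apply: rat_in_itvoo; rewrite ltrBlDr ltrDl.
  have [q2 q2r] : exists q, ratr q \in `]x, (x + r)[.
    by apply: rat_in_itvoo; rewrite ltrDl.
  have [q3 q3r] : exists q, ratr q \in `](y - r), y[.
    by apply: rat_in_itvoo; rewrite ltrBlDr ltrDl.
  have [q4 q4r] : exists q, ratr q \in `]y, (y + r)[.
    by apply: rat_in_itvoo; rewrite ltrDl.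
  move: q1r q2r q3r q4r; rewrite !in_itv /= => /andP[a1 b1] /andP[a2 b2] /andP[a3 b3] /andP[a4 b4].
  have en : e (pickle ((q1, q2), (q3, q4))) = ((q1, q2), (q3, q4)).
    by rewrite /e pickleK.
  exists (pickle ((q1, q2), (q3, q4))); rewrite /= en /rect /=.
    move=> [x' y'] [/=]; rewrite !in_itv /= => /andP[h1 h2] /andP[h3 h4].
    apply: rU; split; rewrite /= /ball /= ltr_norml; apply/andP; split; lra.
  by split; rewrite /= in_itv /=; apply/andP.
apply: bigcup_measurable => n _.
by apply: measurableX; exact: measurable_itv.
Qed.

Lemma continuous_measurable2 (u : R * R -> R) : continuous u ->
  measurable_fun [set: PP] (u : PP -> R).
Proof.
move=> cu; apply: (measurability _ (RGenOInfty.measurableE R)) => //.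
move=> /= _ [_ [a ->] <-]; rewrite setTI.
apply: open_measurable2.
by apply: open_comp; [move=> z _; exact: cu|exact: interval_open].
Qed.

Lemma pderiv_cat (w w' : seq bool) (u : R * R -> R) :
  pderiv w (pderiv w' u) = pderiv (w ++ w') u.
Proof. by elim: w => //= b w ->. Qed.

Lemma rschwartz_pderiv (w : seq bool) (u : R * R -> R) :
  rschwartz u -> rschwartz (pderiv w u).
Proof.
move=> [su du]; split.
  by move=> w'; rewrite pderiv_cat; exact: su.
by move=> m n w'; rewrite pderiv_cat; exact: du.
Qed.

Lemma rschwartz_continuous (u : R * R -> R) : rschwartz u -> continuous u.
Proof. by move=> [su _]; have [] := su [::]. Qed.

Lemma rschwartz_measurable (u : R * R -> R) : rschwartz u -> measurable_fun [set: PP] (u : PP -> R).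
Proof. by move=> su; apply: continuous_measurable2; exact: rschwartz_continuous. Qed.

(** The majorant of all Schwartz functions; it is a tensor product of integrable functions. *)
Definition maj (z : PP) : R := (1 + z.1 ^+ 2)^-1 * (1 + z.2 ^+ 2)^-1.

Lemma maj_ge0 z : 0 <= maj z.
Proof. by rewrite mulr_ge0 // invr_ge0 ltW // oneDsqr_pos. Qed.

Lemma maj_le1 z : maj z <= 1.
Proof.
have h (x : R) : (1 + x ^+ 2)^-1 <= 1 by rewrite invf_le1 ?oneDsqr_pos // lerDl sqr_ge0.
by rewrite /maj mulr_ile1 // invr_ge0 ltW // oneDsqr_pos.
Qed.

Lemma rschwartz_le_maj (u : R * R -> R) : rschwartz u ->
  exists2 M : R, 0 <= M & forall z, `|u z| <= M * maj z.
Proof.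
move=> [_ du].
have [M0 h0] := du 0%N 0%N [::]; have [M1 h1] := du 2%N 0%N [::].
have [M2 h2] := du 0%N 2%N [::]; have [M3 h3] := du 2%N 2%N [::].
have key z : `|u z| * ((1 + z.1 ^+ 2) * (1 + z.2 ^+ 2)) <= M0 + M1 + M2 + M3.
  have := h0 z; have := h1 z; have := h2 z; have := h3 z; rewrite /= !expr0 !mul1r !mulr1.
  have x2 := sqr_ge0 z.1; have y2 := sqr_ge0 z.2.
  rewrite (normrM _ (u z)) (ger0_norm (mulr_ge0 x2 y2)).
  rewrite [in X in _ -> X -> _](normrM _ (u z)) [in X in _ -> X -> _](ger0_norm y2).
  rewrite [in X in _ -> _ -> X -> _](normrM _ (u z)) [in X in _ -> _ -> X -> _](ger0_norm x2).
  by move=> k3 k2 k1 k0; rewrite !mulrDr !mulrDl; lra.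
exists (M0 + M1 + M2 + M3).
  apply: le_trans (key (0, 0)); rewrite mulr_ge0 // mulr_ge0 // ltW // oneDsqr_pos //.
by move=> z; rewrite /maj -invfM ler_pdivlMr // mulr_gt0 // oneDsqr_pos.
Qed.

Lemma measurable_tensor (a b : R -> R) : measurable_fun [set: RR] a -> measurable_fun [set: RR] b ->
  measurable_fun [set: PP] (fun z => a z.1 * b z.2).
Proof.
move=> ma mb; apply: measurable_funM.
- exact: (measurableT_comp ma measurable_fst).
- exact: (measurableT_comp mb measurable_snd).
Qed.

Lemma integrable_tensor (a b : R -> R) :
  mu.-integrable [set: R] (EFin \o a) -> mu.-integrable [set: R] (EFin \o b) ->
  mu2.-integrable [set: PP] (EFin \o (fun z => a z.1 * b z.2)).
Proof.
move=> ia ib.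
have ma : measurable_fun [set: RR] a by apply/measurable_EFinP; exact: (measurable_int mu).
have mb : measurable_fun [set: RR] b by apply/measurable_EFinP; exact: (measurable_int mu).
have mab := measurable_tensor ma mb.
apply/(@integrable12ltyP _ _ RR RR R mu mu); first exact/measurable_EFinP.
have abs_fin (f : R -> R) : mu.-integrable [set: R] (EFin \o f) ->
    (\int[mu]_x (`|f x|)%:E)%E \is a fin_num.
  move=> /integrable_norm/(@integrable_fin_num _ RR _ mu); exact.
have E : (\int[mu]_x \int[mu]_y `|(a x * b y)%:E|)%E =
    ((\int[mu]_x `|a x|%:E) * (\int[mu]_x `|b x|%:E))%E.
  under eq_integral => x _.
    under eq_integral do rewrite /= normrM EFinM.
    rewrite ge0_integralZl //; last exact/measurable_EFinP/measurableT_comp.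
    over.
  rewrite ge0_integralZr //; first exact/measurable_EFinP/measurableT_comp.
  exact: integral_ge0.
rewrite [X in (X < _)%E]E -(fineK (abs_fin _ ia)) -(fineK (abs_fin _ ib)) -EFinM.
exact: ltry.
Qed.

Lemma integrable_maj : mu2.-integrable [set: PP] (EFin \o maj).
Proof.
apply: (@integrable_tensor (fun x => (1 + x ^+ 2)^-1) (fun x => (1 + x ^+ 2)^-1)).
all: exact: integrable_oneDsqrV.
Qed.

Definition slice (b : bool) (r s : R) : R * R := if b then (s, r) else (r, s).

Lemma continuous_slice b r : continuous (slice b r).
Proof.
by case: b => s; [apply: (@cvg_pair _ _ _ (nbhs s) (nbhs s) (nbhs r) _ _ _ (fun x => x) (fun _ => r))|
  apply: (@cvg_pair _ _ _ (nbhs s) (nbhs r) (nbhs s) _ _ _ (fun _ => r) (fun x => x))];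
  try exact: cvg_id; exact: cvg_cst.
Qed.

(** The partial derivatives of the definition of smoothness, seen along a coordinate line. *)
Lemma is_derive_slice (b : bool) (u : R * R -> R) (r s : R) : rschwartz u ->
  is_derive s (1 : R) (fun s => u (slice b r s)) (pderiv [:: b] u (slice b r s)).
Proof.
move=> [su _]; have [_ /(_ b (slice b r s)) du] := su [::].
have E : (fun h : R => h^-1 *: (((fun s => u (slice b r s)) \o shift s) (h *: 1) - u (slice b r s))) =
    (fun h : R => h^-1 *: ((u \o shift (slice b r s)) (h *: dir R b) - u (slice b r s))).
  apply/funext => h; congr (_ *: (u _ - _)).
  by case: b {du}; apply: injective_projections; rewrite /= ?scaler0 ?add0r.
apply: DeriveDef; first by move: du; rewrite /derivable /= -E.
by rewrite /derive E.
Qed.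

End Schwartz.

Section Decay.
Context {R : realType}.
Notation mu := (@lebesgue_measure R).
Notation RR := (measurableTypeR R).
Notation PP := (RR * RR)%type.
Notation mu2 := (sfprod (@lebesgue_measure R) (@lebesgue_measure R)).

Lemma Rintegral0_eq d (T : measurableType d) (nu : {measure set T -> \bar R}) (D : set T) (f : T -> R) :
  (forall x, D x -> f x = 0) -> \int[nu]_(x in D) f x = 0.
Proof. by move=> f0; rewrite /Rintegral integral0_eq // => x Dx; rewrite f0. Qed.

Definition coord (b : bool) (z : PP) : R := if b then z.1 else z.2.

Lemma integrable_schwartz_cos (u v : R * R -> R) (zeta : PP) (c r : R) : rschwartz u -> rschwartz v ->
  mu2.-integrable [set: PP] (EFin \o (fun z : PP =>
    v z * cos (lin zeta z + c) + r * (u z * sin (lin zeta z + c)))).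
Proof.
move=> su sv; have [M M0 hM] := rschwartz_le_maj su; have [K K0 hK] := rschwartz_le_maj sv.
have ml : measurable_fun [set: PP] (fun z => lin zeta z + c).
  by apply: measurable_funD => //; exact: measurable_lin.
apply: (@integrable_dominated _ _ _ mu2 setT _ (fun z => (K + `|r| * M) * maj z)) => //; last 1 first.
- by apply: integrableMl_cst => //; exact: integrable_maj.
- apply: measurable_funD.
    apply: measurable_funM; first exact: rschwartz_measurable.
    by apply: measurableT_comp ml; apply: continuous_measurable_fun; exact: continuous_cos.
  apply: measurable_funM => //; apply: measurable_funM; first exact: rschwartz_measurable.
  by apply: measurableT_comp ml; apply: continuous_measurable_fun; exact: continuous_sin.
move=> z _; apply: (le_trans (ler_normD _ _)); rewrite mulrDl; apply: lerD.
  rewrite normrM -[leRHS]mulr1; apply: ler_pM => //.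
  by rewrite ler_norml cos_geN1 cos_le1.
rewrite normrM -mulrA ler_wpM2l // normrM -[leRHS]mulr1; apply: ler_pM => //.
by rewrite ler_norml sin_geN1 sin_le1.
Qed.

Lemma is_derive_lin_slice (b : bool) (zeta : PP) (c r s : R) :
  is_derive s (1 : R) (fun s => lin zeta (slice b r s) + c) (coord b zeta).
Proof.
case: b; rewrite /lin /slice /coord /=; apply: is_derive_eq; rewrite /GRing.scale /=; ring.
Qed.

Lemma maj_slice_le (b : bool) (r s : R) : maj (slice b r s) <= (1 + s ^+ 2)^-1.
Proof.
have le1 (x : R) : (1 + x ^+ 2)^-1 <= 1 by rewrite invf_le1 ?oneDsqr_pos // lerDl sqr_ge0.
have ge0 (x : R) : 0 <= (1 + x ^+ 2)^-1 by rewrite invr_ge0 ltW // oneDsqr_pos.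
by case: b; rewrite /maj /=; [exact: ler_piMr|exact: ler_piMl].
Qed.

Lemma ibp_slice (b : bool) (u : R * R -> R) (zeta : PP) (c r : R) : rschwartz u ->
  \int[mu]_s (pderiv [:: b] u (slice b r s) * cos (lin zeta (slice b r s) + c)
    + (- coord b zeta) * (u (slice b r s) * sin (lin zeta (slice b r s) + c))) = 0.
Proof.
move=> su; have sv := rschwartz_pderiv [:: b] su.
have [M M0 hM] := rschwartz_le_maj su; have [K K0 hK] := rschwartz_le_maj sv.
have cosle (x : R) : `|cos x| <= 1 by rewrite ler_norml cos_geN1 cos_le1.
have sinle (x : R) : `|sin x| <= 1 by rewrite ler_norml sin_geN1 sin_le1.
have bound (w : R * R -> R) (B x s : R) : 0 <= B -> (forall z, `|w z| <= B * maj z) -> `|x| <= 1 ->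
    `|w (slice b r s) * x| <= B * (1 + s ^+ 2)^-1.
  move=> B0 hB x1; rewrite normrM -[leRHS]mulr1; apply: ler_pM => //.
  by apply: (le_trans (hB _)); rewrite ler_wpM2l // maj_slice_le.
have cu (w : R * R -> R) : rschwartz w -> continuous (fun s => w (slice b r s)).
  move=> sw s; apply: (@continuous_comp _ _ _ (slice b r) w); first exact: continuous_slice.
  exact: rschwartz_continuous.
have cl (s : R) : {for s, continuous (fun s => lin zeta (slice b r s) + c)}.
  by apply: derivable_continuous; have h := is_derive_lin_slice b zeta c r s; apply: ex_derive.
pose h s := u (slice b r s) * cos (lin zeta (slice b r s) + c).
pose h' s := pderiv [:: b] u (slice b r s) * cos (lin zeta (slice b r s) + c)
    + (- coord b zeta) * (u (slice b r s) * sin (lin zeta (slice b r s) + c)).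
have ch' : continuous h'.
  move=> s; apply: cvgD.
    by apply: cvgM; [exact: cu|exact: (continuous_comp (cl s) (@continuous_cos R _))].
  apply: cvgM; first exact: cvg_cst.
  by apply: cvgM; [exact: cu|exact: (continuous_comp (cl s) (@continuous_sin R _))].
apply: (@Rint_deriv0 R h h' M) => [s|//||s]; last exact: bound.
- have du := is_derive_slice b r s su; have dl := is_derive_lin_slice b zeta c r s.
  have dc := @is_derive1_comp _ (@cos R) (fun s => lin zeta (slice b r s) + c) s _ _ (is_derive_cos _) dl.
  rewrite /h /h'; apply: (is_derive_eq (is_deriveM du dc)).
  by rewrite /GRing.scale /=; ring.
- apply: (@integrable_dominated _ _ RR mu setT _
    (fun s => (K + `|coord b zeta| * M) * (1 + s ^+ 2)^-1)); first exact: measurableT.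
  + exact: continuous_measurable_fun.
  + move=> s _; apply: (le_trans (ler_normD _ _)); rewrite mulrDl; apply: lerD; first exact: bound.
    by rewrite normrM normrN -mulrA ler_wpM2l // bound.
  + by apply: integrableMl_cst => //; exact: integrable_oneDsqrV.
Qed.

(** Integration over all lines in direction [b] of the derivative of [u * cos]. *)
Lemma ibp_plane (b : bool) (u : R * R -> R) (zeta : PP) (c : R) : rschwartz u ->
  \int[mu2]_z (pderiv [:: b] u z * cos (lin zeta z + c)
    + (- coord b zeta) * (u z * sin (lin zeta z + c))) = 0.
Proof.
move=> su; have sv := rschwartz_pderiv [:: b] su.
have iF := integrable_schwartz_cos zeta c (- coord b zeta) su sv.
have mF : measurable_fun [set: PP] (fun z : PP => pderiv [:: b] u z * cos (lin zeta z + c)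
    + (- coord b zeta) * (u z * sin (lin zeta z + c))).
  by apply/measurable_EFinP; exact: (measurable_int mu2).
rewrite -{1}setXTT in iF; rewrite -setXTT.
case: b sv iF mF => sv iF mF.
- rewrite (Rint_prod2 measurableT measurableT mF iF).
  by apply: Rintegral0_eq => r _; exact: (ibp_slice true zeta c r su).
- rewrite (Rint_prod measurableT measurableT mF iF).
  by apply: Rintegral0_eq => r _; exact: (ibp_slice false zeta c r su).
Qed.

(** The Fourier transform of a real function in real form: shifting [c] by a quarter period
    exchanges real and imaginary parts. *)
Definition cosint (u : R * R -> R) (zeta : PP) (c : R) : R :=
  \int[mu2]_z (u z * cos (lin zeta z + c)).

Lemma integrable_cosint (u : R * R -> R) (zeta : PP) (c : R) : rschwartz u ->
  mu2.-integrable [set: PP] (EFin \o (fun z : PP => u z * cos (lin zeta z + c))).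
Proof.
move=> su; have := integrable_schwartz_cos zeta c 0 su su.
by apply: eq_integrable => // z _ /=; rewrite mul0r addr0.
Qed.

(** A derivative becomes a multiplication by the frequency; the quarter period stands for the
    factor [i]. *)
Lemma cosint_deriv (b : bool) (u : R * R -> R) (zeta : PP) (c : R) : rschwartz u ->
  coord b zeta * cosint u zeta c = cosint (pderiv [:: b] u) zeta (c + pi / 2).
Proof.
move=> su; have sv := rschwartz_pderiv [:: b] su.
apply/eqP; rewrite eq_sym -subr_eq0 /cosint -RintegralZl //; last exact: integrable_cosint.
rewrite -RintegralB //; last 2 first.
- exact: integrable_cosint.
- by apply: integrableMl_cst => //; exact: integrable_cosint.
rewrite -[X in _ == X](ibp_plane b zeta (c + pi / 2) su); apply/eqP.
apply: eq_Rintegral => z _; rewrite addrA sinDpihalf.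
by rewrite /=; ring.
Qed.

Lemma cosint_bound (u : R * R -> R) : rschwartz u ->
  exists2 B : R, 0 <= B & forall zeta c, `|cosint u zeta c| <= B.
Proof.
move=> su; have [M M0 hM] := rschwartz_le_maj su.
exists (\int[mu2]_z (M * maj z)).
  by apply: Rintegral_ge0 => z _; rewrite mulr_ge0 // maj_ge0.
move=> zeta c; apply: normr_Rint_le => //.
- exact: integrable_cosint.
- by apply: integrableMl_cst => //; exact: integrable_maj.
move=> z _; rewrite normrM -[leRHS]mulr1; apply: ler_pM => //.
by rewrite ler_norml cos_geN1 cos_le1.
Qed.

(** Two derivatives in each of the variables. *)
Lemma cosint_decay (u : R * R -> R) : rschwartz u ->
  exists2 K : R, 0 <= K & forall zeta c, `|cosint u zeta c| <= K * maj zeta.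
Proof.
move=> su.
have s1 := rschwartz_pderiv [:: true] su; have s11 := rschwartz_pderiv [:: true] s1.
have s2 := rschwartz_pderiv [:: false] su; have s22 := rschwartz_pderiv [:: false] s2.
have s3 := rschwartz_pderiv [:: false] s11; have s33 := rschwartz_pderiv [:: false] s3.
have [B0 b0 h0] := cosint_bound su; have [B1 b1 h1] := cosint_bound s11.
have [B2 b2 h2] := cosint_bound s22; have [B3 b3 h3] := cosint_bound s33.
exists (B0 + B1 + B2 + B3) => [|zeta c]; first by rewrite !addr_ge0.
rewrite /maj -invfM ler_pdivlMr; last by rewrite mulr_gt0 // oneDsqr_pos.
have x2 := sqr_ge0 zeta.1; have y2 := sqr_ge0 zeta.2.
have e1 : `|cosint u zeta c| * zeta.1 ^+ 2 <= B1.
  rewrite mulrC -{1}(ger0_norm x2) -normrM expr2 -mulrA.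
  rewrite (cosint_deriv true zeta c su) (cosint_deriv true zeta _ s1); exact: h1.
have e2 : `|cosint u zeta c| * zeta.2 ^+ 2 <= B2.
  rewrite mulrC -{1}(ger0_norm y2) -normrM expr2 -mulrA.
  rewrite (cosint_deriv false zeta c su) (cosint_deriv false zeta _ s2); exact: h2.
have e3 : `|cosint u zeta c| * (zeta.1 ^+ 2 * zeta.2 ^+ 2) <= B3.
  have -> : `|cosint u zeta c| * (zeta.1 ^+ 2 * zeta.2 ^+ 2) =
      `|zeta.2 * (zeta.2 * (zeta.1 * (zeta.1 * cosint u zeta c)))|.
    by rewrite -[X in _ * X](ger0_norm (mulr_ge0 x2 y2)) -normrM; congr `|_|; ring.
  rewrite (cosint_deriv true zeta c su) (cosint_deriv true zeta _ s1).
  rewrite (cosint_deriv false zeta _ s11) (cosint_deriv false zeta _ s3); exact: h3.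
have e0 := h0 zeta c.
by rewrite !mulrDr !mulrDl !mulr1 !mul1r mulrDr mulr1; lra.
Qed.

(** The right-hand side is the derivative of [2 / (1 - b) * (s / (1 + s))^(1 - b)], a bounded
    function. *)
Lemma powerweight_le (b s : R) : 0 <= b < 1 -> 0 < s ->
  expR (- b * ln s) * (1 + s ^+ 2)^-1 <=
  2 * (expR ((1 - b) * (ln s - ln (1 + s))) * (s^-1 - (1 + s)^-1)).
Proof.
move=> /andP[b0 b1] s0; have s1 : 0 < 1 + s by rewrite addr_gt0.
have l0 : 0 <= ln (1 + s) by rewrite ln_ge0 // lerDl ltW.
have -> : expR ((1 - b) * (ln s - ln (1 + s))) = expR (- b * ln s) * s * expR (- (1 - b) * ln (1 + s)).
  rewrite [X in _ = _ * X * _](_ : s = expR (ln s)); last by rewrite lnK.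
  by rewrite -!expRD; congr expR; ring.
have h : (1 + s)^-1 <= expR (- (1 - b) * ln (1 + s)).
  rewrite [X in X^-1](_ : 1 + s = expR (ln (1 + s))); last by rewrite lnK.
  by rewrite -expRN ler_expR mulNr lerN2 ler_piMl // gerBl.
have -> : 2 * (expR (- b * ln s) * s * expR (- (1 - b) * ln (1 + s)) * (s^-1 - (1 + s)^-1)) =
    expR (- b * ln s) * (2 * (expR (- (1 - b) * ln (1 + s)) * (1 + s)^-1)).
  by field; rewrite !gt_eqF.
rewrite ler_wpM2l ?expR_ge0 //.
apply: (@le_trans _ _ (2 * ((1 + s)^-1 * (1 + s)^-1))); last first.
  by rewrite ler_wpM2l // ler_wpM2r // invr_ge0 ltW.
rewrite -invfM -[2]invrK -invfM lef_pV2 ?posrE ?mulr_gt0 ?oneDsqr_pos ?invr_gt0 //.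
have := sqr_ge0 (s - 1); rewrite mulrC ler_pdivrMr //; nra.
Qed.

End Decay.

(** * Integrability of the symbol *)

Section Weights.
Context {R : realType}.
Notation mu := (@lebesgue_measure R).
Notation RR := (measurableTypeR R).
Notation PP := (RR * RR)%type.
Notation mu2 := (sfprod (@lebesgue_measure R) (@lebesgue_measure R)).

Lemma Rint_powerweight (b N : R) : 0 <= b < 1 -> 1 <= N ->
  \int[mu]_(s in annulus N) (expR (- b * ln `|s|) * (1 + s ^+ 2)^-1) <= 4 / (1 - b).
Proof.
move=> hb N1; have N0 : 0 < N by exact: lt_le_trans N1.
have a0 : 0 < 1 - b by case/andP: hb; rewrite subr_gt0.
have NV : 0 < N^-1 by rewrite invr_gt0.
have NN : N^-1 <= N by apply: (@le_trans _ _ 1) => //; rewrite invf_le1.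
have bf : bm (annulus N) (fun s => expR (- b * ln `|s|) * (1 + s ^+ 2)^-1).
  apply: bmM; first by apply/bm_expR/bmZ/bm_lnabs.
  apply: bm_le1; first exact: measurable_oneDsqrV.
  by move=> s; rewrite ger0_norm ?invr_ge0 ?(ltW (oneDsqr_pos _)) // invf_le1 ?oneDsqr_pos // lerDl sqr_ge0.
have cf (s : R) : s != 0 -> {for s, continuous (fun s : R => expR (- b * ln `|s|) * (1 + s ^+ 2)^-1)}.
  move=> s0; have sp : 0 < `|s| by rewrite normr_gt0.
  have cl : {for s, continuous (fun s : R => - b * ln `|s|)}.
    apply: cvgM; first exact: cvg_cst.
    exact: (continuous_comp (@norm_continuous _ _ s) (continuous_ln sp)).
  apply: cvgM; last exact: continuous_oneDsqrV.
  exact: (continuous_comp cl (@continuous_expR R _)).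
rewrite Rint_annulus //; last by move=> s s0; apply: cf; rewrite lt_eqF.
pose F (s : R) := 2 / (1 - b) * expR ((1 - b) * (ln s - ln (1 + s))).
pose F' (s : R) := 2 * (expR ((1 - b) * (ln s - ln (1 + s))) * (s^-1 - (1 + s)^-1)).
have itvP s : `[N^-1, N]%classic s -> 0 < s.
  by rewrite /= in_itv /= => /andP[h _]; exact: lt_le_trans h.
have dA (s : R) : 0 < s ->
    is_derive s (1 : R) (fun s : R => (1 - b) * (ln s - ln (1 + s))) ((1 - b) * (s^-1 - (1 + s)^-1)).
  move=> s0; have s1 : 0 < 1 + s by rewrite addr_gt0.
  have dl := is_derive1_ln s0; have dl1 := is_derive1_ln s1.
  have dg : is_derive s (1 : R) (fun s : R => 1 + s) 1.
    by apply: is_derive_eq; rewrite add0r mulr1.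
  have dl2 : is_derive s (1 : R) (fun s : R => ln (1 + s)) ((1 + s)^-1 * 1).
    exact: (@is_derive1_comp _ (@ln R) (fun s : R => 1 + s)).
  have d3 : is_derive s (1 : R) (fun s : R => ln s - ln (1 + s)) (s^-1 - (1 + s)^-1 * 1).
    exact: is_deriveB.
  by apply: is_derive_eq; rewrite /GRing.scale /= mulr1.
have dE (s : R) : 0 < s -> is_derive s (1 : R) (fun s : R => expR ((1 - b) * (ln s - ln (1 + s))))
   (expR ((1 - b) * (ln s - ln (1 + s))) * ((1 - b) * (s^-1 - (1 + s)^-1))).
  move=> s0; exact: (@is_derive1_comp _ (@expR R) (fun s : R => (1 - b) * (ln s - ln (1 + s)))
    _ _ _ (is_derive_expR _) (dA s s0)).
have cF' (s : R) : 0 < s -> {for s, continuous F'}.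
  move=> s0; have s1 : 0 < 1 + s by rewrite addr_gt0.
  have hE := dE s s0.
  have cE : {for s, continuous (fun s : R => expR ((1 - b) * (ln s - ln (1 + s))))}.
    by apply: derivable_continuous; apply: ex_derive.
  apply: cvgM; first exact: cvg_cst.
  apply: cvgM; first exact: cE.
  apply: cvgB; first by apply: cvgV; [rewrite gt_eqF|exact: cvg_id].
  by apply: cvgV; [rewrite gt_eqF|apply: cvgD; [exact: cvg_cst|exact: cvg_id]].
have half (f : R -> R) : (forall s, 0 < s -> f s = expR (- b * ln s) * (1 + s ^+ 2)^-1) ->
   \int[mu]_(s in `[N^-1, N]) f s <= 2 / (1 - b).
  move=> hf.
  have s0 s : N^-1 <= s <= N -> 0 < s by case/andP => h _; exact: lt_le_trans h.
  apply: (@le_trans _ _ (\int[mu]_(s in `[N^-1, N]) F' s)).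
    have -> : \int[mu]_(s in `[N^-1, N]) f s =
        \int[mu]_(s in `[N^-1, N]) (expR (- b * ln `|s|) * (1 + s ^+ 2)^-1).
      by apply: eq_Rintegral => s; rewrite inE => /itvP sp; rewrite hf // gtr0_norm.
    apply: Rint_le => //.
    - by apply: continuous_itv_integrable => s /s0 sp; apply: cf; rewrite gt_eqF.
    - by apply: continuous_itv_integrable => s /s0 sp; exact: cF'.
    - by move=> s /itvP sp; rewrite gtr0_norm //; exact: powerweight_le.
  have dF (s : R) : N^-1 <= s <= N -> is_derive s (1 : R) F (F' s).
    move=> /s0 sp; have hE := dE s sp; rewrite /F /F'; apply: is_derive_eq.
    have n0 : s != 0 by rewrite gt_eqF.
    have n1 : 1 + s != 0 by rewrite gt_eqF // addr_gt0.
    have n2 : 1 - b != 0 by rewrite gt_eqF.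
    by rewrite /GRing.scale /=; field; rewrite ?n0 ?n1 ?n2.
  rewrite (Rint_FTC NN dF).
  - have h : 0 <= F N^-1 by rewrite mulr_ge0 ?expR_ge0 // divr_ge0 // ltW.
    rewrite lerBlDr; apply: (@le_trans _ _ (2 / (1 - b))); last by rewrite lerDl.
    rewrite /F ler_piMr ?divr_ge0 ?(ltW a0) // -[leRHS]expR0 ler_expR pmulr_rle0 // subr_le0.
    by rewrite ler_ln ?posrE ?addr_gt0 // lerDr.
  - by move=> s /s0 sp; exact: cF'.
rewrite (_ : 4 / (1 - b) = 2 / (1 - b) + 2 / (1 - b)); last by field; rewrite gt_eqF.
apply: lerD; apply: half => s s0; last by rewrite gtr0_norm.
by rewrite normrN gtr0_norm // sqrrN.
Qed.

Lemma annulus_incr (M N : R) : 1 <= M -> M <= N -> annulus M `<=` annulus N.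
Proof.
move=> M1 MN s /(annulusP M1)/andP[h1 h2]; have N1 := le_trans M1 MN.
apply: annulusPP => //; apply/andP; split; last exact: le_trans MN.
by apply: le_trans h1; rewrite lef_pV2 ?posrE ?(lt_le_trans ltr01).
Qed.

(** [N.+1] rather than [N], since the annuli are meaningful for [1 <= N] only. *)
Lemma bigcup_annulus : \bigcup_n annulus (n.+1%:R : R) = ~` [set 0].
Proof.
apply/seteqP; split => [s [n _ /annulusP h]|s /= s0].
  have := h; rewrite ler1n => /(_ isT)/andP[h1 _] /= s0; move: h1.
  by rewrite s0 normr0 leNgt invr_gt0 ltr0n.
have sp : 0 < `|s| by rewrite normr_gt0; apply/eqP.
have [m hm] : exists m : nat, Num.max `|s| `|s|^-1 < m%:R.
  exists (Num.truncn (Num.max `|s| `|s|^-1)).+1; exact: truncnS_gt.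
exists m => //; have : m%:R <= m.+1%:R :> R by rewrite ler_nat.
move: hm; rewrite gt_max => /andP[h1 h2] h3.
apply: annulusPP; first by rewrite ler1n.
apply/andP; split; last by apply: ltW; exact: lt_le_trans h3.
by rewrite -[leRHS]invrK lef_pV2 ?posrE ?invr_gt0 // ltW // (lt_le_trans h2).
Qed.

Lemma integrable_powerweight (b : R) : 0 <= b < 1 ->
  mu.-integrable [set: RR] (EFin \o (fun s : R => expR (- b * ln `|s|) * (1 + s ^+ 2)^-1)).
Proof.
move=> hb; set f := fun s : R => _.
have f0 s : 0 <= f s by rewrite mulr_ge0 ?expR_ge0 // invr_ge0 ltW // oneDsqr_pos.
have mf : measurable_fun [set: RR] f.
  apply: measurable_funM; last exact: measurable_oneDsqrV.
  apply: (measurableT_comp (@measurable_expR R)); apply: measurable_funM => //.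
  exact: measurable_lnabs.
apply/integrableP; split; first exact/measurable_EFinP.
under eq_integral => s _ do rewrite /= ger0_norm //.
rewrite (@ge0_negligible_integral _ RR _ mu setT [set 0]) //; last 3 first.
- exact/measurable_EFinP.
- by move=> s _; rewrite lee_fin.
- exact: lebesgue_measure_set1.
rewrite setTD -bigcup_annulus.
have mA (n : nat) : measurable (annulus (n.+1%:R : R)) by exact: measurable_annulus.
have cv : (\int[mu]_(s in annulus n.+1%:R) (f s)%:E)%E @[n --> \oo] -->
    (\int[mu]_(s in \bigcup_n annulus (n.+1%:R : R)) (f s)%:E)%E.
  apply: (@ge0_nondecreasing_set_cvg_integral _ RR R (fun n => annulus n.+1%:R) (EFin \o f) mu) => //.
  - by move=> m n mn; rewrite subsetEset; apply: annulus_incr; rewrite ?ler1n ?ler_nat.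
  - by move=> n; apply: measurable_funTS; exact/measurable_EFinP.
  - by move=> n s _; rewrite lee_fin.
apply: (@le_lt_trans _ _ (4 / (1 - b))%:E); last exact: ltry.
apply: (cvge_le _ cv); apply: nearW => n.
have i : mu.-integrable (annulus (n.+1%:R : R)) (EFin \o f).
  apply: bm_integrable => //; first exact: annulus_lty.
  apply: bmM; first by apply/bm_expR/bmZ/bm_lnabs; rewrite ler1n.
  apply: bm_le1; first exact: measurable_oneDsqrV.
  by move=> s; rewrite ger0_norm ?invr_ge0 ?(ltW (oneDsqr_pos _)) // invf_le1 ?oneDsqr_pos // lerDl sqr_ge0.
rewrite -(fineK (integrable_fin_num (mA n) i)) lee_fin.
by apply: Rint_powerweight => //; rewrite ler1n.
Qed.

Lemma Rint_exhaust_cvg d (T : measurableType d) (nu : {measure set T -> \bar R}) (D : set T)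
    (A : nat -> set T) (f : T -> R) :
  measurable D -> (forall n, measurable (A n)) -> (forall n, A n `<=` D) ->
  (forall x, D x -> \forall n \near \oo, A n x) ->
  nu.-integrable D (EFin \o f) ->
  (fun n => \int[nu]_(x in A n) f x) @ \oo --> \int[nu]_(x in D) f x.
Proof.
move=> mD mA AD cA intf.
have mf : measurable_fun D f by apply/measurable_EFinP; exact: (measurable_int nu).
have E n : \int[nu]_(x in A n) f x = \int[nu]_(x in D) (f x * \1_(A n) x).
  rewrite -{1}(setIidr (AD n)) Rintegral_mkcondr; apply: eq_Rintegral => x _.
  by rewrite patchE indicE; case: ifPn => _; rewrite ?mulr1 ?mulr0.
under eq_cvg do rewrite E.
apply: (@Rint_dominated_cvg R _ T nu D (fun n x => f x * \1_(A n) x) f (fun x => `|f x|)) => //.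
- move=> n; apply: measurable_funM => //; exact: measurable_indic.
- move=> x Dx; apply: (@cvg_near_cst _ _ _ _ _); apply: filterS (cA x Dx) => n Anx.
  by rewrite indicE mem_set // mulr1.
- exact: integrable_norm.
- move=> n x _; rewrite normrM ler_piMr // indicE; case: (_ \in _); rewrite ?normr1 ?normr0 //.
Qed.

(** The set where logarithms and powers of the frequencies may disagree. *)
Definition axes : set PP := ([set 0] `*` setT) `|` (setT `*` [set 0]).

Lemma measurable_axes : measurable axes.
Proof. by apply: measurableU; exact: measurableX. Qed.

Lemma axes_null : mu2 axes = 0%E.
Proof.
have h1 : mu2 ([set 0] `*` setT) = 0%E.
  transitivity ((mu : set R -> \bar R) [set (0 : R)]%R * mu setT)%E; first exact: product_measure1E.
  by rewrite lebesgue_measure_set1 mul0e.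
have h2 : mu2 (setT `*` [set 0]) = 0%E.
  transitivity (mu setT * (mu : set R -> \bar R) [set (0 : R)]%R)%E; first exact: product_measure1E.
  by rewrite lebesgue_measure_set1 mule0.
have m1 : measurable ([set 0] `*` setT : set PP) by exact: measurableX.
have m2 : measurable (setT `*` [set 0] : set PP) by exact: measurableX.
have h : (mu2 axes <= mu2 ([set 0%R] `*` setT) + mu2 (setT `*` [set 0%R]))%E by exact: measureU2.
by apply/eqP; rewrite eq_le measure_ge0 andbT (le_trans h) // h1 h2 adde0.
Qed.

(** The singularity on the axes is integrable because the exponents are less than one, and
    [maj] provides the integrability at infinity. *)
Lemma integrable_weight (b1 b2 : R) : 0 <= b1 < 1 -> 0 <= b2 < 1 ->
  mu2.-integrable [set: PP] (EFin \o (fun zeta : PP => expR (- logweight b1 b2 zeta) * maj zeta)).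
Proof.
move=> h1 h2.
have := integrable_tensor (integrable_powerweight h1) (integrable_powerweight h2).
apply: eq_integrable => // z _ /=; congr EFin.
by rewrite /logweight opprD expRD /maj -!mulNr mulrACA.
Qed.

End Weights.

(** * Removal of the truncations *)

Section Pairing.
Context {R : realType}.
Notation mu := (@lebesgue_measure R).
Notation RR := (measurableTypeR R).
Notation PP := (RR * RR)%type.
Notation mu2 := (sfprod (@lebesgue_measure R) (@lebesgue_measure R)).

Variables (alpha1 alpha2 theta t : R).
Hypotheses (al1 : 0 < alpha1 <= 2) (al2 : 0 < alpha2 <= 2) (th : 0 <= theta <= 1).

Definition weight (zeta : PP) : R :=
  expR (- theta * logweight (1 - alpha1 / 2) (1 - alpha2 / 2) zeta).

(** The frequency integrand of the propagator of a real function, at the point [p.1] and the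
    frequency [p.2].  The phase is the opposite of the one in [bform]. *)
Definition osc (c : R) (u : R * R -> R) (p : PP * PP) : R :=
  weight p.2 * cosint u p.2 (symb alpha1 alpha2 t p.2 - lin p.2 p.1 - c).

Definition propagator (c : R) (u : R * R -> R) (w : PP) : R := \int[mu2]_zeta osc c u (w, zeta).

Lemma weight_ge0 zeta : 0 <= weight zeta. Proof. exact: expR_ge0. Qed.

Lemma measurable_weight : measurable_fun [set: PP] weight.
Proof.
apply: (measurableT_comp (@measurable_expR R)); apply: measurable_funM => //.
exact: measurable_logweight.
Qed.

Lemma integrable_weight_maj : mu2.-integrable [set: PP] (EFin \o (fun zeta : PP => weight zeta * maj zeta)).
Proof.
have h (a : R) : 0 < a <= 2 -> 0 <= theta * (1 - a / 2) < 1.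
  case/andP: th => th0 th1 /andP[a0 a2]; apply/andP; split.
    by rewrite mulr_ge0 // subr_ge0 ler_pdivrMr // mul1r.
  apply: (@le_lt_trans _ _ (1 - a / 2)).
    by rewrite ler_piMl // subr_ge0 ler_pdivrMr // mul1r.
  by rewrite gtrBl divr_gt0.
have := integrable_weight (h _ al1) (h _ al2).
apply: eq_integrable => // z _ /=; congr (expR _ * _)%:E.
by rewrite /logweight; ring.
Qed.

(** With [u] cut off to [D]; this destroys the decay in the frequency. *)
Definition trunc_osc (D : set PP) (c : R) (u : R * R -> R) (p : PP * PP) : R :=
  weight p.2 * \int[mu2]_(z in D)
    (u z * cos (lin p.2 z + (symb alpha1 alpha2 t p.2 - lin p.2 p.1 - c))).

Variable u : R * R -> R.
Hypothesis su : rschwartz u.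

Lemma measurable_cosint_phase (D : set PP) (sigma : PP -> R) c : measurable D ->
  measurable_fun [set: PP] sigma ->
  measurable_fun [set: PP * PP] (fun p : PP * PP =>
    \int[mu2]_(z in D) (u z * cos (lin p.2 z + (sigma p.2 - lin p.2 p.1 - c)))).
Proof.
move=> mD ms.
have m1 := @measurable_fst _ _ (PP * PP)%type PP.
have m2 := @measurable_snd _ _ (PP * PP)%type PP.
have f1 := @measurable_fst _ _ PP PP.
have f2 := @measurable_snd _ _ PP PP.
have m21 := measurableT_comp f2 m1.
have m11 := measurableT_comp f1 m1.
apply: (@measurable_Rint _ _ _ (PP * PP)%type PP mu2 D (fun q =>
  u q.2 * cos (lin q.1.2 q.2 + (sigma q.1.2 - lin q.1.2 q.1.1 - c)))) => //.
apply: measurable_funM; first exact: (measurableT_comp (rschwartz_measurable su) m2).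
apply: measurableT_comp; first by apply: continuous_measurable_fun; exact: continuous_cos.
apply: measurable_funD.
  exact: (measurableT_comp (@measurable_lin2 R) (measurable_fun_pair m21 m2)).
apply: measurable_funB => //; apply: measurable_funB; first exact: (measurableT_comp ms m21).
exact: (measurableT_comp (@measurable_lin2 R) (measurable_fun_pair m21 m11)).
Qed.

Lemma measurable_trunc_osc D c : measurable D -> measurable_fun [set: PP * PP] (trunc_osc D c u).
Proof.
move=> mD; apply: measurable_funM; first exact: (measurableT_comp measurable_weight measurable_snd).
by apply: measurable_cosint_phase => //; exact: measurable_symb.
Qed.

Lemma measurable_osc c : measurable_fun [set: PP * PP] (osc c u).
Proof. exact: measurable_trunc_osc. Qed.

Lemma osc_le : exists2 K : R, 0 <= K & forall c p, `|osc c u p| <= K * (weight p.2 * maj p.2).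
Proof.
have [K K0 hK] := cosint_decay su; exists K => // c p.
by rewrite /osc normrM (ger0_norm (weight_ge0 _)) mulrCA ler_wpM2l ?weight_ge0.
Qed.

Lemma integrable_osc c w : mu2.-integrable [set: PP] (EFin \o (fun zeta => osc c u (w, zeta))).
Proof.
have [K K0 hK] := osc_le.
apply: (@integrable_dominated _ _ _ mu2 setT _ (fun zeta => K * (weight zeta * maj zeta))) => //.
- exact: (measurableT_comp (measurable_osc c) (measurable_pair1 _)).
- by apply: integrableMl_cst => //; exact: integrable_weight_maj.
Qed.

Lemma measurable_propagator c : measurable_fun [set: PP] (propagator c u).
Proof. exact: (@measurable_Rint _ _ _ PP PP mu2 setT (osc c u) measurableT (measurable_osc c)). Qed.

Lemma propagator_bounded : exists2 B : R, 0 <= B & forall c w, `|propagator c u w| <= B.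
Proof.
have [K K0 hK] := osc_le; exists (\int[mu2]_zeta (K * (weight zeta * maj zeta))).
  by apply: Rintegral_ge0 => z _; rewrite mulr_ge0 // mulr_ge0 ?weight_ge0 ?maj_ge0.
move=> c w; apply: normr_Rint_le => //.
- exact: integrable_osc.
- by apply: integrableMl_cst => //; exact: integrable_weight_maj.
Qed.

Definition box (n : nat) : set PP := `[- n%:R, n%:R]%classic `*` `[- n%:R, n%:R]%classic.

Lemma measurable_box n : measurable (box n).
Proof. by apply: measurableX; exact: measurable_itv. Qed.

Lemma box_lty n : (mu2 (box n) < +oo)%E.
Proof. by apply: finite_measureX; try exact: measurable_itv; exact: itv_lt_pinfty. Qed.

Lemma box_near (z : PP) : \forall n \near \oo, box n z.
Proof.
near=> n; have : `|z.1| + `|z.2| < n%:R.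
  by near: n; exact: nbhs_infty_gtr.
move=> h; split; rewrite /= in_itv /= -ler_norml.
- by apply: ltW; apply: le_lt_trans h; rewrite lerDl.
- by apply: ltW; apply: le_lt_trans h; rewrite lerDr.
Unshelve. all: by end_near. Qed.

Lemma trunc_osc_le : exists2 B : R, 0 <= B &
  forall D c p, measurable D -> `|trunc_osc D c u p| <= weight p.2 * B.
Proof.
have [M M0 hM] := rschwartz_le_maj su.
have iM : mu2.-integrable [set: PP] (EFin \o (fun z : PP => M * maj z)).
  by apply: integrableMl_cst => //; exact: integrable_maj.
exists (\int[mu2]_z (M * maj z)).
  by apply: Rintegral_ge0 => z _; rewrite mulr_ge0 // maj_ge0.
move=> D c p mD; rewrite /trunc_osc normrM (ger0_norm (weight_ge0 _)) ler_wpM2l ?weight_ge0 //.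
apply: (@le_trans _ _ (\int[mu2]_(z in D) (M * maj z))); last first.
  by apply: Rint_subset_ge0 => // z _; rewrite mulr_ge0 // maj_ge0.
apply: normr_Rint_le => //.
- by apply: (integrableS measurableT) => //; exact: integrable_cosint.
- exact: (integrableS measurableT).
move=> z _; rewrite normrM -[leRHS]mulr1; apply: ler_pM => //.
by rewrite ler_norml cos_geN1 cos_le1.
Qed.

Lemma cvg_trunc_osc c p :
  (fun n => trunc_osc (box n) c u p) @ \oo --> osc c u p.
Proof.
apply: cvgM; first exact: cvg_cst.
apply: Rint_exhaust_cvg => //.
- exact: measurable_box.
- by move=> z _; exact: box_near.
- exact: integrable_cosint.
Qed.

Definition freqs (n : nat) : set PP := annulus n.+1%:R `*` annulus n.+1%:R.

Lemma freqs_sub n : freqs n `<=` ~` axes.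
Proof.
move=> z [z1 z2] /= [[e _]|[_ e]].
- have : (~` [set 0]) z.1 by rewrite -bigcup_annulus; exists n.
  by apply.
- have : (~` [set 0]) z.2 by rewrite -bigcup_annulus; exists n.
  by apply.
Qed.

Lemma freqs_near z : (~` axes) z -> \forall n \near \oo, freqs n z.
Proof.
move=> hz.
have h (s : R) : s != 0 -> \forall n \near \oo, annulus (n.+1%:R : R) s.
  move=> s0; have : (~` [set 0]) s by apply/eqP.
  rewrite -bigcup_annulus => -[m _ hm]; exists m => // n /= mn.
  by apply: annulus_incr hm; rewrite ?ler1n ?ler_nat.
have z1 : z.1 != 0 by apply/eqP => e; apply: hz; left.
have z2 : z.2 != 0 by apply/eqP => e; apply: hz; right.
by near=> n; split; near: n; exact: h.
Unshelve. all: by end_near. Qed.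

Lemma cvg_propagator c w :
  (fun n => \int[mu2]_(zeta in freqs n) osc c u (w, zeta)) @ \oo --> propagator c u w.
Proof.
have io := integrable_osc c w.
have -> : propagator c u w = \int[mu2]_(zeta in ~` axes) osc c u (w, zeta).
  rewrite /propagator /Rintegral -setTD; congr fine.
  by apply: negligible_integral => //; [exact: measurable_axes|exact: axes_null].
apply: Rint_exhaust_cvg.
- by apply: measurableC; exact: measurable_axes.
- by move=> n; exact: measurable_Q.
- exact: freqs_sub.
- exact: freqs_near.
- by apply: (integrableS measurableT) => //; apply: measurableC; exact: measurable_axes.
Qed.

Lemma bform_trunc_osc (E : set PP) (g : PP -> R) (n k : nat) c : measurable E ->
  (mu2 E < +oo)%E -> bm E g ->
  bform alpha1 alpha2 theta t n.+1%:R c (box k) E u g =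
  \int[mu2]_(w in E) (g w * \int[mu2]_(zeta in freqs n) trunc_osc (box k) c u (w, zeta)).
Proof.
move=> mE fE bg; have [M M0 hM] := rschwartz_le_maj su.
have bu : bm (box k) (u : PP -> R).
  split; first exact: rschwartz_measurable.
  by exists M => z _; rewrite (le_trans (hM z)) // ler_piMr // maj_le1.
have N1 : 1 <= n.+1%:R :> R by rewrite ler1n.
rewrite (bform_iterated alpha1 alpha2 theta t c N1 (measurable_box k) mE (box_lty k) fE bu bg).
apply: eq_Rintegral => w _; congr (_ * _); apply: eq_Rintegral => zeta _.
congr (_ * _); apply: eq_Rintegral => z _; congr (_ * _).
by rewrite -cosN; congr cos => /=; ring.
Qed.

(** The cut-off in space is removed first, while the frequencies are confined to a set where the
    weight is bounded: there the total mass of [u] is a sufficient majorant. *)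
Lemma cvg_pairing_trunc (E : set PP) (g : PP -> R) (n : nat) c : measurable E ->
  (mu2 E < +oo)%E -> bm E g ->
  (fun k => \int[mu2]_(w in E) (g w * \int[mu2]_(zeta in freqs n) trunc_osc (box k) c u (w, zeta)))
   @ \oo --> \int[mu2]_(w in E) (g w * \int[mu2]_(zeta in freqs n) osc c u (w, zeta)).
Proof.
move=> mE fE [mg [Mg gM]]; have [B B0 hB] := trunc_osc_le.
have mQ : measurable (freqs n) by exact: measurable_Q.
have iW : mu2.-integrable (freqs n) (EFin \o (fun zeta => weight zeta * B)).
  apply: bm_integrable => //; first exact: Q_lty.
  apply: bmM; last exact: bm_cst.
  by apply: bm_expR; apply: bmZ; apply: bm_logweight; rewrite ler1n.
have mt k := measurable_trunc_osc c (measurable_box k).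
pose J k w := \int[mu2]_(zeta in freqs n) trunc_osc (box k) c u (w, zeta).
have mJ k : measurable_fun [set: PP] (J k).
  exact: (@measurable_Rint _ _ _ PP PP mu2 (freqs n) (trunc_osc (box k) c u) mQ (mt k)).
have bt k w zeta : `|trunc_osc (box k) c u (w, zeta)| <= weight zeta * B.
  exact: (hB (box k) c (w, zeta) (measurable_box k)).
have mtw k w : measurable_fun [set: PP] (fun zeta => trunc_osc (box k) c u (w, zeta)).
  exact: (measurableT_comp (mt k) (measurable_pair1 _)).
apply: (@Rint_dominated_cvg R _ PP mu2 E (fun k w => g w * J k w) _
  (fun w => `|Mg| * \int[mu2]_(zeta in freqs n) (weight zeta * B))) => //.
- by move=> k; apply: measurable_funTS; exact: measurable_funM.
- move=> w Ew; apply: cvgM; first exact: cvg_cst.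
  apply: (@Rint_dominated_cvg R _ PP mu2 (freqs n) _ _ (fun zeta => weight zeta * B)) => //.
  + by move=> k; apply: measurable_funTS; exact: mtw.
  + by move=> zeta _; exact: cvg_trunc_osc.
- by apply: bm_integrable => //; exact: bm_cst.
- move=> k w Ew; rewrite normrM; apply: ler_pM => //.
    by rewrite (le_trans (gM _ Ew)) // ler_norm.
  apply: normr_Rint_le => //.
  apply: (@integrable_dominated _ _ _ mu2 (freqs n) _ (fun zeta => weight zeta * B)) => //.
  by apply: measurable_funTS; exact: mtw.
Qed.

(** The decay of the Fourier transform of [u] now makes the weight integrable over all
    frequencies. *)
Lemma cvg_pairing (E : set PP) (g : PP -> R) c : measurable E ->
  (mu2 E < +oo)%E -> bm E g ->
  (fun n => \int[mu2]_(w in E) (g w * \int[mu2]_(zeta in freqs n) osc c u (w, zeta)))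
   @ \oo --> \int[mu2]_(w in E) (g w * propagator c u w).
Proof.
move=> mE fE [mg [Mg gM]]; have [K K0 hK] := osc_le.
have iK : mu2.-integrable [set: PP] (EFin \o (fun zeta => K * (weight zeta * maj zeta))).
  by apply: integrableMl_cst => //; exact: integrable_weight_maj.
have mQ n : measurable (freqs n) by exact: measurable_Q.
have mJ n : measurable_fun [set: PP] (fun w => \int[mu2]_(zeta in freqs n) osc c u (w, zeta)).
  exact: (@measurable_Rint _ _ _ PP PP mu2 (freqs n) (osc c u) (mQ n) (measurable_osc c)).
apply: (@Rint_dominated_cvg R _ PP mu2 E _ _
  (fun w => `|Mg| * \int[mu2]_zeta (K * (weight zeta * maj zeta)))) => //.
- by move=> n; apply: measurable_funTS; exact: measurable_funM.
- by move=> w Ew; apply: cvgM; [exact: cvg_cst|exact: cvg_propagator].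
- by apply: bm_integrable => //; exact: bm_cst.
- move=> n w Ew; rewrite normrM; apply: ler_pM => //.
    by rewrite (le_trans (gM _ Ew)) // ler_norm.
  apply: (@le_trans _ _ (\int[mu2]_(zeta in freqs n) (K * (weight zeta * maj zeta)))); last first.
    apply: Rint_subset_ge0 => // z _.
    by rewrite mulr_ge0 // mulr_ge0 ?weight_ge0 ?maj_ge0.
  apply: normr_Rint_le => //.
  + by apply: (integrableS measurableT) => //; exact: integrable_osc.
  + exact: (integrableS measurableT).
Qed.

End Pairing.

Section PairingBound.
Context {R : realType}.
Notation RR := (measurableTypeR R).
Notation PP := (RR * RR)%type.
Notation mu2 := (sfprod (@lebesgue_measure R) (@lebesgue_measure R)).

Lemma cvg_normr_le (x : nat -> R) (l K : R) : x @ \oo --> l ->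
  (forall n, `|x n| <= K) -> `|l| <= K.
Proof. by move=> /cvg_norm xl xK; apply: (cvgr_to_le xl); exact: nearW. Qed.

Lemma pairing_bound (alpha1 alpha2 theta : R) :
  0 < alpha1 <= 2 -> alpha1 != 1 -> 0 < alpha2 <= 2 -> alpha2 != 1 -> 0 <= theta <= 1 ->
  exists2 C : R, 0 < C & forall (t c a b : R) (E : set PP) (u : R * R -> R) (g : PP -> R),
  t != 0 -> measurable E -> (mu2 E < +oo)%E -> rschwartz u -> bm E g -> 0 < a -> 0 < b ->
  (\int[mu2]_z (`|u z| `^ (2 / (1 + theta)))%:E <= (a `^ (2 / (1 + theta)))%:E)%E ->
  \int[mu2]_(z in E) `|g z| `^ (2 / (1 + theta)) <= b `^ (2 / (1 + theta)) ->
  `|\int[mu2]_(w in E) (g w * propagator alpha1 alpha2 theta t c u w)|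
     <= C * `|t| `^ (- theta) * (a * b).
Proof.
move=> al1 al1' al2 al2' th.
have [C C0 hC] := bform_bound al1 al1' al2 al2' th; exists C => //.
move=> t c a b E u g t0 mE fE su bg a0 b0 ua gb.
have mu_p : measurable_fun [set: PP] (fun z : PP => `|u z| `^ (2 / (1 + theta))).
  apply: (measurableT_comp (@measurable_powR R _)).
  by apply: measurableT_comp => //; exact: rschwartz_measurable.
have step n : `|\int[mu2]_(w in E) (g w *
    \int[mu2]_(zeta in freqs n) osc alpha1 alpha2 theta t c u (w, zeta))| <= C * `|t| `^ (- theta) * (a * b).
  apply: (cvg_normr_le (@cvg_pairing_trunc R alpha1 alpha2 theta t u su E g n c mE fE bg)) => k.
  rewrite -bform_trunc_osc //.
  apply: hC => //.
  - by rewrite ler1n.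
  - exact: measurable_box.
  - exact: box_lty.
  - have [M M0 hM] := rschwartz_le_maj su.
    split; first exact: rschwartz_measurable.
    by exists M => z _; rewrite (le_trans (hM z)) // ler_piMr // maj_le1.
  - by apply: Rint_le_integral => //; exact: measurable_box.
exact: (cvg_normr_le (@cvg_pairing R alpha1 alpha2 theta t al1 al2 th u su E g c mE fE bg)).
Qed.

End PairingBound.

(** * Duality *)

Section Duality.
Context {R : realType}.
Notation mu := (@lebesgue_measure R).
Notation RR := (measurableTypeR R).
Notation PP := (RR * RR)%type.
Notation mu2 := (sfprod (@lebesgue_measure R) (@lebesgue_measure R)).

Lemma target_exponentE (theta : R) : theta < 1 -> target_exponent theta = (2 / (1 - theta))%:E.
Proof. by move=> th; rewrite /target_exponent lt_eqF. Qed.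

Lemma conjugate_exponents (theta : R) : 0 <= theta < 1 ->
  [/\ 0 < 2 / (1 + theta), 1 < 2 / (1 - theta),
      (2 / (1 + theta)) * (2 / (1 - theta) - 1) = 2 / (1 - theta) &
      (2 / (1 - theta))^-1 + (2 / (1 + theta))^-1 = 1].
Proof.
move=> /andP[th0 th1]; have p0 : 0 < 1 + theta by rewrite ltr_wpDr.
have q0 : 0 < 1 - theta by rewrite subr_gt0.
split; first by rewrite divr_gt0.
- by rewrite ltr_pdivlMr // mul1r; lra.
- by field; rewrite !gt_eqF.
- by field; rewrite !gt_eqF.
Qed.

(** Absorption: [S = S^(1/q) S^(1/p)], and the second factor cancels. *)
Lemma le_of_selfbound (S A p q : R) : 0 < p -> 0 < q -> q^-1 + p^-1 = 1 -> 0 < S -> 0 < A ->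
  S <= A * S `^ p^-1 -> S <= A `^ q.
Proof.
move=> p0 q0 pq S0 A0; have E : S = S `^ q^-1 * S `^ p^-1.
  by rewrite -powRD ?pq ?powRr1 ?(ltW S0) // gt_eqF // implybT.
rewrite {1}E ler_pM2r ?powR_gt0 // => h.
have -> : S = (S `^ q^-1) `^ q by rewrite -powRrM mulVf ?gt_eqF // powRr1 // ltW.
by apply: ge0_ler_powR; rewrite ?nnegrE ?powR_ge0 // ltW.
Qed.

(** The test function is the power [q - 1] of [h] on a box, for which both integrals equal the
    integral [S] of [|h|^q]; [S] is finite because [h] is bounded, hence [le_of_selfbound].  The
    boxes then exhaust the plane. *)
Lemma duality_fin (theta A B : R) (h : PP -> R) : 0 <= theta < 1 ->
  measurable_fun [set: PP] h -> (forall z, `|h z| <= B) -> 0 < A ->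
  (forall (E : set PP) (g : PP -> R) (b : R), measurable E -> (mu2 E < +oo)%E -> bm E g -> 0 < b ->
    \int[mu2]_(z in E) `|g z| `^ (2 / (1 + theta)) <= b `^ (2 / (1 + theta)) ->
    `|\int[mu2]_(z in E) (g z * h z)| <= A * b) ->
  (Lnorm mu2 (2 / (1 - theta))%:E (EFin \o h) <= A%:E)%E.
Proof.
move=> th mh hB A0 dual.
have [p0 q1 pq1 pq] := conjugate_exponents th.
set p := 2 / (1 + theta) in dual p0 pq1 pq *; set q := 2 / (1 - theta) in q1 pq1 pq *.
have q0 : 0 < q by exact: lt_trans q1.
have mhq : measurable_fun [set: PP] (fun z => `|h z| `^ q).
  by apply: (measurableT_comp (@measurable_powR R _)); apply: measurableT_comp.
have bhq n : bm (box n) (fun z => `|h z| `^ q).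
  split => //; exists (`|B| `^ q) => z _; rewrite ger0_norm ?powR_ge0 //.
  apply: ge0_ler_powR; [exact: ltW|by rewrite nnegrE|by rewrite nnegrE|].
  by rewrite (le_trans (hB z)) // ler_norm.
have ihq n := bm_integrable (measurable_box n) (box_lty n) (bhq n).
have bnd n : \int[mu2]_(z in box n) `|h z| `^ q <= A `^ q.
  set S := Rintegral _ _ _.
  have S0 : 0 <= S by apply: Rintegral_ge0 => z _; exact: powR_ge0.
  move: S0; rewrite le_eqVlt => /predU1P[<-|S0]; first exact: powR_ge0.
  apply: (le_of_selfbound p0 q0 pq S0 A0).
  have bg : bm (box n) (fun z => spow (q - 1) (h z)).
    by apply: bm_spow; [rewrite subr_gt0|split => //; exists B].
  have q10 : q - 1 != 0 by rewrite gt_eqF // subr_gt0.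
  have := dual (box n) _ (S `^ p^-1) (measurable_box n) (box_lty n) bg (powR_gt0 _ S0).
  rewrite -powRrM mulVf ?gt_eqF // powRr1 ?(ltW S0) //.
  have -> : \int[mu2]_(z in box n) `|spow (q - 1) (h z)| `^ p = S.
    by apply: eq_Rintegral => z _; rewrite normr_spow // -powRrM mulrC pq1.
  move=> /(_ (lexx _)); apply: le_trans.
  have -> : \int[mu2]_(z in box n) (spow (q - 1) (h z) * h z) = S.
    apply: eq_Rintegral => z _; rewrite /spow mulrAC -expr2 -real_normK ?num_real // expr2 -mulrA.
    rewrite (_ : q - 1 - 1 = (q - 1) - 1) //.
    by rewrite mulr_powRB1 ?subr_gt0 // mulr_powRB1.
  exact: ler_norm.
have tot : (\int[mu2]_z (`|h z| `^ q)%:E <= (A `^ q)%:E)%E.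
  have -> : [set: PP] = \bigcup_n box n.
    apply/seteqP; split => // z _; have [n _ hn] := box_near z.
    by exists n => //; exact: hn n (leqnn n).
  have cv : (\int[mu2]_(z in box n) (`|h z| `^ q)%:E)%E @[n --> \oo] -->
      (\int[mu2]_(z in \bigcup_n box n) (`|h z| `^ q)%:E)%E.
    apply: (@ge0_nondecreasing_set_cvg_integral _ PP R box (fun z => (`|h z| `^ q)%:E) mu2).
    - move=> m n mn; rewrite subsetEset => z [z1 z2].
      have mn' : m%:R <= n%:R :> R by rewrite ler_nat.
      by split; move: z1 z2; rewrite /= !in_itv /= -!ler_norml => h1 h2; exact: le_trans mn'.
    - exact: measurable_box.
    - by move=> n; apply: measurable_funTS; exact/measurable_EFinP.
    - by move=> n z _; rewrite lee_fin powR_ge0.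
  apply: (cvge_le _ cv); apply: nearW => n.
  by rewrite -(fineK (integrable_fin_num (measurable_box n) (ihq n))) lee_fin; exact: bnd.
rewrite unlock /=.
have -> : (A%:E = (A `^ q)%:E `^ q^-1)%E.
  by rewrite poweR_EFin -powRrM mulfV ?gt_eqF // powRr1 // ltW.
apply: gt0_ler_poweR.
- by rewrite invr_ge0 ltW.
- by rewrite in_itv /= leey andbT; apply: integral_ge0 => z _; rewrite lee_fin powR_ge0.
- by rewrite in_itv /= leey andbT lee_fin powR_ge0.
- exact: tot.
Qed.

(** If [|h| >= A + e] on a subset of positive measure of some box, then the sign of [h] on this
    set contradicts the hypothesis. *)
Lemma duality_oo (A B : R) (h : PP -> R) :
  measurable_fun [set: PP] h -> (forall z, `|h z| <= B) -> 0 < A ->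
  (forall (E : set PP) (g : PP -> R) (b : R), measurable E -> (mu2 E < +oo)%E -> bm E g -> 0 < b ->
    \int[mu2]_(z in E) `|g z| <= b ->
    `|\int[mu2]_(z in E) (g z * h z)| <= A * b) ->
  (Lnorm mu2 +oo (EFin \o h) <= A%:E)%E.
Proof.
move=> mh hB A0 dual; rewrite unlock /=; case: ifPn => _; last by rewrite lee_fin ltW.
apply/lee_addgt0Pr => e e0; rewrite -EFinD; apply/ess_supP.
pose F := [set z : PP | A + e <= `|h z|].
have mF : measurable F.
  rewrite (_ : F = (fun z => `|h z|) @^-1` `[A + e, +oo[%classic); last first.
    by apply/seteqP; split => z; rewrite /F /= in_itv /= andbT.
  by rewrite -[X in measurable X]setTI; apply: measurableT_comp.
have mE n : measurable (box n `&` F) by apply: measurableI => //; exact: measurable_box.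
have fE n : (mu2 (box n `&` F) < +oo)%E.
  apply: le_lt_trans (box_lty n); apply: le_measure;
    [by rewrite inE; exact: mE|by rewrite inE; exact: measurable_box|exact: subIsetl].
have null n : mu2 (box n `&` F) = 0%E.
  apply/eqP; rewrite eq_le measure_ge0 andbT leNgt; apply/negP => pos.
  set E := box n `&` F in pos *; set m := fine (mu2 E).
  have mEE : (m%:E = mu2 E)%E.
    by rewrite fineK // ge0_fin_numE ?measure_ge0 //; exact: fE.
  have m0 : 0 < m by rewrite -lte_fin mEE.
  have sg (z : PP) : `|Num.sg (h z)| <= 1 by rewrite normr_sg; case: (h z != 0).
  have msg : measurable_fun [set: PP] (fun z => Num.sg (h z)).
    rewrite (_ : (fun z => _) = spow 0 \o h); first exact: (measurableT_comp (measurable_spow 0) mh).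
    apply/funext => z /=; have [->|hz] := eqVneq (h z) 0; first by rewrite /spow mul0r sgr0.
    by rewrite spowE // mul0r expR0 mulr1.
  have bsg : bm E (fun z => Num.sg (h z)) by exact: bm_le1.
  have g1 : \int[mu2]_(z in E) `|Num.sg (h z)| <= m.
    rewrite -[m]mul1r -(@Rintegral_cst _ _ _ mu2 E (mE n) 1).
    apply: Rint_le; [exact: mE|exact: (bm_integrable (mE n) (fE n) (bm_norm bsg))| |by []].
    exact: (bm_integrable (mE n) (fE n) (bm_cst _ _)).
  have := dual E _ m (mE n) (fE n) bsg m0 g1; apply/negP; rewrite -ltNge.
  apply: (@lt_le_trans _ _ ((A + e) * m)); first by rewrite ltr_pM2r // ltrDl.
  apply: le_trans (ler_norm _); rewrite -(@Rintegral_cst _ _ _ mu2 E (mE n) (A + e)).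
  apply: Rint_le.
  - exact: mE.
  - exact: (bm_integrable (mE n) (fE n) (bm_cst _ _)).
  - apply: (bm_integrable (mE n) (fE n)); apply: bmM => //; split => //; exists B => z _; exact: hB.
  - by move=> z [_ Fz]; rewrite /= -normrEsg.
have [|M [mM M0 sM]] := @negligible_bigcup _ _ _ mu2 (fun n => box n `&` F).
  by move=> n; apply/(negligibleP _ (mE n)); exact: null.
exists M; split => //; apply: subset_trans sM => z /= /negP; rewrite -ltNge lte_fin => hz.
have [n _ hn] := box_near z; exists n => //; split; first exact: hn n (leqnn n).
exact: ltW.
Qed.

Lemma duality (theta A B : R) (h : PP -> R) : 0 <= theta <= 1 ->
  measurable_fun [set: PP] h -> (forall z, `|h z| <= B) -> 0 < A ->
  (forall (E : set PP) (g : PP -> R) (b : R), measurable E -> (mu2 E < +oo)%E -> bm E g -> 0 < b ->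
    \int[mu2]_(z in E) `|g z| `^ (2 / (1 + theta)) <= b `^ (2 / (1 + theta)) ->
    `|\int[mu2]_(z in E) (g z * h z)| <= A * b) ->
  (Lnorm mu2 (target_exponent theta) (EFin \o h) <= A%:E)%E.
Proof.
move=> /andP[th0 th1] mh hB A0 dual.
have [th|th] := eqVneq theta 1; last first.
  have t1 : theta < 1 by rewrite lt_neqAle th.
  rewrite target_exponentE //; apply: (@duality_fin theta A B) => //.
  by rewrite th0.
rewrite /target_exponent th eqxx; apply: (duality_oo mh hB A0) => E g b mE fE bg b0 hg.
apply: dual => //; rewrite th (_ : 2 / (1 + 1) = 1); last by field.
rewrite powRr1 ?(ltW b0) //; apply: le_trans hg; rewrite le_eqVlt; apply/orP; left; apply/eqP.
by apply: eq_Rintegral => z _; rewrite powRr1.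
Qed.

End Duality.

(** * Norms of real and complex functions *)

Section PropagatorNorm.
Context {R : realType}.
Notation mu := (@lebesgue_measure R).
Notation RR := (measurableTypeR R).
Notation PP := (RR * RR)%type.
Notation mu2 := (sfprod (@lebesgue_measure R) (@lebesgue_measure R)).

(** The norm of [u] is enlarged by an arbitrarily small amount, since [pairing_bound] asks for
    positive bounds. *)
Lemma propagator_Lnorm (alpha1 alpha2 theta : R) :
  0 < alpha1 <= 2 -> alpha1 != 1 -> 0 < alpha2 <= 2 -> alpha2 != 1 -> 0 <= theta <= 1 ->
  exists2 C : R, 0 < C & forall (t c : R) (u : R * R -> R), t != 0 -> rschwartz u ->
  (Lnorm mu2 (target_exponent theta) (EFin \o propagator alpha1 alpha2 theta t c u) <=
    (C * `|t| `^ (- theta))%:E * Lnorm mu2 (source_exponent theta) (EFin \o (u : PP -> R)))%E.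
Proof.
move=> al1 al1' al2 al2' th.
have [C C0 hC] := pairing_bound al1 al1' al2 al2' th; exists C => // t c u t0 su.
have th0 : 0 < 1 + theta by case/andP: th => h _; rewrite ltr_wpDr.
pose p := 2 / (1 + theta); have p0 : 0 < p by rewrite divr_gt0.
have pn : p != 0 by rewrite gt_eqF.
have K0 : 0 < C * `|t| `^ (- theta) by rewrite mulr_gt0 // powR_gt0 // normr_gt0.
set K := C * `|t| `^ (- theta) in K0 *.
rewrite /source_exponent -/p.
have Lp := powR_Lnorm mu2 (EFin \o (u : PP -> R)) pn.
have L0 := Lnorm_ge0 mu2 p%:E (EFin \o (u : PP -> R)).
set L := Lnorm mu2 p%:E (EFin \o (u : PP -> R)) in Lp L0 *.
have [Loo|Lfin] := eqVneq L +oo%E.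
  by rewrite Loo gt0_muley ?lte_fin // leey.
have LE : (L = (fine L)%:E)%E by rewrite fineK // ge0_fin_numE // ltey.
have l0 : 0 <= fine L by rewrite fine_ge0.
apply/lee_addgt0Pr => e e0; rewrite LE -EFinM -EFinD.
have e'0 : 0 < e / K by rewrite divr_gt0.
have -> : K * fine L + e = K * (fine L + e / K) by field; rewrite gt_eqF.
have a0 : 0 < fine L + e / K by rewrite ltr_wpDl.
have [B _ hB] := propagator_bounded t al1 al2 th su.
apply: (@duality _ theta _ B _ th) => //.
- exact: measurable_propagator.
- by rewrite mulr_gt0.
move=> E g b mE fE bg b0 hb.
have := hC t c (fine L + e / K) b E u g t0 mE fE su bg a0 b0 _ hb.
rewrite /K -!mulrA; apply.
have -> : (\int[mu2]_z (`|u z| `^ (2 / (1 + theta)))%:E = (fine L `^ p)%:E)%E.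
  by rewrite -poweR_EFin -LE Lp.
rewrite lee_fin; apply: ge0_ler_powR; rewrite ?nnegrE // ?ltW //.
by rewrite ltrDl.
Qed.

End PropagatorNorm.

Section ComplexNorm.
Context {R : realType}.
Notation RR := (measurableTypeR R).
Notation PP := (RR * RR)%type.
Notation mu2 := (sfprod (@lebesgue_measure R) (@lebesgue_measure R)).
Notation normc := (@ComplexField.Normc.normc R).
Notation Re := (@complex.Re R).
Notation Im := (@complex.Im R).

Lemma Lnorm_mono (q : \bar R) (f g : PP -> R) : (0 < q)%E ->
  measurable_fun [set: PP] f -> measurable_fun [set: PP] g ->
  (forall z, `|f z| <= `|g z|) -> (Lnorm mu2 q (EFin \o f) <= Lnorm mu2 q (EFin \o g))%E.
Proof.
case: q => // [q|] q0 mf mg fg; rewrite unlock /=.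
- rewrite lte_fin in q0.
  have mp (h : PP -> R) : measurable_fun [set: PP] h ->
      measurable_fun [set: PP] (fun z => (`|h z| `^ q)%:E).
    move=> mh; apply/measurable_EFinP; apply: (measurableT_comp (@measurable_powR R _)).
    exact: measurableT_comp.
  apply: gt0_ler_poweR.
  + by rewrite invr_ge0 ltW.
  + by rewrite in_itv /= leey andbT; apply: integral_ge0 => z _; rewrite lee_fin powR_ge0.
  + by rewrite in_itv /= leey andbT; apply: integral_ge0 => z _; rewrite lee_fin powR_ge0.
  apply: ge0_le_integral.
  + by [].
  + by move=> z _; rewrite lee_fin powR_ge0.
  + exact: (mp f mf).
  + exact: (mp g mg).
  + move=> z _; rewrite lee_fin; apply: ge0_ler_powR; rewrite ?nnegrE //.
    exact: ltW.
- case: ifPn => // _; apply: le_ess_sup; apply: nearW => z /=; rewrite lee_fin; exact: fg.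
Qed.

Lemma Lnorm_normr (q : \bar R) (f : PP -> R) :
  Lnorm mu2 q (EFin \o (fun z => `|f z|)) = Lnorm mu2 q (EFin \o f).
Proof. by rewrite -[RHS]Lnorm_abse; apply: eq_Lnorm. Qed.

Lemma normcE2 (x : R[i]) : normc x = Num.sqrt (Re x ^+ 2 + Im x ^+ 2).
Proof. by case: x. Qed.

Lemma normc_ge0 (x : R[i]) : 0 <= normc x.
Proof. by rewrite normcE2 sqrtr_ge0. Qed.

Lemma normr_Re_le (x : R[i]) : `|Re x| <= normc x.
Proof. by rewrite normcE2 -sqrtr_sqr ler_wsqrtr // lerDl sqr_ge0. Qed.

Lemma normr_Im_le (x : R[i]) : `|Im x| <= normc x.
Proof. by rewrite normcE2 -sqrtr_sqr ler_wsqrtr // lerDr sqr_ge0. Qed.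

Lemma normc_le_ReIm (x : R[i]) : normc x <= `|Re x| + `|Im x|.
Proof.
rewrite normcE2 -[leRHS]ger0_norm ?addr_ge0 // -sqrtr_sqr ler_wsqrtr //.
rewrite sqrrD !real_normK ?num_real // lerD2r lerDl mulrn_wge0 // mulr_ge0 //.
Qed.

Lemma measurable_normc (F : PP -> R[i]) : cmeasurable F ->
  measurable_fun [set: PP] (fun z => normc (F z)).
Proof.
move=> [m1 m2]; under eq_fun do rewrite normcE2.
apply: (@measurableT_comp _ _ _ _ _ _ (@Num.sqrt R)).
  by apply: continuous_measurable_fun; exact: sqrt_continuous.
by apply: measurable_funD; exact: measurable_funX.
Qed.

Lemma cmeasurableB (F G : PP -> R[i]) : cmeasurable F -> cmeasurable G ->
  cmeasurable (fun z => F z - G z).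
Proof.
move=> [f1 f2] [g1 g2]; split.
- rewrite (_ : (fun z => _) = (fun z => Re (F z) - Re (G z))); first exact: measurable_funB.
  by apply/funext => z; case: (F z); case: (G z).
- rewrite (_ : (fun z => _) = (fun z => Im (F z) - Im (G z))); first exact: measurable_funB.
  by apply/funext => z; case: (F z); case: (G z).
Qed.

Lemma cLnorm_triangle (q : \bar R) (F G H : PP -> R[i]) : (1 <= q)%E ->
  cmeasurable F -> cmeasurable G -> cmeasurable H ->
  (forall z, normc (F z) <= normc (G z) + normc (H z)) ->
  (cLnorm q F <= cLnorm q G + cLnorm q H)%E.
Proof.
move=> q1 mF mG mH FGH.
have q0 : (0 < q)%E by apply: lt_le_trans q1; rewrite lte_fin.
have mf := measurable_normc mF; have mg := measurable_normc mG; have mh := measurable_normc mH.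
apply: le_trans (eminkowski mu2 mg mh q1).
apply: (@Lnorm_mono q _ (fun z => normc (G z) + normc (H z))) => //.
  exact: measurable_funD.
by move=> z; rewrite !ger0_norm ?addr_ge0 ?normc_ge0.
Qed.

Lemma cLnormB_sym (q : \bar R) (F G : PP -> R[i]) :
  cLnorm q (fun z => F z - G z) = cLnorm q (fun z => G z - F z).
Proof.
by apply: eq_Lnorm => z; rewrite -normcN opprB.
Qed.

Lemma normc_triangle (x y : R[i]) : normc x <= normc (x - y) + normc y.
Proof. by rewrite -{1}(subrK y x); exact: le_normcD. Qed.

End ComplexNorm.

(** * The propagator in real form *)

Section Identify.
Local Open Scope complex_scope.
Context {R : realType}.
Notation mu := (@lebesgue_measure R).
Notation RR := (measurableTypeR R).
Notation PP := (RR * RR)%type.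
Notation mu2 := (sfprod (@lebesgue_measure R) (@lebesgue_measure R)).
Notation normc := (@ComplexField.Normc.normc R).
Notation Re := (@complex.Re R).
Notation Im := (@complex.Im R).

Variables (alpha1 alpha2 theta t : R).
Hypotheses (al1 : 0 < alpha1 <= 2) (al2 : 0 < alpha2 <= 2) (th : 0 <= theta <= 1).

Let T := smoothed_propagator alpha1 alpha2 ((1 - alpha1 / 2) * theta) ((1 - alpha2 / 2) * theta) t.

(** [pweight] and [psymb] are the modulus and the phase of the symbol in terms of powers; they
    differ from [weight] and [symb] on [axes] only. *)
Definition pweight (zeta : PP) : R :=
  `|zeta.1| `^ (- ((1 - alpha1 / 2) * theta)) * `|zeta.2| `^ (- ((1 - alpha2 / 2) * theta)).

Definition psymb (zeta : PP) : R := t * (`|zeta.1| `^ alpha1 + `|zeta.2| `^ alpha2).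

Lemma measurable_powR_fst (a : R) : measurable_fun [set: PP] (fun z : PP => `|z.1| `^ a).
Proof.
apply: (measurableT_comp (@measurable_powR R _)).
by apply: (measurableT_comp (@normr_measurable R _)); exact: measurable_fst.
Qed.

Lemma measurable_powR_snd (a : R) : measurable_fun [set: PP] (fun z : PP => `|z.2| `^ a).
Proof.
apply: (measurableT_comp (@measurable_powR R _)).
by apply: (measurableT_comp (@normr_measurable R _)); exact: measurable_snd.
Qed.

Lemma measurable_psymb : measurable_fun [set: PP] psymb.
Proof.
apply: measurable_funM => //; apply: measurable_funD;
  [exact: measurable_powR_fst|exact: measurable_powR_snd].
Qed.

Lemma pweightE zeta : (~` axes) zeta -> pweight zeta = weight alpha1 alpha2 theta zeta.
Proof.
move=> hz; have z1 : zeta.1 != 0 by apply/eqP => e; apply: hz; left.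
have z2 : zeta.2 != 0 by apply/eqP => e; apply: hz; right.
rewrite /pweight /weight /powR !normr_eq0 (negbTE z1) (negbTE z2) -expRD.
by congr expR; rewrite /logweight; ring.
Qed.

Lemma psymbE zeta : (~` axes) zeta -> psymb zeta = symb alpha1 alpha2 t zeta.
Proof.
move=> hz; have z1 : zeta.1 != 0 by apply/eqP => e; apply: hz; left.
have z2 : zeta.2 != 0 by apply/eqP => e; apply: hz; right.
by rewrite /psymb /symb /powR !normr_eq0 (negbTE z1) (negbTE z2).
Qed.

Lemma Rint_psymb (c1 c2 : R) (u v : R * R -> R) (w : PP) : rschwartz u -> rschwartz v ->
  \int[mu2]_zeta (pweight zeta * (cosint u zeta (psymb zeta - lin zeta w - c1) +
                                 cosint v zeta (psymb zeta - lin zeta w - c2))) =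
  propagator alpha1 alpha2 theta t c1 u w + propagator alpha1 alpha2 theta t c2 v w.
Proof.
move=> su sv.
have iu := integrable_osc t al1 al2 th su c1 w.
have iv := integrable_osc t al1 al2 th sv c2 w.
rewrite /propagator -RintegralD; [|exact: measurableT|exact: iu|exact: iv].
rewrite /Rintegral; apply: (congr1 fine).
have mp (x : R * R -> R) c : rschwartz x ->
    measurable_fun [set: PP] (fun zeta => cosint x zeta (psymb zeta - lin zeta w - c)).
  move=> sx; exact: (measurableT_comp
    (measurable_cosint_phase sx c measurableT measurable_psymb) (measurable_pair1 w)).
apply: ae_eq_integral => //.
- apply/measurable_EFinP; apply: measurable_funM.
    apply: measurable_funM; [exact: measurable_powR_fst|exact: measurable_powR_snd].
  by apply: measurable_funD; exact: mp.
- have := integrableD measurableT iu iv; exact: measurable_int.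
- exists axes; split; [exact: measurable_axes|exact: axes_null|].
  move=> zeta /= h; apply: contrapT => hz; apply: h => _.
  by rewrite pweightE // psymbE // /osc /= mulrDr.
Qed.

Lemma pairingE (z zeta : PP) : pairing z zeta = lin zeta z.
Proof. by rewrite /pairing /lin mulrC [z.2 * _]mulrC. Qed.

(** The addition theorem for the cosine, under the integral. *)
Lemma cosint_shift (u : R * R -> R) (zeta : PP) (c : R) : rschwartz u ->
  cosint u zeta c = cos c * cosint u zeta 0 - sin c * cosint u zeta (- (pi / 2)).
Proof.
move=> su; have i0 := integrable_cosint zeta 0 su; have i1 := integrable_cosint zeta (- (pi / 2)) su.
rewrite /cosint -!RintegralZl // -RintegralB //; try exact: integrableMl_cst.
by apply: eq_Rintegral => z _; rewrite addr0 cosBpihalf cosD; ring.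
Qed.

Lemma realM_complex (r x y : R) : r%:C * (x +i* y) = (r * x) +i* (r * y) :> R[i].
Proof. by apply/eqP; rewrite eq_complex /= !mul0r subr0 addr0 !eqxx. Qed.

Lemma Rint_leb2 (D : set PP) (f : PP -> R) : Rintegral (leb2 R) D f = Rintegral mu2 D f.
Proof. by []. Qed.

(** Real and imaginary parts of the product of [exp (i ...)] with the transform of [a + i b]
    are combinations of [cosint] whose shifts are quarter periods. *)
Lemma smoothed_propagatorE (f : PP -> R[i]) (w : PP) : schwartz f ->
  let a := fun z => Re (f z) in let b := fun z => Im (f z) in
  Re (T f w) = (2 * pi) ^- 2 * (propagator alpha1 alpha2 theta t 0 a w
                               + propagator alpha1 alpha2 theta t (pi / 2) b w) /\
  Im (T f w) = (2 * pi) ^- 2 * (propagator alpha1 alpha2 theta t 0 b w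
                               + propagator alpha1 alpha2 theta t (- (pi / 2)) a w).
Proof.
move=> [sa sb] a b.
have ia zeta c : mu2.-integrable [set: PP] (EFin \o (fun z : PP => a z * cos (lin zeta z + c))).
  exact: integrable_cosint.
have ib zeta c : mu2.-integrable [set: PP] (EFin \o (fun z : PP => b z * cos (lin zeta z + c))).
  exact: integrable_cosint.
have ff zeta : fourier f zeta = (cosint a zeta 0 + cosint b zeta (- (pi / 2))) +i*
    (cosint b zeta 0 - cosint a zeta (- (pi / 2))).
  rewrite /fourier /cintegral !Rint_leb2; congr (_ +i* _).
    rewrite /cosint -RintegralD; [|by []|exact: ia|exact: ib]; apply: eq_Rintegral => z _.
    rewrite pairingE /expi cosN sinN addr0 cosBpihalf /a /b.
    by case: (f z) => x y /=; ring.
  rewrite /cosint -RintegralB; [|by []|exact: ib|exact: ia]; apply: eq_Rintegral => z _.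
  rewrite pairingE /expi cosN sinN addr0 cosBpihalf /a /b.
  by case: (f z) => x y /=; ring.
have gg zeta : expi (pairing w zeta) * (D1_symbol (- ((1 - alpha1 / 2) * theta)) zeta
      * D2_symbol (- ((1 - alpha2 / 2) * theta)) zeta * U_symbol alpha1 alpha2 t zeta * fourier f zeta) =
   (pweight zeta * (cosint a zeta (psymb zeta - lin zeta w - 0) +
                    cosint b zeta (psymb zeta - lin zeta w - pi / 2))) +i*
   (pweight zeta * (cosint b zeta (psymb zeta - lin zeta w - 0) +
                    cosint a zeta (psymb zeta - lin zeta w - - (pi / 2)))).
  rewrite ff pairingE /D1_symbol /D2_symbol /U_symbol -/(psymb zeta) /expi.
  rewrite !(cosint_shift zeta (psymb zeta - _ - _)) // !subr0 opprK.
  rewrite cosBpihalf sinBpihalf cosDpihalf sinDpihalf cosB sinB cosN sinN /pweight.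
  by apply/eqP; rewrite eq_complex /=; apply/andP; split; apply/eqP; ring.
have E : T f w = ((2 * pi) ^- 2)%:C *
   ((propagator alpha1 alpha2 theta t 0 a w + propagator alpha1 alpha2 theta t (pi / 2) b w) +i*
    (propagator alpha1 alpha2 theta t 0 b w + propagator alpha1 alpha2 theta t (- (pi / 2)) a w)).
  rewrite /T /smoothed_propagator /multiplier /inv_fourier; congr (_ * _).
  rewrite /cintegral !Rint_leb2; congr (_ +i* _).
    by apply: etrans (Rint_psymb 0 (pi / 2) w sa sb); apply: eq_Rintegral => zeta _; rewrite gg.
  by apply: etrans (Rint_psymb 0 (- (pi / 2)) w sb sa); apply: eq_Rintegral => zeta _; rewrite gg.
by rewrite E realM_complex.
Qed.

End Identify.

(** * The estimate and its extension by density *)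

Section Assembly.
Context {R : realType}.
Notation RR := (measurableTypeR R).
Notation PP := (RR * RR)%type.
Notation mu2 := (sfprod (@lebesgue_measure R) (@lebesgue_measure R)).
Notation normc := (@ComplexField.Normc.normc R).
Notation Re := (@complex.Re R).
Notation Im := (@complex.Im R).

Lemma cmeasurable_schwartz (f : PP -> R[i]) : schwartz f -> cmeasurable f.
Proof. by move=> [sa sb]; split; exact: rschwartz_measurable. Qed.

Lemma cmeasurable_smoothed (alpha1 alpha2 theta t : R) (f : PP -> R[i]) :
  0 < alpha1 <= 2 -> 0 < alpha2 <= 2 -> 0 <= theta <= 1 -> schwartz f ->
  cmeasurable (smoothed_propagator alpha1 alpha2 ((1 - alpha1 / 2) * theta)
    ((1 - alpha2 / 2) * theta) t f).
Proof.
move=> al1 al2 th sf; have [sa sb] := sf.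
have mP (c : R) (u : R * R -> R) : rschwartz u ->
    measurable_fun [set: PP] (propagator alpha1 alpha2 theta t c u).
  by move=> su; exact: measurable_propagator.
have h := fun w => smoothed_propagatorE t al1 al2 th w sf.
split; [under eq_fun => w do rewrite (h w).1|under eq_fun => w do rewrite (h w).2].
all: by apply: measurable_funM => //; apply: measurable_funD; exact: mP.
Qed.

Lemma source_exponent_ge1 (theta : R) : 0 <= theta <= 1 -> (1 <= source_exponent theta)%E.
Proof.
move=> /andP[th0 th1]; rewrite lee_fin ler_pdivlMr ?ltr_wpDr // mul1r; lra.
Qed.

Lemma target_exponent_ge1 (theta : R) : 0 <= theta <= 1 -> (1 <= target_exponent theta)%E.
Proof.
move=> /andP[th0 th1]; rewrite /target_exponent; case: eqVneq => [_|th]; first by rewrite leey.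
have t1 : 0 < 1 - theta by rewrite subr_gt0 lt_neqAle th.
by rewrite lee_fin ler_pdivlMr // mul1r; lra.
Qed.

Lemma twopi_Vsqr_le1 : 0 <= (2 * pi : R) ^- 2 <= 1.
Proof.
have h : 1 <= 2 * (pi : R) by have := @pi_ge2 R; lra.
apply/andP; split; first by rewrite invr_ge0 exprn_ge0 // (le_trans ler01).
by rewrite invf_le1 ?exprn_ege1 // exprn_gt0 // (lt_le_trans ltr01).
Qed.

Lemma scaled_sum_le (r x y : R) : 0 <= r <= 1 -> `|r * (x + y)| <= `|x| + `|y|.
Proof.
move=> /andP[r0 r1]; rewrite normrM (ger0_norm r0).
by apply: le_trans (ler_normD x y); rewrite ler_piMl.
Qed.

(** The four real propagators of [smoothed_propagatorE] are summed by Minkowski's inequality;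
    the factor [(2 * pi)^-2] is at most one. *)
Lemma smoothed_cLnorm (alpha1 alpha2 theta : R) :
  0 < alpha1 <= 2 -> alpha1 != 1 -> 0 < alpha2 <= 2 -> alpha2 != 1 -> 0 <= theta <= 1 ->
  exists2 C : R, 0 < C & forall (t : R) (f : PP -> R[i]), t != 0 -> schwartz f ->
  (cLnorm (target_exponent theta) (smoothed_propagator alpha1 alpha2 ((1 - alpha1 / 2) * theta)
    ((1 - alpha2 / 2) * theta) t f) <=
    (C * `|t| `^ (- theta))%:E * cLnorm (source_exponent theta) f)%E.
Proof.
move=> al1 al1' al2 al2' th.
have [C C0 hC] := propagator_Lnorm al1 al1' al2 al2' th.
exists (4 * C) => [|t f t0 sf]; first by rewrite mulr_gt0.
have q1 := target_exponent_ge1 th; have p1 := source_exponent_ge1 th.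
set q := target_exponent theta in q1 hC *; set p := source_exponent theta in p1 hC *.
have q0 : (0 < q)%E by apply: lt_le_trans q1; rewrite lte_fin.
have p0 : (0 < p)%E by apply: lt_le_trans p1; rewrite lte_fin.
have [sa sb] := sf.
pose a := fun z => Re (f z); pose b := fun z => Im (f z).
pose P c u := propagator alpha1 alpha2 theta t c u.
have mP (c : R) (u : R * R -> R) : rschwartz u -> measurable_fun [set: PP] (fun w => `|P c u w|).
  by move=> su; apply: measurableT_comp => //; exact: measurable_propagator.
have mT := cmeasurable_smoothed t al1 al2 th sf.
have mf := cmeasurable_schwartz sf.
have K0 : 0 <= C * `|t| `^ (- theta) by rewrite mulr_ge0 ?powR_ge0 // ltW.
set K := C * `|t| `^ (- theta) in K0 *.
have la : (Lnorm mu2 p (EFin \o (a : PP -> R)) <= cLnorm p f)%E.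
  apply: (@Lnorm_mono _ p _ (fun z => normc (f z))) => //; [exact: mf.1|exact: measurable_normc|].
  by move=> z; rewrite (ger0_norm (normc_ge0 _)) normr_Re_le.
have lb : (Lnorm mu2 p (EFin \o (b : PP -> R)) <= cLnorm p f)%E.
  apply: (@Lnorm_mono _ p _ (fun z => normc (f z))) => //; [exact: mf.2|exact: measurable_normc|].
  by move=> z; rewrite (ger0_norm (normc_ge0 _)) normr_Im_le.
have bnd c u : rschwartz u -> (Lnorm mu2 p (EFin \o (u : PP -> R)) <= cLnorm p f)%E ->
    (Lnorm mu2 q (EFin \o (fun w => `|P c u w|)%R) <= K%:E * cLnorm p f)%E.
  move=> su lu; rewrite Lnorm_normr; apply: le_trans (hC t c u t0 su) _.
  by rewrite lee_wpmul2l ?lee_fin.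
pose g1 w := `|P 0 a w| + `|P (pi / 2) b w|.
pose g2 w := `|P 0 b w| + `|P (- (pi / 2)) a w|.
have mg1 : measurable_fun [set: PP] g1 by apply: measurable_funD; exact: mP.
have mg2 : measurable_fun [set: PP] g2 by apply: measurable_funD; exact: mP.
have -> : ((4 * C * `|t| `^ (- theta))%:E * cLnorm p f =
   (K%:E * cLnorm p f + K%:E * cLnorm p f) + (K%:E * cLnorm p f + K%:E * cLnorm p f))%E.
  have L0 : (0 <= cLnorm p f)%E by exact: Lnorm_ge0.
  by rewrite -!ge0_muleDl ?lee_fin ?addr_ge0 // -!EFinD; congr (_%:E * _)%E; rewrite /K; ring.
apply: (@le_trans _ _ (Lnorm mu2 q (EFin \o (g1 \+ g2)))).
  apply: (@Lnorm_mono R q _ (g1 \+ g2) q0 (measurable_normc mT) (measurable_funD mg1 mg2)) => w.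
  rewrite (ger0_norm (normc_ge0 _)) [leRHS]ger0_norm ?addr_ge0 //.
  apply: le_trans (normc_le_ReIm _) _.
  have [-> ->] := smoothed_propagatorE t al1 al2 th w sf.
  by apply: lerD; exact: scaled_sum_le twopi_Vsqr_le1.
apply: le_trans (eminkowski mu2 mg1 mg2 q1) _; apply: leeD.
- apply: le_trans (eminkowski mu2 (mP 0 _ sa) (mP (pi / 2) _ sb) q1) _.
  by apply: leeD; exact: bnd.
- apply: le_trans (eminkowski mu2 (mP 0 _ sb) (mP (- (pi / 2)) _ sa) q1) _.
  by apply: leeD; exact: bnd.
Qed.

(** Minkowski's inequality twice: [g] is close to [T (fn n)], whose norm is controlled by that of
    [fn n], which is close to that of [f]. *)
Lemma density_bound (p q : \bar R) (T : (PP -> R[i]) -> PP -> R[i]) (K : R) :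
  (1 <= p)%E -> (1 <= q)%E -> 0 < K ->
  (forall f, schwartz f -> cmeasurable (T f)) ->
  (forall f, schwartz f -> (cLnorm q (T f) <= K%:E * cLnorm p f)%E) ->
  forall f g, density_extension p q T f g -> (cLnorm q g <= K%:E * cLnorm p f)%E.
Proof.
move=> p1 q1 K0 mT bT f g [mf ff mg [fn [sfn cf cg]]].
have L0 : (0 <= cLnorm p f)%E by exact: Lnorm_ge0.
apply/lee_addgt0Pr => e e0.
(* An error [d] in both norms costs at most [d + K * d <= e]. *)
pose d := e / 2 / Num.max 1 K.
have M1 : 1 <= Num.max 1 K by rewrite le_max lexx.
have d0 : 0 < d by rewrite !divr_gt0 // (lt_le_trans ltr01).
have step n : (cLnorm q g <= cLnorm q (fun z => T (fn n) z - g z)%R +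
    K%:E * (cLnorm p (fun z => fn n z - f z)%R + cLnorm p f))%E.
  have mTn := mT _ (sfn n); have mfn := cmeasurable_schwartz (sfn n).
  apply: (@le_trans _ _ (cLnorm q (fun z => g z - T (fn n) z)%R + cLnorm q (T (fn n)))%E).
    apply: cLnorm_triangle => //; first exact: cmeasurableB.
    by move=> z; exact: normc_triangle.
  rewrite cLnormB_sym leeD2l //; apply: le_trans (bT _ (sfn n)) _.
  rewrite lee_wpmul2l ?lee_fin ?(ltW K0) //.
  apply: cLnorm_triangle => //; first exact: cmeasurableB.
  by move=> z; exact: normc_triangle.
have small (x : nat -> \bar R) : x @ \oo --> 0%E -> \forall n \near \oo, (x n <= d%:E)%E.
  move=> cx; have d0' : ((0 : R)%:E < d%:E)%E by rewrite lte_fin.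
  by have [N _ hN] := cx _ (open_ereal_lt' d0'); exists N => // n /hN /ltW.
have [n _ hn] := filterI (small _ cg) (small _ cf).
have [h1 h2] := hn n (leqnn n).
apply: le_trans (step n) _.
apply: (@le_trans _ _ (d%:E + K%:E * (d%:E + cLnorm p f))%E).
  by apply: leeD => //; rewrite lee_wpmul2l ?lee_fin ?(ltW K0) // leeD2r.
rewrite ge0_muleDr ?lee_fin ?(ltW d0) // addeA addeC leeD2l // -EFinM -EFinD lee_fin.
have MK : K <= Num.max 1 K by rewrite le_max lexx orbT.
have dM : d * Num.max 1 K = e / 2 by rewrite /d divfK // gt_eqF // (lt_le_trans ltr01).
rewrite [leRHS](splitr e); apply: lerD; rewrite -dM; first by rewrite ler_peMr // ltW.
by rewrite mulrC ler_pM2l.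
Qed.

End Assembly.

Theorem proposition3p1 (R : realType) (alpha1 alpha2 theta : R)
    (halpha1 : 0 < alpha1 <= 2) (halpha1' : alpha1 != 1)
    (halpha2 : 0 < alpha2 <= 2) (halpha2' : alpha2 != 1)
    (halpha : alpha2 <= alpha1)
    (htheta : 0 <= theta <= 1) :
  let beta1 := 1 - alpha1 / 2 in
  let beta2 := 1 - alpha2 / 2 in
  let p := source_exponent theta in
  let q := target_exponent theta in
  let T := smoothed_propagator alpha1 alpha2 (beta1 * theta) (beta2 * theta) in
  exists2 C : R, 0 < C & forall t : R, t != 0 ->
    (forall f : plane R -> complex R, schwartz f ->
      (cLnorm q (T t f) <= (C * `|t| `^ (- theta))%:E * cLnorm p f)%E) /\
    (forall f Tf : plane R -> complex R, density_extension p q (T t) f Tf ->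
      (cLnorm q Tf <= (C * `|t| `^ (- theta))%:E * cLnorm p f)%E).
Proof.
move=> beta1 beta2 p q T.
have [C C0 hC] := smoothed_cLnorm halpha1 halpha1' halpha2 halpha2' htheta.
exists C => // t t0; split; first by move=> f sf; exact: hC.
move=> f Tf; apply: density_bound.
- exact: source_exponent_ge1.
- exact: target_exponent_ge1.
- by rewrite mulr_gt0 // powR_gt0 // normr_gt0.
- by move=> g sg; exact: cmeasurable_smoothed.
- by move=> g sg; exact: hC.
Qed.
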